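(* Let $\mathbf S=\{\mathbf S_{i,j}\}$ be the universal model associated with the abstract noncommutative variety $\mathcal V^{\mathbf m}_{\mathbf f,J}$, where $J$ is a WOT-closed left ideal of $F^\infty(\mathbf D^{\mathbf m}_{\mathbf f})$, and let $\mathbf T=\{T_{i,j}\}$ be a pure element in the noncommutative variety $\mathcal V^{\mathbf m}_{\mathbf f,J}(\mathcal H)$. Put $\mathcal D=\overline{\Delta^{\mathbf m}_{\mathbf f,\mathbf T}(I)(\mathcal H)}$ and let $\mathbf K_{\mathbf f,\mathbf T,J}:\mathcal H\to\mathcal N_J\otimes\mathcal D$ be the noncommutative constrained Berezin kernel. Then the subspace $\mathbf K_{\mathbf f,\mathbf T,J}\mathcal H$ is co-invariant under each operator $\mathbf S_{i,j}\otimes I_{\mathcal D}$, $i\in\{1,\dots,k\}$, $j\in\{1,\dots,n_i\}$. If $1\in\mathcal N_J$, then the dilation provided by the relation $$\mathbf T_{(\alpha)}=\mathbf K_{\mathbf f,\mathbf T,J}^*(\mathbf S_{(\alpha)}\otimes I_{\mathcal D})\mathbf K_{\mathbf f,\mathbf T,J},\qquad(\alpha)\in\mathbb F^+_{n_1}\times\cdots\times\mathbb F^+_{n_k},$$ is minimal. If, in addition, $\mathbf f=\mathbf q=(q_1,\dots,q_k)$ is a $k$-tuple of positive regular noncommutative polynomials and $$\overline{\mathrm{span}}\{\mathbf S_{(\alpha)}\mathbf S_{(\beta)}^*:\ (\alpha),(\beta)\in\mathbb F^+_{n_1}\times\cdots\times\mathbb F^+_{n_k}\}=C^*(\mathbf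 S_{i,j}),$$ then the minimal dilation of $\mathbf T$ is unique up to an isomorphism.
   Context: Fix $k\ge 1$ and $(n_1,\dots,n_k)$, $\mathbf m=(m_1,\dots,m_k)$ in $\mathbb N^k$, $\mathbb N=\{1,2,\dots\}$. Hilbert spaces are complex and separable. $\mathbb F^+_{n_i}$ is the free unital semigroup on generators $g^i_1,\dots,g^i_{n_i}$ with identity $g^i_0$; $|\alpha|$ is word length. For $X_i=(X_{i,1},\dots,X_{i,n_i})$ and $\alpha=g^i_{j_1}\cdots g^i_{j_p}$ put $X_{i,\alpha}=X_{i,j_1}\cdots X_{i,j_p}$, $X_{i,g^i_0}=I$; for $\mathbf X=(X_1,\dots,X_k)$ and $(\alpha)=(\alpha_1,\dots,\alpha_k)$ put $\mathbf X_{(\alpha)}=X_{1,\alpha_1}\cdots X_{k,\alpha_k}$. $\mathbf f=(f_1,\dots,f_k)$, where each $f_i=\sum_{\alpha\in\mathbb F^+_{n_i}}a_{i,\alpha}Z_{i,\alpha}$ is a positive regular free holomorphic function: $a_{i,\alpha}\ge0$, $a_{i,g^i_0}=0$, $a_{i,g^i_j}>0$ for $1\le j\le n_i$, and $\limsup_{p\to\infty}(\sum_{|\alpha|=p}|a_{i,\alpha}|^2)^{1/2p}<\infty$; a positive regular polynomial is such an $f_i$ with finitely many nonzero coefficients. Put $\Phi_{f_i,X_i}(Y)=\sum_{|\alpha|\ge1}a_{i,\alpha}X_{i,\alpha}YX_{i,\alpha}^*$ (weak operator convergence) and $\Delta^{\mathbf p}_{\mathbf f,\mathbf X}=(id-\Phi_{f_1,X_1})^{p_1}\circ\cdots\circ(id-\Phi_{f_k,X_k})^{p_k}$,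 $\mathbf p\in\mathbb Z_+^k$. $\mathbf D^{\mathbf m}_{\mathbf f}(\mathcal H)$ is the set of all $\mathbf X\in B(\mathcal H)^{n_1}\times\cdots\times B(\mathcal H)^{n_k}$ such that the entries of $X_s$ commute with those of $X_t$ for $s\ne t$ and $\Delta^{\mathbf p}_{\mathbf f,\mathbf X}(I)\ge0$ for all $\mathbf 0\le\mathbf p\le\mathbf m$ (componentwise). $\mathbf X$ is pure if $\lim_{\mathbf q\in\mathbb Z_+^k}(id-\Phi_{f_k,X_k}^{q_k})\cdots(id-\Phi_{f_1,X_1}^{q_1})(I)=I$ (weak operator topology). $F^2(H_{n_i})=\mathbb C1\oplus\bigoplus_{p\ge1}H_{n_i}^{\otimes p}$ is the full Fock space over an $n_i$-dimensional Hilbert space, with orthonormal basis $\{e^i_\alpha\}_{\alpha\in\mathbb F^+_{n_i}}$, $e^i_{g^i_0}=1$. Set $b^{(m_i)}_{i,g^i_0}=1$ and $b^{(m_i)}_{i,\alpha}=\sum_{p=1}^{|\alpha|}\sum_{\gamma_1\cdots\gamma_p=\alpha,\,|\gamma_s|\ge1}a_{i,\gamma_1}\cdots a_{i,\gamma_p}\binom{p+m_i-1}{m_i-1}$ for $|\alpha|\ge1$; $W_{i,j}e^i_\alpha=\sqrt{b^{(m_i)}_{i,\alpha}/b^{(m_i)}_{i,g^i_j\alpha}}\;e^i_{g^i_j\alpha}$; $\mathbf W_{i,j}=I\otimes\cdots\otimes W_{i,j}\otimes\cdots\otimes I$ ($i$-th factor) on $\otimes_{i=1}^kF^2(H_{n_i})$.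 $F^\infty(\mathbf D^{\mathbf m}_{\mathbf f})$ is the sequential SOT- (equivalently WOT-, $w^*$-) closure of the polynomials in the $\mathbf W_{i,j}$ and $I$; each $g$ in it has a unique Fourier representation $g=\sum_{(\beta)}c_{(\beta)}\mathbf W_{(\beta)}$, and for pure $\mathbf X\in\mathbf D^{\mathbf m}_{\mathbf f}(\mathcal H)$, $g(\mathbf X)=\text{SOT-}\lim_{r\to1}\sum_{q\ge0}\sum_{|\beta_1|+\cdots+|\beta_k|=q}r^qc_{(\beta)}\mathbf X_{(\beta)}$. $\mathcal M_J$ is the closure of $J(\otimes_iF^2(H_{n_i}))$, $\mathcal N_J=[\otimes_iF^2(H_{n_i})]\ominus\mathcal M_J$, always assumed $\ne\{0\}$; $\mathbf S_{i,j}=P_{\mathcal N_J}\mathbf W_{i,j}|_{\mathcal N_J}$; $1$ is the vacuum vector of $\otimes_iF^2(H_{n_i})$. $C^*(\mathbf S_{i,j})$ is the $C^*$-algebra generated by all $\mathbf S_{i,j}$ and $I$. A pure element of $\mathcal V^{\mathbf m}_{\mathbf f,J}(\mathcal H)$ is a pure $\mathbf T\in\mathbf D^{\mathbf m}_{\mathbf f}(\mathcal H)$ with $g(\mathbf T)=0$ for all $g\in J$. The constrained Berezin kernel is $\mathbf K_{\mathbf f,\mathbf T,J}=(P_{\mathcal N_J}\otimes I)\mathbf K_{\mathbf f,\mathbf T}$, where $$\mathbf K_{\mathbf f,\mathbf T}h=\sum_{\beta_1,\dots,\beta_k}\sqrt{b^{(m_1)}_{1,\beta_1}}\cdots\sqrt{b^{(m_k)}_{k,\beta_k}}\;e^1_{\beta_1}\otimes\cdots\otimes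 e^k_{\beta_k}\otimes\Delta^{\mathbf m}_{\mathbf f,\mathbf T}(I)^{1/2}T_{1,\beta_1}^*\cdots T_{k,\beta_k}^*h .$$ A subspace is co-invariant under an operator $X$ if it is invariant under $X^*$. A dilation of $\mathbf T$ here consists of a Hilbert space $\mathcal D'$ and an isometry $V:\mathcal H\to\mathcal N_J\otimes\mathcal D'$ with $V\mathcal H$ co-invariant under each $\mathbf S_{i,j}\otimes I_{\mathcal D'}$ and $\mathbf T_{(\alpha)}=V^*(\mathbf S_{(\alpha)}\otimes I_{\mathcal D'})V$ for all $(\alpha)$; it is minimal if $\mathcal N_J\otimes\mathcal D'$ is the closed span of all $(\mathbf S_{(\alpha)}\otimes I_{\mathcal D'})V\mathcal H$. Two dilations $(\mathcal D_1,V_1)$, $(\mathcal D_2,V_2)$ are isomorphic if there is a unitary $U:\mathcal N_J\otimes\mathcal D_1\to\mathcal N_J\otimes\mathcal D_2$ with $U(\mathbf S_{i,j}\otimes I_{\mathcal D_1})=(\mathbf S_{i,j}\otimes I_{\mathcal D_2})U$ for all $i,j$ and $UV_1=V_2$. *)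

(* Defs.v *)
From HB Require Import structures.
From mathcomp Require Import all_boot all_order all_algebra complex.
From mathcomp Require Import all_classical all_reals all_analysis.

Set Implicit Arguments.
Unset Strict Implicit.
Unset Printing Implicit Defensive.

Import Order.TTheory GRing.Theory Num.Theory ComplexField.
Import numFieldNormedType.Exports.

Local Open Scope classical_set_scope.
Local Open Scope complex_scope.
Local Open Scope ring_scope.

(* The inner product is linear in its first variable. Positive definiteness is
   contained in hdot_norm. *)
HB.mixin Record isHilbert (R : realType) H
    & CompleteNormedModule R[i] H := {
  hdot : H -> H -> R[i] ;
  hdot_linear : forall (a : R[i]) (x x' y : H),
    hdot (a *: x + x') y = a * hdot x y + hdot x' y ;
  hdotC : forall x y : H, hdot y x = (hdot x y)^* ;
  hdot_norm : forall x : H, `|x| ^+ 2 = hdot x x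
}.

#[short(type="hilbertType")]
HB.structure Definition Hilbert (R : realType) :=
  {H of CompleteNormedModule R[i] H & isHilbert R H}.

Definition separable (T : topologicalType) :=
  exists2 A : set T, countable A & dense A.

Definition lspan (K : pzRingType) (V : lmodType K) (A : set V) : set V :=
  [set x | exists (N : nat) (c : 'I_N -> K) (v : 'I_N -> V),
    (forall l, A (v l)) /\ x = \sum_l c l *: v l].

Section BoundedOperators.
Context {R : realType} (U V : normedModType R[i]).

Definition blin : {pred (U -> V)} :=
  [pred f : U -> V | `[< linear f /\ continuous f >]].

Lemma blin_submod : submod_closed blin.
Proof.
split.
  apply/asboolP; split=> [a x y|x]; last exact: cst_continuous.
  by rewrite scaler0 addr0.
move=> a f g /asboolP[lf cf] /asboolP[lg cg]; apply/asboolP; split.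
  move=> b x y; rewrite !fctE lf lg !scalerDr !scalerA addrACA.
  by rewrite (mulrC a b).
by move=> x; apply: cvgD; [apply: cvgZr; exact: cf|exact: cg].
Qed.

HB.instance Definition _ := GRing.isSubmodClosed.Build R[i] (U -> V) blin blin_submod.

Record bop := BOp { bop_fun :> U -> V ; bop_subproof : bop_fun \in blin }.

HB.instance Definition _ := [isSub for bop_fun].
HB.instance Definition _ := [Choice of bop by <:].
HB.instance Definition _ := [SubChoice_isSubLmodule of bop by <:].

Lemma bop_linear (A : bop) : linear A.
Proof. by case: A => f fP; case/asboolP: (fP). Qed.

Lemma bop_continuous (A : bop) : continuous A.
Proof. by case: A => f fP; case/asboolP: (fP). Qed.

End BoundedOperators.


Section BoundedOperatorsTheory.
Context {R : realType}.

Lemma bop_id_subproof (U : normedModType R[i]) : (idfun : U -> U) \in @blin R U U.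
Proof. by apply/asboolP; split=> [a x y //|x]; exact: cvg_id. Qed.

Definition bop_id (U : normedModType R[i]) : bop U U := BOp (@bop_id_subproof U).

Lemma bop_comp_subproof (U V W : normedModType R[i]) (B : bop V W)
  (A : bop U V) : B \o A \in @blin R U W.
Proof.
apply/asboolP; split=> [a x y|x] /=; first by rewrite !bop_linear.
by apply: continuous_comp; exact: bop_continuous.
Qed.

Definition bop_comp (U V W : normedModType R[i]) (B : bop V W) (A : bop U V) :
  bop U W := BOp (bop_comp_subproof B A).

End BoundedOperatorsTheory.

Notation "B \oB A" := (bop_comp B A) (at level 50, left associativity).
Arguments bop_id {R U}.

Section HilbertTheory.
Context {R : realType} (H : hilbertType R).
Implicit Types x y z : H.

Lemma hdotDl x x' y : hdot (x + x') y = hdot x y + hdot x' y.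
Proof. by have := hdot_linear 1 x x' y; rewrite scale1r mul1r. Qed.

Lemma hdot0l y : hdot (0 : H) y = 0.
Proof. by apply: (addrI (hdot (0 : H) y)); rewrite -hdotDl !addr0. Qed.

Lemma hdotZl a x y : hdot (a *: x) y = a * hdot x y.
Proof. by have := hdot_linear a x 0 y; rewrite hdot0l !addr0. Qed.

Lemma hdotNl x y : hdot (- x) y = - hdot x y.
Proof. by rewrite -scaleN1r hdotZl mulN1r. Qed.

Lemma hdotDr x y y' : hdot x (y + y') = hdot x y + hdot x y'.
Proof. by rewrite (hdotC (y + y') x) hdotDl rmorphD (hdotC y x) (hdotC y' x). Qed.

Lemma hdotZr a x y : hdot x (a *: y) = a^* * hdot x y.
Proof. by rewrite (hdotC (a *: y) x) hdotZl rmorphM (hdotC y x). Qed.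

Lemma hdot0r x : hdot x (0 : H) = 0.
Proof. by rewrite (hdotC 0 x) hdot0l rmorph0. Qed.

Lemma hdotNr x y : hdot x (- y) = - hdot x y.
Proof. by rewrite -scaleN1r hdotZr rmorphN1 mulN1r. Qed.

Lemma hdot_eq0 x : hdot x x = 0 -> x = 0.
Proof. by rewrite -hdot_norm => /eqP; rewrite sqrf_eq0 normr_eq0 => /eqP. Qed.

Lemma cauchy_schwarz x y : `|hdot x y| <= `|x| * `|y|.
Proof.
have [->|y0] := eqVneq y 0; first by rewrite hdot0r !normr0 mulr0.
have ny : 0 < `|y| by rewrite normr_gt0.
pose a := hdot x y / `|y| ^+ 2.
have : 0 <= hdot (x - a *: y) (x - a *: y) by rewrite -hdot_norm exprn_ge0.
have aE : a * hdot y y = hdot x y by rewrite /a -hdot_norm divfK// expf_neq0// gt_eqF.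
rewrite hdotDr hdotNr hdotZr !hdotDl !hdotNl !hdotZl aE subrr mulr0 subr0.
rewrite -hdot_norm (hdotC x y) /a mulrAC -normCK subr_ge0 ler_pdivrMr ?exprn_gt0//.
by rewrite -exprMn ler_pXn2r// nnegrE ?mulr_ge0.
Qed.

End HilbertTheory.

Record csubspace (R : realType) (H : hilbertType R) := CSubspace {
  cset : set H ;
  cset_closed : closed cset ;
  cset0 : cset 0 ;
  cset_lin : forall (a : R[i]) (x y : H), cset x -> cset y -> cset (a *: x + y)
}.

Section SubHilbert.
Context {R : realType} {H : hilbertType R} (M : csubspace H).

Definition cpred : {pred H} := [pred x : H | `[< cset M x >]].

Lemma cpred_submod : submod_closed cpred.
Proof.
split; first exact/asboolP/cset0.
by move=> a x y /asboolP Mx /asboolP My; apply/asboolP/cset_lin.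
Qed.

HB.instance Definition _ := GRing.isSubmodClosed.Build R[i] H cpred cpred_submod.

Record subH := SubH { sub_val :> H ; sub_subproof : sub_val \in cpred }.

HB.instance Definition _ := [isSub for sub_val].
HB.instance Definition _ := [Choice of subH by <:].
HB.instance Definition _ := [SubChoice_isSubLmodule of subH by <:].

Definition norm_sub (x : subH) : R[i] := `|sub_val x|.

Fact norm_subD x y : norm_sub (x + y) <= norm_sub x + norm_sub y.
Proof. exact: ler_normD. Qed.

Fact norm_subZ (a : R[i]) x : norm_sub (a *: x) = `|a| * norm_sub x.
Proof. exact: normrZ. Qed.

Fact norm_sub_eq0 x : norm_sub x = 0 -> x = 0.
Proof. by move=> /normr0_eq0 x0; exact: val_inj. Qed.

HB.instance Definition _ :=
  Lmodule_isNormed.Build R[i] subH norm_subD norm_subZ norm_sub_eq0.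

Fact sub_complete (F : set_system subH) : ProperFilter F -> cauchy F -> cvg F.
Proof.
move=> FF /cauchy_ballP Fc.
have cG : cauchy (sub_val @ F).
  apply/cauchy_ballP => e e0; have [[A B] /= [FA FB] AB] := Fc e e0.
  exists (sub_val @` A, sub_val @` B) => /=.
    by split; [apply: filterS FA|apply: filterS FB] => x ?; exists x.
  move=> [_ _] /= [[x Ax <-] [y By <-]].
  by have := AB (x, y) (conj Ax By); rewrite -!ball_normE.
have /cvg_ex[l Gl] : cvg (sub_val @ F) by exact: cauchy_cvg.
have Ml : cset M l.
  apply: (@closed_cvg _ _ _ _ sub_val (cset M)) Gl; first exact: cset_closed.
  by apply: nearW => x; apply/asboolP/sub_subproof.
have lP : l \in cpred by apply/asboolP.
apply/cvg_ex; exists (SubH lP); apply/cvgrPdist_lt => e e0.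
by move/cvgrPdist_lt : Gl => /(_ e e0).
Qed.

HB.instance Definition _ := Uniform_isComplete.Build subH sub_complete.

Definition hdot_sub (x y : subH) : R[i] := hdot (sub_val x) (sub_val y).

Fact hdot_sub_linear (a : R[i]) x x' y :
  hdot_sub (a *: x + x') y = a * hdot_sub x y + hdot_sub x' y.
Proof. exact: hdot_linear. Qed.

Fact hdot_subC x y : hdot_sub y x = (hdot_sub x y)^*.
Proof. exact: hdotC. Qed.

Fact hdot_sub_norm (x : subH) : `|x| ^+ 2 = hdot_sub x x.
Proof. exact: hdot_norm. Qed.

HB.instance Definition _ :=
  isHilbert.Build R subH hdot_sub_linear hdot_subC hdot_sub_norm.

End SubHilbert.

Section Subspaces.
Context {R : realType} {H : hilbertType R}.

Lemma hdot_continuousl (x : H) : continuous (fun y : H => hdot y x : R[i]^o).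
Proof.
move=> y; apply/cvgrPdist_lt => e e0.
have n0 : 0 < `|x| + 1 by rewrite ltr_wpDl.
near=> z; rewrite -[hdot y x - _]/(hdot y x + - hdot z x) -hdotNl -hdotDl.
apply: le_lt_trans (cauchy_schwarz _ _) _.
apply: (@le_lt_trans _ _ (`|y - z| * (`|x| + 1))); first by rewrite ler_wpM2l// lerDl.
rewrite -ltr_pdivlMr//; near: z.
have /cvgrPdist_lt := @cvg_id _ (nbhs y); apply; rewrite divr_gt0.
Unshelve. all: by end_near. Qed.

Lemma closed_orth (A : set H) :
  closed [set y : H | forall x, A x -> hdot y x = 0].
Proof.
have -> : [set y : H | forall x, A x -> hdot y x = 0] =
    \bigcap_(x in A) [set y : H | hdot y x = 0] by [].
apply: closed_bigI => x _.
have := @preimage_closed _ _ (fun y : H => hdot y x : R[i]^o) [set 0]; apply.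
  move=> y _; exact: hdot_continuousl.
have := @accessible_closed_set1 R[i]^o; apply.
exact: hausdorff_accessible (@norm_hausdorff _ R[i]^o).
Qed.

Fact orth0 (A : set H) x : A x -> hdot 0 x = 0.
Proof. by rewrite hdot0l. Qed.

Fact orth_lin (A : set H) (a : R[i]) (y z : H) :
  (forall x, A x -> hdot y x = 0) -> (forall x, A x -> hdot z x = 0) ->
  forall x, A x -> hdot (a *: y + z) x = 0.
Proof. by move=> Ay Az x Ax; rewrite hdot_linear Ay// Az// mulr0 addr0. Qed.

Definition orth (A : set H) : csubspace H :=
  CSubspace (@closed_orth A) (@orth0 A) (@orth_lin A).

Lemma closure_normP (A : set H) (x : H) :
  closure A x <-> forall e : R[i], 0 < e -> exists2 z, A z & `|x - z| < e.
Proof.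
split=> [clA e e0|h B].
  have [|z [Az]] := clA (ball x e); first exact: nbhsx_ballx.
  by rewrite -ball_normE /= => xz; exists z.
move=> /nbhs_ballP[e /= e0 eB]; have [z Az xz] := h e e0.
by exists z; split => //; apply: eB; rewrite -ball_normE.
Qed.

Fact range0 (U : normedModType R[i]) (A : bop U H) : closure (range A) 0.
Proof.
apply: subset_closure; exists 0 => //.
have := bop_linear A 1 0 0; rewrite !scale1r !addr0 => h.
by apply: (addrI (A 0)); rewrite addr0.
Qed.

Fact range_lin (U : normedModType R[i]) (A : bop U H) (a : R[i]) (x y : H) :
  closure (range A) x -> closure (range A) y -> closure (range A) (a *: x + y).
Proof.
move=> /closure_normP cx /closure_normP cy; apply/closure_normP => e e0.
have a0 : 0 < `|a| + 1 by rewrite ltr_wpDl.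
have e20 : 0 < e / 2 by rewrite divr_gt0.
have [_ [u _ <-] xu] := cx (e / 2 / (`|a| + 1)) (divr_gt0 e20 a0).
have [_ [v _ <-] yv] := cy (e / 2) e20.
exists (A (a *: u + v)); first by exists (a *: u + v).
rewrite bop_linear opprD addrACA -scalerBr [ltRHS]splitr.
apply: le_lt_trans (ler_normD _ _) _; apply: ler_ltD => //.
rewrite normrZ; apply: (@le_trans _ _ ((`|a| + 1) * `|x - A u|)).
  by rewrite ler_wpM2r// lerDl.
by rewrite mulrC -ler_pdivlMr// ltW.
Qed.

Definition closed_range (U : normedModType R[i]) (A : bop U H) : csubspace H :=
  CSubspace (@closed_closure _ (range A)) (@range0 U A) (@range_lin U A).

End Subspaces.

Lemma sub_incl_subproof (R : realType) (H : hilbertType R) (M : csubspace H) :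
  (@sub_val R H M : subH M -> H) \in @blin R (subH M) H.
Proof.
apply/asboolP; split=> [a x y //|x].
have h V := @cvgrPdist_lt R[i] V _ (nbhs x) (nbhs_filter x).
apply/h => e e0.
exact: ((h (subH M) idfun x).1 (@cvg_id _ (nbhs x)) e e0).
Qed.

Section HilbertOperators.
Context {R : realType}.
Implicit Types U V H : hilbertType R.

Definition incl H (M : csubspace H) : bop (subH M) H :=
  BOp (sub_incl_subproof M).

(* The operators below are introduced by their defining property: xget 0 P is
   an element of P (unique in each case), and 0 if there is none. *)

(* Orthogonal projection onto M, with M as codomain. *)
Definition proj H (M : csubspace H) : bop H (subH M) :=
  xget 0 [set P : bop H (subH M) |
    forall (x : H) (y : subH M), hdot (x - incl M (P x)) (incl M y) = 0].

Definition adj U V (A : bop U V) : bop V U :=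
  xget 0 [set B : bop V U | forall x y, hdot (A x) y = hdot x (B y)].

Definition positive_op H (A : bop H H) := forall x : H, 0 <= hdot (A x) x.

Definition sqrt_op H (A : bop H H) : bop H H :=
  xget 0 [set Q : bop H H | positive_op Q /\ Q \oB Q = A].

Definition isometric U V (A : bop U V) := forall x : U, `|A x| = `|x|.

Definition unitary U V (A : bop U V) :=
  adj A \oB A = bop_id /\ A \oB adj A = bop_id.

Definition coinvariant H (A : bop H H) (M : set H) :=
  forall x, M x -> M (adj A x).

Definition wot_cvg U V (T : Type) (F : set_system T) (A : T -> bop U V)
    (B : bop U V) :=
  forall x y, (fun t => hdot (A t x) y : R[i]^o) @ F --> (hdot (B x) y : R[i]^o).

(* Closedness in the weak operator topology, through limits of filters. *)
Definition wot_closed U V (J : set (bop U V)) :=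
  forall (F : set_system (bop U V)) (B : bop U V),
    ProperFilter F -> F J -> wot_cvg F id B -> J B.

Definition norm_closure U V (J : set (bop U V)) : set (bop U V) :=
  [set A | forall e : R[i], 0 < e ->
    exists2 B, J B & forall x : U, `|A x - B x| <= e * `|x|].

Definition Cstar_gen H (G : set (bop H H)) : set (bop H H) :=
  \bigcap_(A in [set A : set (bop H H) |
      [/\ G `<=` A, A bop_id,
        (forall (a : R[i]) B B', A B -> A B' -> A (a *: B + B')),
        (forall B B', A B -> A B' -> A (B \oB B')) &
        (forall B, A B -> A (adj B)) /\ norm_closure A `<=` A]]) A.

End HilbertOperators.

(* Hilbert tensor products, which are determined up to a canonical unitary, are
   given by any Hilbert space that realizes them. *)
Record htensor (R : realType) (k : nat) (F : 'I_k -> hilbertType R) := HTensor {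
  tspace :> hilbertType R ;
  tens : (forall i, F i) -> tspace ;
  tens_linear : forall (x : forall i, F i) i (a : R[i]) (u v : F i),
    tens (eqtype.dfwith x (a *: u + v)) = a *: tens (eqtype.dfwith x u) + tens (eqtype.dfwith x v) ;
  tens_dot : forall x y, hdot (tens x) (tens y) = \prod_i hdot (x i) (y i) ;
  tens_total : closure (lspan (range tens)) = setT
}.

Record htensor2 (R : realType) (A B : hilbertType R) := HTensor2 {
  tspace2 :> hilbertType R ;
  tens2 : A -> B -> tspace2 ;
  tens2_linearl : forall (a : R[i]) x x' y,
    tens2 (a *: x + x') y = a *: tens2 x y + tens2 x' y ;
  tens2_linearr : forall (a : R[i]) x y y',
    tens2 x (a *: y + y') = a *: tens2 x y + tens2 x y' ;
  tens2_dot : forall x y x' y',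
    hdot (tens2 x y) (tens2 x' y') = hdot x x' * hdot y y' ;
  tens2_total : closure (lspan [set z | exists x y, z = tens2 x y]) = setT
}.

Definition op_tens2 (R : realType) (A B A' B' : hilbertType R)
    (E : htensor2 A B) (E' : htensor2 A' B') (X : bop A A') (Y : bop B B') :
    bop E E' :=
  xget 0 [set Z : bop E E' |
    forall x y, Z (tens2 E x y) = tens2 E' (X x) (Y y)].

(* I (x) .. (x) X (x) .. (x) I with X as i-th factor. *)
Definition ampliation (R : realType) (k : nat) (F : 'I_k -> hilbertType R)
    (E : htensor F) (i : 'I_k) (X : bop (F i) (F i)) : bop E E :=
  xget 0 [set Z : bop E E |
    forall x : forall l, F l, Z (tens E x) = tens E (eqtype.dfwith x (X (x i)))].

(* Full Fock space over an n-dimensional Hilbert space: the Hilbert direct sum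
   of its tensor powers. The 0-th power is one-dimensional, spanned by the unit
   vector given by the empty family: it is the summand C1. *)
Record fock (R : realType) (n : nat) := Fock {
  fbase : hilbertType R ;
  fvec : 'I_n -> fbase ;
  fvec_orthonormal : forall i j, hdot (fvec i) (fvec j) = (i == j)%:R ;
  fvec_total : lspan (range fvec) = setT ;
  fpow : forall p : nat, htensor (fun _ : 'I_p => fbase) ;
  fspace :> hilbertType R ;
  finj : forall p : nat, bop (fpow p) fspace ;
  finj_isometric : forall p, isometric (finj p) ;
  finj_orth : forall p q x y, p != q -> hdot (finj p x) (finj q y) = 0 ;
  finj_total : closure (lspan (\bigcup_p range (finj p))) = setT
}.

Definition fock_basis (R : realType) (n : nat) (F : fock R n) (w : seq 'I_n) : F :=
  finj F (size w) (tens (fpow F (size w)) (fun l => fvec F (tnth (in_tuple w) l))).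

Section PositiveRegular.
Context {R : realType} {n : nat}.
(* Words over n letters are sequences, and a w is the coefficient of Z_w. *)
Variable a : seq 'I_n -> R.

Definition positive_regular :=
  [/\ forall w, 0 <= a w, a [::] = 0, forall j, 0 < a [:: j] &
    (limn_esup (fun p : nat =>
       ((\sum_(w : p.-tuple 'I_n) a w ^+ 2) `^ ((2 * p)%:R^-1))%:E) < +oo)%E].

Definition positive_regular_poly :=
  positive_regular /\ finite_set [set w | a w != 0].

Definition bcoef (m : nat) (w : seq 'I_n) : R :=
  if w is [::] then 1 else
  \sum_(1 <= p < (size w).+1)
    \sum_(g \in [set g : p.-tuple (seq 'I_n) |
                   flatten g = w /\ all (fun v => 0 < size v)%N g])
      (\prod_(v <- g) a v) * 'C(p + m - 1, m - 1)%:R.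

Definition opword {H : hilbertType R} (X : 'I_n -> bop H H) (w : seq 'I_n) :
    bop H H :=
  foldr (fun j A => X j \oB A) bop_id w.

Section Phi.
Context {H : hilbertType R}.
Variable X : 'I_n -> bop H H.

Definition Phi_partial (Y : bop H H) (N : nat) : bop H H :=
  \sum_(1 <= p < N) \sum_(w : p.-tuple 'I_n)
    (a w)%:C *: (opword X w \oB Y \oB adj (opword X w)).

Definition Phi_defined := forall Y, exists Z, wot_cvg \oo (Phi_partial Y) Z.

Definition Phi (Y : bop H H) : bop H H :=
  xget 0 [set Z : bop H H | wot_cvg \oo (Phi_partial Y) Z].

End Phi.

Definition wshift (m : nat) (F : fock R n) (j : 'I_n) : bop F F :=
  xget 0 [set W : bop F F | forall w, W (fock_basis F w) =
    (Num.sqrt (bcoef m w / bcoef m (j :: w)))%:C *: fock_basis F (j :: w)].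

End PositiveRegular.

Section Polydomain.
Context {R : realType} {k : nat} {n : 'I_k -> nat}.

Definition mword := {dffun forall i : 'I_k, seq 'I_(n i)}.

Definition homog (q : nat) : set mword :=
  [set b | (\sum_(i < k) size (b i))%N = q].

Section Tuples.
Context {H : hilbertType R}.
Implicit Type X : forall i : 'I_k, 'I_(n i) -> bop H H.

Definition mopword X (b : mword) : bop H H :=
  foldr (fun i A => opword (X i) (b i) \oB A) bop_id (enum 'I_k).

Definition mopword_adj X (b : mword) : bop H H :=
  foldr (fun i A => adj (opword (X i) (b i)) \oB A) bop_id (enum 'I_k).

(* s ranges over the words in all the letters (i, j). *)
Definition op_polys X : set (bop H H) :=
  lspan [set A | exists s : seq {i : 'I_k & 'I_(n i)},
    A = foldr (fun ij B => X (tag ij) (tagged ij) \oB B) bop_id s].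

Section Delta.
Variable a : forall i : 'I_k, seq 'I_(n i) -> R.
Arguments a : clear implicits.

Definition Delta X (p : 'I_k -> nat) (Y : bop H H) : bop H H :=
  foldr (fun i Z => iter (p i) (fun Z' => Z' - Phi (a i) (X i) Z') Z)
    Y (enum 'I_k).

(* Phi_defined says that Phi is a map on all of B(H). *)
Definition polydomain (m : 'I_k -> nat) X :=
  [/\ forall i, Phi_defined (a i) (X i),
     forall s t, s != t -> forall j l, X s j \oB X t l = X t l \oB X s j &
     forall p : 'I_k -> nat, (forall i, p i <= m i)%N ->
       positive_op (Delta X p bop_id)].

(* The filter of Z_+^k directed by the componentwise order. *)
Definition multi_oo : set_system ('I_k -> nat) :=
  [set A | exists q0 : 'I_k -> nat,
    forall q, (forall i, q0 i <= q i)%N -> A q].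

(* foldl applies the factor of index 0 first. *)
Definition pure X :=
  wot_cvg multi_oo (fun q : 'I_k -> nat =>
      foldl (fun Y i => Y - iter (q i) (Phi (a i) (X i)) Y) bop_id (enum 'I_k))
    bop_id.

End Delta.
End Tuples.

Section Model.
Context {F : forall i : 'I_k, fock R (n i)}.
Variable E : htensor (fun i => fspace (F i)).

Definition ebasis (b : mword) : E := tens E (fun i => fock_basis (F i) (b i)).

Definition vacuum : E := tens E (fun i => fock_basis (F i) [::]).

Definition Wmodel (a : forall i : 'I_k, seq 'I_(n i) -> R) (m : 'I_k -> nat)
    (i : 'I_k) (j : 'I_(n i)) : bop E E :=
  ampliation E (wshift (a i) (m i) (F i) j).

Section Hardy.
Variable W : forall i : 'I_k, 'I_(n i) -> bop E E.
Arguments W : clear implicits.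

(* The algebra F^oo(D^m_f), as the sequential SOT-closure of the polynomials. *)
Definition hardy : set (bop E E) :=
  [set g | exists p : nat -> bop E E,
    (forall l, op_polys W (p l)) /\ forall x : E, (p l x) @[l --> \oo] --> g x].

(* g = \sum_b c_b W_b, tested on the vectors of the orthonormal basis. *)
Definition fourier (g : bop E E) (c : mword -> R[i]) :=
  forall w : mword, (fun N : nat => \sum_(0 <= q < N)
      \sum_(b \in homog q) c b *: mopword W b (ebasis w)) @ \oo
    --> g (ebasis w).

(* Z = g(X): for each x, y r is the sum of the r-dilated series at x. *)
Definition calculus {H : hilbertType R} (X : forall i : 'I_k, 'I_(n i) -> bop H H)
    (g : bop E E) (Z : bop H H) :=
  exists2 c, fourier g c & forall x : H, exists2 y : R -> H,
    (forall r, 0 <= r < 1 ->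
      (fun N : nat => \sum_(0 <= q < N)
        \sum_(b \in homog q) ((r ^+ q)%:C * c b) *: mopword X b x) @ \oo --> y r) &
    y @ 1^'- --> Z x.

Definition wot_left_ideal (J : set (bop E E)) :=
  [/\ J `<=` hardy, J 0,
     forall (z : R[i]) g g', J g -> J g' -> J (z *: g + g'),
     forall h g, hardy h -> J g -> J (h \oB g) & wot_closed J].

End Hardy.

Definition MJ (J : set (bop E E)) : set E :=
  closure (lspan [set y | exists g x, J g /\ y = g x]).

Definition NJ (J : set (bop E E)) : csubspace E := orth (MJ J).

Definition Smodel (W : forall i : 'I_k, 'I_(n i) -> bop E E) J
    (i : 'I_k) (j : 'I_(n i)) : bop (subH (NJ J)) (subH (NJ J)) :=
  proj (NJ J) \oB W i j \oB incl (NJ J).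

Section Berezin.
Context {H : hilbertType R}.
Variables (a : forall i : 'I_k, seq 'I_(n i) -> R) (m : 'I_k -> nat).
Variable T : forall i : 'I_k, 'I_(n i) -> bop H H.
Arguments a : clear implicits.
Arguments T : clear implicits.

Definition defect_space : csubspace H := closed_range (Delta a T m bop_id).

(* The range of the square root lies in the defect space; the projection only
   restricts its codomain. *)
Definition defect_sqrt : bop H (subH defect_space) :=
  proj defect_space \oB sqrt_op (Delta a T m bop_id).

Definition berezin (ED : htensor2 E (subH defect_space)) : bop H ED :=
  xget 0 [set K : bop H ED | forall h : H,
    (fun N : nat => \sum_(0 <= q < N) \sum_(b \in homog q)
       (\prod_(i < k) Num.sqrt (bcoef (a i) (m i) (b i)))%:C *:
         tens2 ED (ebasis b) (defect_sqrt (mopword_adj T b h))) @ \oo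
    --> K h].

Definition constrained_berezin J (ED : htensor2 E (subH defect_space))
    (ND : htensor2 (subH (NJ J)) (subH defect_space)) : bop H ND :=
  op_tens2 ED ND (proj (NJ J)) bop_id \oB berezin ED.

End Berezin.
End Model.

Section Dilations.
Context {N H : hilbertType R}.
Variables (S : forall i : 'I_k, 'I_(n i) -> bop N N).
Variables (T : forall i : 'I_k, 'I_(n i) -> bop H H).
Arguments S : clear implicits.
Arguments T : clear implicits.

(* X (x) I on a realization ND of N (x) D. *)
Definition amplify (D : hilbertType R) (ND : htensor2 N D) (X : bop N N) :
  bop ND ND := op_tens2 ND ND X bop_id.

Definition is_dilation (D : hilbertType R) (ND : htensor2 N D) (V : bop H ND) :=
  [/\ isometric V,
     forall i j, coinvariant (amplify ND (S i j)) (range V) &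
     forall b : mword,
       mopword T b = adj V \oB amplify ND (mopword S b) \oB V].

Definition minimal (D : hilbertType R) (ND : htensor2 N D) (V : bop H ND) :=
  closure (lspan [set y | exists (b : mword) (h : H),
    y = amplify ND (mopword S b) (V h)]) = setT.

Definition isomorphic_dilations (D1 D2 : hilbertType R) (ND1 : htensor2 N D1)
    (ND2 : htensor2 N D2) (V1 : bop H ND1) (V2 : bop H ND2) :=
  exists U : bop ND1 ND2,
    [/\ unitary U,
       forall i j, U \oB amplify ND1 (S i j) = amplify ND2 (S i j) \oB U &
       U \oB V1 = V2].

End Dilations.
End Polydomain.

Arguments mword {k} n.

(* Main.v *)
(* K is the Berezin kernel of T. Tonelli's theorem turns the formal identity
   (1 - f)^-m (1 - f)^m = 1 into sum_w b_w X_w (id - Phi)^m(Y) X_w^* = Y as soon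
   as Phi^p(Y) tends to 0; applied to one index i after the other it shows that
   K is an isometry, and K^* (W_ij (x) I) = T_ij K^*. For g in J, Abel's theorem
   and g(T) = 0 give K^* (g (x) I) = 0, so K maps into N_J (x) D and compresses
   to the dilation.

   Minimality already holds before compression. Let z be orthogonal to all the
   (W_b (x) I) K h. The operators X such that z is orthogonal to all the
   (W_b X (x) I) K h include I and are stable under X |-> W_ij X W_ij^*, because
   W_ij^* K = K T_ij^*. Among the diagonal operators prod_i b^(l_i) / b^(m_i)
   one can thus lower each l_i from m_i down to 0, by (1 - f) b^(l+1) = b^(l),
   which yields the projection onto the constants; it maps K h to
   1 (x) Delta^(1/2) h, and these vectors generate everything.

   For any dilation V, V^* (S_b S_c^* (x) I) V = T_b T_c^*. Since S_c^* S_b is a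
   norm limit of combinations of the S_b S_c^*, the inner products of the vectors
   (S_b (x) I) V h do not depend on V, hence uniqueness. *)
Require Import Defs.
From mathcomp Require Import all_boot all_order all_algebra complex.
From mathcomp Require Import all_classical all_reals all_analysis.
From mathcomp Require Import ring lra.

Set Implicit Arguments.
Unset Strict Implicit.
Unset Printing Implicit Defensive.

Import Order.TTheory GRing.Theory Num.Theory ComplexField.
Import numFieldNormedType.Exports.

Local Open Scope classical_set_scope.
Local Open Scope complex_scope.
Local Open Scope ring_scope.

Local Notation incl := Defs.incl.
Local Notation proj := Defs.proj.
Local Notation split := fintype.split.
Local Notation dfwith := eqtype.dfwith.

(** * Hilbert space preliminaries *)

(** Adjoints, projections, square roots, tensor operators and [berezin] are given by [xget], so a
    property of one of them is available only after a construction. The recurrent tools are [mk_bop]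
    and [ext_bop], the latter extending a bounded assignment from a total family; identities are
    then checked on total families.

    The weak limits behind [Phi] and purity cannot be exchanged as they stand. The remedy is to
    evaluate everything at a positive operator and a vector: all terms become nonnegative reals, the
    limits become unordered sums in the extended reals, and these can be regrouped and exchanged
    freely. They are turned back into sequences graded by length only to meet the definition of the
    kernel.

    In the minimality argument f_i may be an infinite series, so each lowering of an exponent is a
    strong limit of finite combinations of conjugations. Keeping the diagonal entries between 0 and
    1 is what makes these limits available. *)

Section RealPart.
Context {R : realType}.
Implicit Types z w : R[i].

(* The real part, with values in R rather than in R[i]. *)
Definition rp z : R := complex.Re z.

Lemma rpD : {morph rp : z w / z + w}. Proof. by case=> ? ?; case. Qed.
Lemma rpN : {morph rp : z / - z}. Proof. by case. Qed.
Lemma rpB : {morph rp : z w / z - w}. Proof. by move=> z w; rewrite rpD rpN. Qed.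
Lemma rpMr (r : R) z : rp (r%:C * z) = r * rp z.
Proof. by case: z => x y /=; rewrite /rp /= mul0r subr0. Qed.
Lemma rpC (r : R) : rp r%:C = r. Proof. by []. Qed.

Lemma rp_sum (I : Type) (s : seq I) (P : pred I) (f : I -> R[i]) :
  rp (\sum_(x <- s | P x) f x) = \sum_(x <- s | P x) rp (f x).
Proof. exact: (big_morph rp rpD (erefl _)). Qed.

Lemma rpK z : 0 <= z -> z = (rp z)%:C.
Proof.
case: z => x y; rewrite lecE /= => /andP[/eqP y0 _].
by rewrite y0.
Qed.

Lemma rp_ge0 z : 0 <= z -> 0 <= rp z.
Proof. by rewrite lecE => /andP[]. Qed.

Lemma rp_gt0 z : 0 < z -> 0 < rp z.
Proof. by rewrite ltcE => /andP[]. Qed.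

Lemma rp_norm z : `|rp z|%:C <= `|z|. Proof. exact: normc_ge_Re. Qed.

Lemma rp_le_norm z : (rp z)%:C <= `|z|.
Proof. by apply: le_trans (rp_norm z); rewrite lecR ler_norm. Qed.

Lemma conj_rp (r : R) : (r%:C)^* = r%:C :> R[i].
Proof. by apply/CrealP; apply/complex_realP; exists r. Qed.

Lemma rp_cvg (T : Type) (F : set_system T) (FF : Filter F) (u : T -> R[i]) (l : R[i]) :
  (u : T -> R[i]^o) @ F --> (l : R[i]^o) -> (rp \o u : T -> R^o) @ F --> (rp l : R^o).
Proof.
move=> /cvgrPdist_lt ul; apply/cvgrPdist_lt => e e0.
have := ul e%:C; rewrite ltcR => /(_ e0); apply: filterS => t.
move=> h; rewrite -ltcR; apply: le_lt_trans h.
by rewrite /= -rpB; exact: rp_norm.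
Qed.

End RealPart.

Section HilbertOperators.
Context {R : realType}.
Implicit Types H U V W : hilbertType R.

Lemma bopP U V (A B : bop U V) : A =1 B -> A = B.
Proof. by move=> AB; apply: val_inj; apply: funext. Qed.

Section Pointwise.
Variables (U V : normedModType R[i]).
Implicit Types A B : bop U V.
Lemma bop0E (x : U) : (0 : bop U V) x = 0. Proof. by []. Qed.
Lemma bopDE A B x : (A + B) x = A x + B x. Proof. by []. Qed.
Lemma bopBE A B x : (A - B) x = A x - B x. Proof. by []. Qed.
Lemma bopZE (c : R[i]) A x : (c *: A) x = c *: A x. Proof. by []. Qed.
Lemma bop_sumE (I : Type) (s : seq I) (P : pred I) (f : I -> bop U V) x :
  (\sum_(i <- s | P i) f i) x = \sum_(i <- s | P i) f i x.
Proof. exact: (big_morph (fun A : bop U V => A x) (fun _ _ => erefl) (erefl _)). Qed.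

Lemma bop0 A : A 0 = 0.
Proof.
have := bop_linear A 1 0 0; rewrite !scale1r !addr0 => h.
by apply: (addrI (A 0)); rewrite addr0.
Qed.
Lemma bopD A x y : A (x + y) = A x + A y.
Proof. by have := bop_linear A 1 x y; rewrite !scale1r. Qed.
Lemma bopZ A c x : A (c *: x) = c *: A x.
Proof. by have := bop_linear A c x 0; rewrite !addr0 bop0 addr0. Qed.
Lemma bopN A x : A (- x) = - A x.
Proof. by rewrite -scaleN1r bopZ scaleN1r. Qed.
Lemma bopB A x y : A (x - y) = A x - A y.
Proof. by rewrite bopD bopN. Qed.
Lemma bop_sum A (I : Type) (s : seq I) (P : pred I) (f : I -> U) :
  A (\sum_(i <- s | P i) f i) = \sum_(i <- s | P i) A (f i).
Proof. exact: (big_morph A (bopD A) (bop0 A)). Qed.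
End Pointwise.

Lemma bop_compE U V W (B : bop V W) (A : bop U V) x : (B \oB A) x = B (A x).
Proof. by []. Qed.

Lemma lin_lip_cont (U V : normedModType R[i]) (f : U -> V) (C : R[i]) :
  linear f -> (forall x, `|f x| <= C * `|x|) -> continuous f.
Proof.
move=> lf Cf.
(* C may be any complex number, negative for instance if U is trivial; |C| + 1 is a positive
   substitute by which one can divide. *)
have C1 : 0 < `|C| + 1 by rewrite ltr_wpDl.
have Cf' x : `|f x| <= (`|C| + 1) * `|x|.
  have [->|x0] := eqVneq x 0.
    have : f 0 = 0.
      have := lf 1 0 0; rewrite !scale1r !addr0 => h.
      by apply: (addrI (f 0)); rewrite addr0.
    by move=> ->; rewrite !normr0 mulr0.
  have C0 : 0 <= C.
    have nx : 0 < `|x| by rewrite normr_gt0.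
    by rewrite -(pmulr_lge0 _ nx); apply: le_trans (Cf x).
  apply: le_trans (Cf x) _; apply: ler_wpM2r => //.
  by rewrite (ger0_norm C0) lerDl.
move=> x; apply/cvgrPdist_lt => e e0.
near=> y.
have -> : f x - f y = f (x - y).
  by have := lf (-1) y x; rewrite !scaleN1r [RHS]addrC => <-; rewrite addrC.
apply: le_lt_trans (Cf' _) _; rewrite mulrC -ltr_pdivlMr//; near: y.
have /cvgrPdist_lt := @cvg_id _ (nbhs x); apply; rewrite divr_gt0.
Unshelve. all: by end_near. Qed.

Lemma mk_bop (U V : normedModType R[i]) (f : U -> V) (C : R[i]) :
  linear f -> (forall x, `|f x| <= C * `|x|) -> exists B : bop U V, B =1 f.
Proof.
move=> lf Cf.
have fP : f \in @blin R U V by apply/asboolP; split => //; exact: lin_lip_cont Cf.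
by exists (BOp fP).
Qed.

Lemma bop_bounded (U V : normedModType R[i]) (A : bop U V) :
  exists2 C : R, 0 < C & forall x, `|A x| <= C%:C * `|x|.
Proof.
have [d /= d0 dA] : exists2 d : R[i], 0 < d & forall x, `|x| < d -> `|A x| < 1.
  have /cvgrPdist_lt/(_ 1 ltr01) := @bop_continuous _ _ _ A 0.
  rewrite bop0 => /nbhs_norm0P[d /= d0 h]; exists d => // x xd.
  by have := h x xd; rewrite /= sub0r normrN.
have d20 : 0 < d / 2 by rewrite divr_gt0.
exists (rp (2 / d)); first by apply: rp_gt0; rewrite divr_gt0.
move=> x; rewrite -rpK; last by rewrite divr_ge0 // ltW.
have [->|x0] := eqVneq x 0; first by rewrite bop0 !normr0 mulr0.
have nx : 0 < `|x| by rewrite normr_gt0.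
(* x is rescaled to norm d / 2, strictly inside the ball where A is bounded by 1; this is where the
   constant 2 / d comes from. *)
have := dA ((d / 2 / `|x|) *: x).
rewrite normrZ normrM normfV normr_id divfK ?gt_eqF// (gtr0_norm d20).
have hd : d / 2 < d by rewrite ltr_pdivrMr// mulr_natr mulr2n ltrDl.
move=> /(_ hd)/ltW; rewrite bopZ normrZ normrM normfV normr_id (gtr0_norm d20).
rewrite -ler_pdivlMl; last by rewrite divr_gt0.
by rewrite mulr1 invfM invrK invfM invrK (mulrC _ 2).
Qed.

Lemma bop_idE U (x : U) : bop_id x = x. Proof. by []. Qed.

Lemma hdotBl H (x x' y : H) : hdot (x - x') y = hdot x y - hdot x' y.
Proof. by rewrite hdotDl hdotNl. Qed.
Lemma hdotBr H (x y y' : H) : hdot x (y - y') = hdot x y - hdot x y'.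
Proof. by rewrite hdotDr hdotNr. Qed.
Lemma hdot_suml H (I : Type) (s : seq I) (P : pred I) (f : I -> H) y :
  hdot (\sum_(i <- s | P i) f i) y = \sum_(i <- s | P i) hdot (f i) y.
Proof. exact: (big_morph (fun x => hdot x y) (fun a b => hdotDl a b y) (hdot0l y)). Qed.
Lemma hdot_sumr H (I : Type) (s : seq I) (P : pred I) (f : I -> H) y :
  hdot y (\sum_(i <- s | P i) f i) = \sum_(i <- s | P i) hdot y (f i).
Proof. exact: (big_morph (hdot y) (hdotDr y) (hdot0r y)). Qed.

Lemma hdot_ext H (x x' : H) : (forall y, hdot x y = hdot x' y) -> x = x'.
Proof.
move=> h; apply/eqP; rewrite -subr_eq0; apply/eqP/hdot_eq0.
by rewrite hdotBl h subrr.
Qed.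

Lemma normD2 H (x y : H) : `|x + y| ^+ 2 = `|x| ^+ 2 + `|y| ^+ 2 + (hdot x y + hdot y x).
Proof. by rewrite !hdot_norm !hdotDl !hdotDr; ring. Qed.

Lemma parallelogram H (x y : H) :
  `|x - y| ^+ 2 = 2 * `|x| ^+ 2 + 2 * `|y| ^+ 2 - `|x + y| ^+ 2.
Proof. by rewrite !hdot_norm !hdotDl !hdotDr !hdotNl !hdotNr; ring. Qed.

Lemma pythagoras H (x y : H) : hdot x y = 0 -> `|x + y| ^+ 2 = `|x| ^+ 2 + `|y| ^+ 2.
Proof. by move=> xy; rewrite normD2 (hdotC x y) xy rmorph0 !addr0. Qed.

(** Complex scalars make this true: expanding G at a y + x with a = 1 shows that G is antisymmetric,
    with a = i that it is symmetric. *)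
Lemma polarization_form H (G : H -> H -> R[i]) :
  (forall a x x' y, G (a *: x + x') y = a * G x y + G x' y) ->
  (forall a x y y', G x (a *: y + y') = a^* * G x y + G x y') ->
  (forall x, G x x = 0) -> forall x y, G x y = 0.
Proof.
move=> Gl Gr G0 x y.
have h a : a^* * G x y + a * G y x = 0.
  have := G0 (a *: y + x); rewrite Gl !Gr !G0 !mulr0 !addr0 add0r => <-.
  by rewrite addrC.
have h1 := h 1; have hi := h ('i)%R.
rewrite conjC1 !mul1r in h1; rewrite conjCi in hi.
have e : G y x = - G x y by apply/eqP; rewrite -addr_eq0 addrC h1.
have /eqP : ('i)%R * G x y *- 2 = 0 by rewrite -hi e mulr2n mulrN mulNr opprD.
by rewrite oppr_eq0 mulrn_eq0 /= mulf_eq0 (negPf (neq0Ci _)) /= => /eqP.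
Qed.

Lemma qform_eq0 H (A : bop H H) : (forall x, hdot (A x) x = 0) -> A = 0.
Proof.
move=> A0; apply: bopP => x; apply: hdot_ext => y; rewrite hdot0l.
apply: (@polarization_form H (fun x y => hdot (A x) y)) => //.
  by move=> a u u' v; rewrite bop_linear hdot_linear.
by move=> a u v v'; rewrite hdotDr hdotZr.
Qed.

Lemma isometric_hdot U V (A : bop U V) : isometric A ->
  forall x y, hdot (A x) (A y) = hdot x y.
Proof.
move=> Ai x y; apply/eqP; rewrite -subr_eq0; apply/eqP.
apply: (@polarization_form U (fun x y => hdot (A x) (A y) - hdot x y)) => //.
- by move=> a u u' v; rewrite bop_linear !hdot_linear; ring.
- by move=> a u v v'; rewrite bop_linear !hdotDr !hdotZr; ring.
- by move=> u; rewrite -!hdot_norm Ai subrr.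
Qed.

End HilbertOperators.

(** * Projections, adjoints and total sets *)

Section ProjectionAdjoint.
Context {R : realType}.
Implicit Types H U V W : hilbertType R.

Lemma cvg_seqP (V : normedModType R[i]) (u : nat -> V) (l : V) :
  u @ \oo --> l <->
  forall e : R, 0 < e -> exists N, forall n, (N <= n)%N -> `|l - u n| < e%:C.
Proof.
split=> [/cvgrPdist_lt ul e e0|ul].
  by have /ul : 0 < e%:C by [rewrite ltcR]; case=> N _ h; exists N => n Nn; exact: h.
apply/cvgrPdist_lt => e e0; have [N h] := ul _ (rp_gt0 e0).
by exists N => // n /= Nn; rewrite (rpK (ltW e0)); exact: h.
Qed.

Lemma cauchy_seq (V : completeNormedModType R[i]) (u : nat -> V) :
  (forall e : R, 0 < e -> exists N, forall m n, (N <= m)%N -> (N <= n)%N ->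
     `|u m - u n| < e%:C) -> exists l : V, u @ \oo --> l.
Proof.
move=> cu; suff : cvg (u @ \oo) by move/cvg_ex.
apply: cauchy_cvg; apply/cauchy_ballP => e e0.
have [N h] := cu _ (rp_gt0 e0).
exists (u @` [set n | (N <= n)%N], u @` [set n | (N <= n)%N]).
  by split; exists N => // n /= Nn; exists n.
move=> [_ _] [/= [m Nm <-] [n Nn <-]].
by rewrite -ball_normE /= (rpK (ltW e0)); exact: h.
Qed.

Lemma bop_cvg (U V : normedModType R[i]) (A : bop U V) (T : Type) (F : set_system T)
  (FF : Filter F) (u : T -> U) l : u @ F --> l -> (A \o u) @ F --> A l.
Proof. by move=> ul; apply: continuous_cvg => //; exact: bop_continuous. Qed.

Lemma hdot_cvgl H (T : Type) (F : set_system T) (FF : Filter F) (u : T -> H) l y :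
  u @ F --> l -> (fun t => hdot (u t) y : R[i]^o) @ F --> (hdot l y : R[i]^o).
Proof.
by move=> ul; exact: cvg_comp ul (@hdot_continuousl _ _ _ _).
Qed.

(** Values are taken in R because the order of R[i] is only partial, while infima, monotone limits
    and [lra] work over R. *)
Definition norm2 H (x : H) : R := rp (`|x| ^+ 2).

Lemma norm2E H (x : H) : `|x| ^+ 2 = (norm2 x)%:C.
Proof. by rewrite -rpK// exprn_ge0. Qed.
Lemma norm2_hdot H (x : H) : hdot x x = (norm2 x)%:C.
Proof. by rewrite -hdot_norm norm2E. Qed.
Lemma norm2_ge0 H (x : H) : 0 <= norm2 x.
Proof. by apply: rp_ge0; rewrite exprn_ge0. Qed.
Lemma norm2_eq0 H (x : H) : norm2 x = 0 -> x = 0.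
Proof. by move=> n0; apply: hdot_eq0; rewrite norm2_hdot n0. Qed.
Lemma norm20 H : norm2 (0 : H) = 0. Proof. by rewrite /norm2 normr0 expr0n. Qed.

Lemma norm_lt_norm2 H (x : H) (e : R) : 0 < e -> (`|x| < e%:C) = (norm2 x < e ^+ 2).
Proof.
move=> e0; rewrite -ltcR -norm2E rmorphXn /= ltr_pXn2r// nnegrE// lecR; exact: ltW.
Qed.

Lemma norm_le_norm2 H U (x : H) (y : U) (e : R) : 0 <= e ->
  (`|x| <= e%:C * `|y|) = (norm2 x <= e ^+ 2 * norm2 y).
Proof.
move=> e0; rewrite -lecR -norm2E [(_ * _)%:C]rmorphM /= -norm2E rmorphXn /= -exprMn ler_pXn2r//.
  by rewrite nnegrE.
by rewrite nnegrE mulr_ge0// lecR.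
Qed.

Lemma projection_exists H (M : csubspace H) (x : H) :
  exists2 m, cset M m & forall y, cset M y -> hdot (x - m) y = 0.
Proof.
pose D := [set norm2 (x - m) | m in cset M].
have D0 : D !=set0 by exists (norm2 (x - 0)); exists 0 => //; exact: cset0.
have Dlb : has_lbound D by exists 0 => _ [m _ <-]; exact: norm2_ge0.
pose d := inf D.
have dle m : cset M m -> d <= norm2 (x - m) by move=> Mm; apply: ge_inf => //; exists m.
have Dd n : exists m, cset M m /\ norm2 (x - m) < d + n.+1%:R^-1.
  have [|_ [m Mm <-] lt] := @inf_adherent _ D n.+1%:R^-1 _ (conj D0 Dlb).
    by rewrite invr_gt0.
  by exists m.
have [u Mu] := choice Dd.
have [m um] : exists l : H, u @ \oo --> l.
  apply: cauchy_seq => e e0.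
  have [N Ne] : exists N : nat, 4 * N.+1%:R^-1 < e ^+ 2.
    have e40 : 0 < e ^+ 2 / 4 by rewrite divr_gt0// exprn_gt0.
    have [N _ hN] := near_infty_natSinv_lt (PosNum e40).
    exists N; rewrite mulrC -ltr_pdivlMr//; exact: (hN N (leqnn N)).
  exists N => p q Np Nq; rewrite norm_lt_norm2//; apply: le_lt_trans Ne.
  have invle s : (N <= s)%N -> s.+1%:R^-1 <= N.+1%:R^-1 :> R.
    by move=> Ns; rewrite lef_pV2 ?posrE// ler_nat ltnS.
  (* The midpoint lies in M, hence at squared distance at least d from x; the parallelogram law then
     forces the minimising sequence to be Cauchy. *)
  pose a := 2^-1 *: (u p + u q).
  have Ma : cset M a.
    have := cset_lin 2^-1 (cset_lin 1 (Mu p).1 (Mu q).1) (cset0 M).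
    by rewrite scale1r addr0.
  have E : norm2 (u p - u q) = 2 * norm2 (x - u q) + 2 * norm2 (x - u p) - 4 * norm2 (x - a).
    apply: (@complexI R); rewrite rmorphB rmorphD !rmorphM /= -!norm2E.
    have -> : u p - u q = (x - u q) - (x - u p).
      by rewrite opprB [RHS]addrC addrA subrK.
    rewrite parallelogram; congr (_ + _ - _); rewrite ?rmorph_nat //.
    have -> : x - u q + (x - u p) = 2 *: (x - a).
      by rewrite /a scalerBr scalerA divff// scale1r scaler_nat mulr2n opprD addrACA (addrC (- u
        q)).
    by rewrite normrZ exprMn ger0_norm// -natrX.
  have := ltW (Mu p).2; have := ltW (Mu q).2; have := dle _ Ma.
  have := invle _ Np; have := invle _ Nq.
  rewrite E; move: (p.+1%:R^-1) (q.+1%:R^-1) (N.+1%:R^-1) => P Q K *; lra.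
have Mm : cset M m.
  apply: (@closed_cvg _ _ _ _ u (cset M)) um; first exact: cset_closed.
  by apply: nearW => n; exact: (Mu n).1.
have mle y : cset M y -> norm2 (x - m) <= norm2 (x - y).
  move=> My; apply: le_trans (dle _ My).
  apply/ler_addgt0Pr => e e0.
  have cv : (fun n => norm2 (x - u n) : R^o) @ \oo --> (norm2 (x - m) : R^o).
    have h1 : (fun n => `|x - u n| : R[i]^o) @ \oo --> (`|x - m| : R[i]^o).
      by apply: cvg_norm; apply: cvgB => //; exact: cvg_cst.
    have h2 : (fun n => `|x - u n| * `|x - u n| : R[i]^o) @ \oo --> (`|x - m| * `|x - m| :
      R[i]^o).
      exact: (cvgM h1 h1).
    exact: rp_cvg h2.
  rewrite -(cvg_lim _ cv)//; apply: limr_le; first by apply/cvg_ex; exists (norm2 (x - m)).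
  have [N _ hN] := near_infty_natSinv_lt (PosNum e0).
  exists N => // n /= Nn; apply: le_trans (ltW (Mu n).2) _.
  by rewrite lerD2l ltW//; exact: hN.
exists m => // y My.
have [->|y0] := eqVneq y 0; first by rewrite hdot0r.
have ny : 0 < norm2 y by rewrite lt0r norm2_ge0 andbT; apply: contraNneq y0 => /norm2_eq0->.
have ny' : (norm2 y)%:C != 0 :> R[i] by rewrite eq_sym -[0]/(0%:C) (inj_eq (@complexI R)) lt_eqF.
(* The coefficient that minimises the norm of x - m - c y. With it, minimality of m says that |<x -
   m, y>|^2 / |y|^2 is at most 0. *)
pose c := hdot (x - m) y / (norm2 y)%:C.
have Mmy : cset M (m + c *: y) by rewrite addrC; exact: cset_lin.
have := mle _ Mmy; rewrite -lecR -!norm2_hdot opprD addrA.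
rewrite /c; move: (x - m) => v;
  rewrite [in X in _ <= X]hdotBl !hdotBr !hdotZr !hdotZl (norm2_hdot y).
rewrite divfK// -subr_ge0.
have -> : forall q p r s : R[i], q - p - (r - s) - q = s - p - r by move=> *; ring.
rewrite subrr sub0r oppr_ge0 (hdotC v y) mulrAC -normCK pmulr_lle0 ?invr_gt0 ?ltcR//.
rewrite -[X in X <= _ -> _]normrX normr_le0 sqrf_eq0 => /eqP; exact.
Qed.

(** The pointwise projections have to be assembled into a bounded operator before [xget] can be
    used: they are linear by uniqueness and contractive by Pythagoras. *)
Lemma projE H (M : csubspace H) (x : H) (y : subH M) :
  hdot (x - incl M (proj M x)) (incl M y) = 0.
Proof.
rewrite /proj; set P := [set _ | _].
suff /(xgetPex (0 : bop H (subH M))) : exists P0, P P0 by exact.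
have /choice[f fP] : forall x, exists m : subH M, forall y : subH M,
  hdot (x - incl M m) (incl M y) = 0.
  move=> z; have [m Mm h] := projection_exists M z.
  have mP : m \in cpred M by apply/asboolP.
  by exists (SubH mP) => w; apply: h; apply/asboolP/sub_subproof.
have uniq (z : H) (m : subH M) : (forall y : subH M, hdot (z - incl M m) (incl M y) = 0) ->
  f z = m.
  move=> h; apply/eqP; rewrite -subr_eq0; apply/eqP/hdot_eq0.
  have E : hdot (f z - m) (f z - m) = hdot (incl M (f z - m)) (incl M (f z - m)) by [].
  rewrite E [X in hdot X _](_ : _ = (z - incl M m) - (z - incl M (f z))).
    by rewrite hdotBl h fP subrr.
  by rewrite bopB opprB [RHS]addrC addrA subrK.
have lf : linear f.
  move=> a u v; apply: uniq => w; rewrite bop_linear opprD addrACA -scalerBr.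
  by rewrite hdot_linear !fP mulr0 addr0.
have fn z : `|f z| <= 1 * `|z|.
  rewrite mul1r -(ler_pXn2r (ltn0Sn 1)) ?nnegrE//.
  have -> : `|z| ^+ 2 = `|(z - incl M (f z)) + incl M (f z)| ^+ 2 by rewrite subrK.
  by rewrite pythagoras// lerDr exprn_ge0.
have [B BE] := mk_bop lf fn.
by exists B => u v; rewrite BE fP.
Qed.

Lemma proj_id H (M : csubspace H) (x : subH M) : proj M (incl M x) = x.
Proof.
apply/eqP; rewrite -subr_eq0; apply/eqP/hdot_eq0.
have := projE (incl M x) (x - proj M (incl M x)); rewrite -bopB => h.
by rewrite -[proj _ _ - _]opprB hdotNl hdotNr opprK.
Qed.

Lemma proj_dot H (M : csubspace H) (x : H) (y : subH M) :
  hdot (proj M x) y = hdot x (incl M y).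
Proof.
by have /eqP := projE x y; rewrite hdotBl subr_eq0 => /eqP.
Qed.

(** If f is not 0, the component v of some vector orthogonal to the closed kernel represents f up to
    a scalar, since x - (f x / f v) v always lies in the kernel. *)
Lemma riesz H (f : H -> R[i]) (C : R[i]) : (forall a x y, f (a *: x + y) = a * f x + f y) ->
  (forall x, `|f x| <= C * `|x|) -> exists z, forall x, f x = hdot x z.
Proof.
move=> lf Cf.
have cf : continuous (f : H -> R[i]^o) by exact: (@lin_lip_cont R H R[i]^o f C lf Cf).
have [f0|/existsNP[x0 fx0]] := pselect (forall x, f x = 0).
  by exists 0 => x; rewrite hdot0r.
have f00 : f 0 = 0 by have := lf 1 0 0; rewrite scale1r mul1r addr0 => h; apply: (addrI (f 0));
  rewrite addr0.
have ck : closed [set x | f x = 0].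
  have := @preimage_closed _ _ (f : H -> R[i]^o) [set 0]; apply => //.
  have := @accessible_closed_set1 R[i]^o; apply.
  exact: hausdorff_accessible (@norm_hausdorff _ R[i]^o).
have kl (a : R[i]) (x y : H) : f x = 0 -> f y = 0 -> f (a *: x + y) = 0.
  by move=> fx fy; rewrite lf fx fy mulr0 addr0.
have [p fp hp] := projection_exists (CSubspace ck f00 kl) x0.
set v := x0 - p in hp.
have fv : f v = f x0.
  by rewrite /v -[p]opprK -scaleN1r opprK addrC lf fp mulr0 add0r.
have fv0 : f v != 0 by apply/eqP; rewrite fv.
have v0 : hdot v v != 0.
  by apply: contraNneq fv0 => /hdot_eq0 ->; rewrite f00.
exists (((f v)^* / hdot v v) *: v) => x.
have := hp (x - (f x / f v) *: v) _; rewrite /= => h.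
have {h} : hdot v (x - (f x / f v) *: v) = 0.
  by apply: h; rewrite addrC -scaleNr lf mulNr divfK// addNr.
move=> /(congr1 Num.conj); rewrite -hdotC rmorph0 hdotBl hdotZl => /eqP.
rewrite subr_eq0 => /eqP h; rewrite hdotZr h rmorphM /= conjCK fmorphV /= -hdotC.
by field; rewrite fv0 v0.
Qed.

Lemma adjE U V (A : bop U V) x y : hdot (A x) y = hdot x (adj A y).
Proof.
rewrite /adj; set P := [set _ | _].
suff /(xgetPex (0 : bop V U)) : exists B, P B by exact.
have [C C0 AC] := bop_bounded A.
have /choice[f fP] : forall y, exists z, forall x, hdot (A x) y = hdot x z.
  move=> v; apply: (@riesz U (fun x => hdot (A x) v) (C%:C * `|v|)).
    by move=> a u u'; rewrite bop_linear hdot_linear.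
  move=> u; apply: le_trans (cauchy_schwarz _ _) _.
  by rewrite mulrAC ler_wpM2r.
have lf : linear f.
  move=> a u v; apply: hdot_ext => w; rewrite hdotC [RHS]hdotC; congr (_^*).
  by rewrite -fP !hdotDr !hdotZr !fP.
have fn z : `|f z| <= C%:C * `|z|.
  have [->|fz0] := eqVneq (f z) 0; first by rewrite normr0 mulr_ge0// lecR ltW.
  have nf : 0 < `|f z| by rewrite normr_gt0.
  (* |f z|^2 = <A (f z), z>, so that Cauchy-Schwarz and the bound on A leave one factor |f z| to
     cancel. *)
  rewrite -(ler_pM2l nf) -expr2 hdot_norm -fP.
  have : 0 <= hdot (A (f z)) z by rewrite fP -hdot_norm exprn_ge0.
  move=> /ger0_norm <-; apply: le_trans (cauchy_schwarz _ _) _.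
  by rewrite mulrCA mulrA ler_wpM2r.
have [B BE] := mk_bop lf fn.
by exists B => u v; rewrite BE fP.
Qed.

Lemma adjE' U V (A : bop U V) x y : hdot y (A x) = hdot (adj A y) x.
Proof. by rewrite hdotC adjE -hdotC. Qed.

Lemma adj_unique U V (A : bop U V) (B : bop V U) :
  (forall x y, hdot (A x) y = hdot x (B y)) -> adj A = B.
Proof.
move=> h; apply: bopP => y; apply: hdot_ext => z.
by rewrite hdotC -adjE h -hdotC.
Qed.

Lemma adjK U V (A : bop U V) : adj (adj A) = A.
Proof. by apply: adj_unique => x y; rewrite -adjE'. Qed.

Lemma adj_comp U V W (B : bop V W) (A : bop U V) : adj (B \oB A) = adj A \oB adj B.
Proof. by apply: adj_unique => x y; rewrite /= !adjE. Qed.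

Lemma adj_id U : adj (@bop_id R U) = bop_id.
Proof. exact: adj_unique. Qed.

Lemma adj_incl H (M : csubspace H) : adj (incl M) = proj M.
Proof. by apply: adj_unique => x y; rewrite hdotC [RHS]hdotC proj_dot. Qed.

Lemma adj_proj H (M : csubspace H) : adj (proj M) = incl M.
Proof. by rewrite -adj_incl adjK. Qed.

Lemma isometric_adj U V (A : bop U V) : isometric A -> adj A \oB A = bop_id.
Proof.
move=> iA; apply: bopP => x; apply: hdot_ext => y.
by rewrite /= -adjE' isometric_hdot.
Qed.

Definition total H (A : set H) := closure (lspan A) = setT.

Lemma lspan_lin (V : lmodType R[i]) (A : set V) a x y :
  lspan A x -> lspan A y -> lspan A (a *: x + y).
Proof.
move=> [N [c [v [Av ->]]]] [N' [c' [v' [Av' ->]]]].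
exists (N + N')%N, (fun l => match split l with inl i => a * c i | inr j => c' j end),
  (fun l => match split l with inl i => v i | inr j => v' j end); split.
  by move=> l; case: split.
rewrite big_split_ord /=; congr (_ + _); rewrite ?scaler_sumr; apply: eq_bigr => i _.
  by rewrite (unsplitK (inl i)) scalerA.
by rewrite (unsplitK (inr i)).
Qed.

Lemma lspan0 (V : lmodType R[i]) (A : set V) : lspan A 0.
Proof.
exists 0%N, (fun=> 0), (fun=> 0); split; first by case.
by rewrite big_ord0.
Qed.

Lemma lspan_sub (V : lmodType R[i]) (A : set V) : A `<=` lspan A.
Proof.
move=> x Ax; exists 1%N, (fun=> 1), (fun=> x); split => //.
by rewrite big_ord1 scale1r.
Qed.

Lemma lspan_ind (V : lmodType R[i]) (A : set V) (P : V -> Prop) :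
  P 0 -> (forall a x y, A x -> P y -> P (a *: x + y)) -> lspan A `<=` P.
Proof.
move=> P0 PS x [N [c [v [Av ->]]]].
by apply: big_rec => // i z _ Pz; apply: PS.
Qed.

Lemma closure_lspan_lin H (A : set H) a x y :
  closure (lspan A) x -> closure (lspan A) y -> closure (lspan A) (a *: x + y).
Proof.
move=> /closure_normP cx /closure_normP cy; apply/closure_normP => e e0.
have a0 : 0 < `|a| + 1 by rewrite ltr_wpDl.
have e20 : 0 < e / 2 by rewrite divr_gt0.
have [u Au xu] := cx (e / 2 / (`|a| + 1)) (divr_gt0 e20 a0).
have [v Av yv] := cy (e / 2) e20.
exists (a *: u + v); first exact: lspan_lin.
rewrite opprD addrACA -scalerBr [ltRHS]splitr.
apply: le_lt_trans (ler_normD _ _) _; apply: ler_ltD => //.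
rewrite normrZ; apply: (@le_trans _ _ ((`|a| + 1) * `|x - u|)).
  by rewrite ler_wpM2r// lerDl.
by rewrite mulrC -ler_pdivlMr// ltW.
Qed.

Definition cspan H (A : set H) : csubspace H :=
  CSubspace (@closed_closure _ (lspan A)) (subset_closure (lspan0 A)) (@closure_lspan_lin H A).

Lemma cspan_orth H (A : set H) z :
  (forall x, A x -> hdot z x = 0) -> forall x, cset (cspan A) x -> hdot z x = 0.
Proof.
move=> zA x cx.
suff : (closure (lspan A) `<=` cset (orth [set z])).
  by move=> /(_ _ cx) /(_ z erefl); rewrite hdotC => /eqP; rewrite conjC_eq0 => /eqP.
have sub : lspan A `<=` cset (orth [set z]).
  apply: lspan_ind; first exact: cset0.
  by move=> a u v Au; apply: cset_lin => _ ->; rewrite hdotC zA// conjC0.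
have := closure_subset sub.
by rewrite -(proj1 (closure_id _) (@cset_closed _ _ (orth [set z]))).
Qed.

(** Orthogonality is the form in which totality is used everywhere below; the converse direction
    projects x onto the closed span and tests the remainder. *)
Lemma totalP H (A : set H) :
  total A <-> forall z, (forall x, A x -> hdot z x = 0) -> z = 0.
Proof.
split=> [tA z zA|h].
  apply: hdot_eq0; apply: (cspan_orth zA); rewrite /= -/(total A).
  by rewrite [closure _]tA.
rewrite /total -subTset => x _; have [m Mm hm] := projection_exists (cspan A) x.
suff /eqP : x - m = 0 by rewrite subr_eq0 => /eqP ->.
by apply: h => y Ay; apply: hm; apply: subset_closure; apply: lspan_sub.
Qed.

Lemma bop_total_eq U V (A : set U) (B B' : bop U V) : total A ->
  (forall x, A x -> B x = B' x) -> B = B'.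
Proof.
move=> /totalP tA h; apply: bopP => x; apply: hdot_ext => y.
apply/eqP; rewrite -subr_eq0 -hdotBl -bopBE adjE; apply/eqP.
suff -> : adj (B - B') y = 0 by rewrite hdot0r.
by apply: tA => z /h Bz; rewrite -adjE' bopBE Bz subrr hdot0r.
Qed.

End ProjectionAdjoint.

(** * Extension by density, square roots, orthogonal series and Abel summation *)

Section ExtensionSqrt.
Context {R : realType}.
Implicit Types H U V W : hilbertType R.

Definition lincomb (I : Type) (V : lmodType R[i]) (v : I -> V) (s : seq (R[i] * I)) : V :=
  \sum_(p <- s) p.1 *: v p.2.

Lemma lincomb_cat (I : Type) (V : lmodType R[i]) (v : I ->
  V) s t : lincomb v (s ++ t) = lincomb v s + lincomb v t.
Proof. by rewrite /lincomb big_cat. Qed.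

Lemma lincomb_scale (I : Type) (V : lmodType R[i]) (v : I -> V) a s :
  lincomb v [seq (a * p.1, p.2) | p <- s] = a *: lincomb v s.
Proof. by rewrite /lincomb big_map scaler_sumr; apply: eq_bigr => p _; rewrite scalerA. Qed.

Lemma lspan_lincomb (I : Type) (V : lmodType R[i]) (v : I -> V) x :
  lspan (range v) x -> exists s, x = lincomb v s.
Proof.
apply: (@lspan_ind R V (range v) (fun x => exists s, x = lincomb v s)).
  by exists [::]; rewrite /lincomb big_nil.
by move=> a _ _ [i _ <-] [s ->]; exists ((a, i) :: s); rewrite /lincomb big_cons.
Qed.

(** The bound on all finite combinations also settles that the assignment is well defined: a
    combination of the v that vanishes has a vanishing image. No independence of the family v is
    required. *)
Lemma ext_bop U V (I : Type) (v : I -> U) (w : I -> V) (C : R) :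
  total (range v) -> 0 <= C -> (forall s, `|lincomb w s| <= C%:C * `|lincomb v s|) ->
  exists2 Z : bop U V, (forall i, Z (v i) = w i) & forall x, `|Z x| <= C%:C * `|x|.
Proof.
move=> tv C0 hC.
(* [P] is the closure of the graph of the assignment on finite combinations; it is linear and
   bounded by C, hence the graph of a map. *)
pose P x y := forall e : R[i], 0 < e ->
  exists s, `|x - lincomb v s| < e /\ `|y - lincomb w s| < e.
have Plin a x y x' y' : P x y -> P x' y' -> P (a *: x + x') (a *: y + y').
  move=> Pxy Pxy' e e0.
  have a0 : 0 < `|a| + 1 by rewrite ltr_wpDl.
  have e20 : 0 < e / 2 by rewrite divr_gt0.
  have [s [s1 s2]] := Pxy (e / 2 / (`|a| + 1)) (divr_gt0 e20 a0).
  have [t [t1 t2]] := Pxy' (e / 2) e20.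
  have key (X : hilbertType R) (z z' u u' : X) : `|z - u| < e / 2 / (`|a| + 1) ->
      `|z' - u'| < e / 2 -> `|a *: z + z' - (a *: u + u')| < e.
    move=> h h'; rewrite opprD addrACA -scalerBr [ltRHS]splitr.
    apply: le_lt_trans (ler_normD _ _) _; apply: ler_ltD => //.
    rewrite normrZ; apply: (@le_trans _ _ ((`|a| + 1) * `|z - u|)).
      by rewrite ler_wpM2r// lerDl.
    by rewrite mulrC -ler_pdivlMr// ltW.
  exists ([seq (a * p.1, p.2) | p <- s] ++ t).
  by rewrite !lincomb_cat !lincomb_scale; split; exact: key.
have Pbound x y : P x y -> `|y| <= C%:C * `|x|.
  move=> Pxy; apply/ler_addgt0Pr => e e0.
  have C1 : 0 < 1 + C%:C by rewrite ltr_pwDl// lecR.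
  have [s [s1 s2]] := Pxy (e / (1 + C%:C)) (divr_gt0 e0 C1).
  have -> : y = (y - lincomb w s) + lincomb w s by rewrite subrK.
  apply: le_trans (ler_normD _ _) _.
  have h : `|lincomb v s| <= `|x| + e / (1 + C%:C).
    have -> : lincomb v s = x - (x - lincomb v s) by rewrite subKr.
    by apply: le_trans (ler_normB _ _) _; rewrite lerD2l ltW.
  have h2 : `|lincomb w s| <= C%:C * (`|x| + e / (1 + C%:C)).
    by apply: le_trans (hC s) _; rewrite ler_wpM2l// lecR.
  apply: le_trans (lerD (ltW s2) h2) _.
  rewrite mulrDr addrCA lerD2l -[X in X + _]mul1r -mulrDl mulrCA divff ?mulr1//.
  by rewrite gt_eqF.
have Pex x : exists y, P x y.
  have : forall n : nat, exists s, `|x - lincomb v s| < (n.+1%:R^-1 : R)%:C.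
    move=> n; have /closure_normP : closure (lspan (range v)) x by rewrite [closure _]tv.
    have n0 : 0 < (n.+1%:R^-1 : R)%:C :> R[i] by rewrite ltcR invr_gt0.
    by move=> /(_ _ n0)[z /lspan_lincomb[s ->] zs]; exists s.
  move=> /choice[s hs].
  have dist p q : `|lincomb w (s p) - lincomb w (s q)| <= (C * (p.+1%:R^-1 + q.+1%:R^-1))%:C.
    have -> : lincomb w (s p) - lincomb w (s q) = lincomb w (s p ++ [seq (-1 * i.1,
      i.2) | i <- s q]).
      by rewrite lincomb_cat lincomb_scale scaleN1r.
    apply: le_trans (hC _) _; rewrite [(_ * _)%:C]rmorphM ler_wpM2l ?lecR//.
    rewrite lincomb_cat lincomb_scale scaleN1r.
    have -> : lincomb v (s p) - lincomb v (s q) = (x - lincomb v (s q)) - (x - lincomb v (s p)).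
      by rewrite opprB [RHS]addrC addrA subrK.
    apply: le_trans (ler_normB _ _) _; rewrite rmorphD /= addrC.
    by apply: lerD; apply: ltW; exact: hs.
  have small (e : R) : 0 < e -> exists N, forall n, (N <= n)%N -> n.+1%:R^-1 < e.
    by move=> e0; have [N _ h] := near_infty_natSinv_lt (PosNum e0); exists N.
  have C1 : 0 < C + 1 by rewrite ltr_wpDl.
  have [y hy] : exists y : V, (fun n => lincomb w (s n)) @ \oo --> y.
    apply: cauchy_seq => e e0.
    have e2 : 0 < e / 2 / (C + 1) by rewrite !divr_gt0.
    have [N hN] := small _ e2; exists N => p q Np Nq.
    apply: le_lt_trans (dist p q) _; rewrite ltcR.
    apply: (@le_lt_trans _ _ ((C + 1) * (p.+1%:R^-1 + q.+1%:R^-1))).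
      by rewrite ler_wpM2r// ?lerDl// addr_ge0// invr_ge0.
    have := hN _ Np; have := hN _ Nq; rewrite !ltr_pdivlMr//.
    move: (p.+1%:R^-1) (q.+1%:R^-1) => a b; lra.
  exists y => e e0; have e0' := rp_gt0 e0.
  have [N1 h1] := small _ e0'.
  have /cvg_seqP/(_ _ e0')[N2 h2] := hy.
  exists (s (N1 + N2)%N); rewrite (rpK (ltW e0)); split.
    by apply: lt_trans (hs _) _; rewrite ltcR h1// leq_addr.
  by apply: h2; rewrite leq_addl.
have /choice[f fP] := Pex.
have Puniq x y y' : P x y -> P x y' -> y = y'.
  move=> h h'; apply/eqP; rewrite -subr_eq0 -normr_le0.
  have := Pbound _ _ (Plin (-1) _ _ _ _ h' h).
  by rewrite !scaleN1r !(addrC (- _)) subrr normr0 mulr0.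
have lf : linear f.
  by move=> a u u'; apply: (Puniq (a *: u + u')); [exact: fP|exact: Plin].
have fb x : `|f x| <= C%:C * `|x| by exact: Pbound.
have [B BE] := mk_bop lf fb.
exists B => [i|x]; rewrite BE//; apply: (Puniq (v i)) => // e e0.
exists [:: (1, i)]; rewrite /lincomb !big_seq1 /= !scale1r !subrr !normr0.
by split.
Qed.

Lemma positive_hdotC H (A : bop H H) x y : positive_op A -> hdot (A x) y = hdot x (A y).
Proof.
move=> pA; rewrite adjE; congr hdot; apply/esym.
suff /eqP : A - adj A = 0 by rewrite subr_eq0 => /eqP {1}->.
apply: qform_eq0 => z; rewrite bopBE hdotBl -adjE' (hdotC (A z) z).
by rewrite (CrealP _) ?subrr// ger0_real.
Qed.

Lemma nondec_cauchy (s : nat -> R) (C : R) :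
  (forall n, s n <= s n.+1) -> (forall n, s n <= C) ->
  exists l, [/\ forall n, s n <= l, l <= C & forall e, 0 < e ->
    exists N, forall n, (N <= n)%N -> l - s n < e].
Proof.
move=> ds bs.
have nd : nondecreasing_seq s by apply/nondecreasing_seqP.
have ub : has_ubound (range s) by exists C => _ [n _ <-].
exists (sup (range s)); split.
- by move=> n; apply: ub_le_sup => //; exists n.
- by apply: ge_sup; [exists (s 0%N), 0%N|move=> _ [n _ <-]].
- move=> e e0; have [|_ [N _ <-] h] := @sup_adherent _ (range s) e e0.
    by split => //; exists (s 0%N), 0%N.
  by exists N => n Nn; have := nd _ _ Nn; lra.
Qed.

Section Sqrt.
Variables (H : hilbertType R) (B : bop H H).
Hypothesis B1 : forall x, `|B x| <= `|x|.
Hypothesis Bs : forall x y, hdot (B x) y = hdot x (B y).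

(* With B = 1 - A, the iterates of Y |-> (B + Y^2) / 2 converge to a solution of
   (1 - Y)^2 = A; they are dominated by the iterates for B = 1 in R. *)
Fixpoint sqrt_iter n : bop H H := if n is n'.+1 then 2^-1 *: (B +
  (sqrt_iter n' \oB sqrt_iter n')) else 0.
Fixpoint sqrt_majorant n : R := if n is n'.+1 then 2^-1 * (1 + sqrt_majorant n' ^+ 2) else 0.

Lemma sqrt_iterS n x : sqrt_iter n.+1 x = 2^-1 *: (B x +
  sqrt_iter n (sqrt_iter n x)).
Proof. by rewrite [sqrt_iter n.+1]/= bopZE bopDE. Qed.
Lemma sqrt_iter0 x : sqrt_iter 0 x = 0. Proof. by []. Qed.
Lemma sqrt_majorantS n : sqrt_majorant n.+1 = 2^-1 * (1 +
  sqrt_majorant n ^+ 2).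
Proof. by []. Qed.

Lemma sqrt_majorant_bounds n : 0 <= sqrt_majorant n /\ sqrt_majorant n <= 1.
Proof.
elim: n => [|n [h0 h1]] /=; first by [].
have : sqrt_majorant n ^+ 2 <= 1 by rewrite expr_le1.
have : 0 <= sqrt_majorant n ^+ 2 by rewrite exprn_ge0.
by split; lra.
Qed.

Lemma sqrt_iter_comm_of (Z : bop H H) : (forall x, Z (B x) = B (Z x)) ->
  forall n x, Z (sqrt_iter n x) = sqrt_iter n (Z x).
Proof.
move=> ZB; elim=> [|n IH] x; first by rewrite !sqrt_iter0 bop0.
by rewrite !sqrt_iterS bopZ bopD ZB !IH.
Qed.

Lemma sqrt_iter_comm m n x : sqrt_iter m (sqrt_iter n x) = sqrt_iter n (sqrt_iter m x).
Proof. by apply: sqrt_iter_comm_of => {}x; rewrite (sqrt_iter_comm_of (Z := B)). Qed.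

Lemma sqrt_iter_norm n x : `|sqrt_iter n x| <= (sqrt_majorant n)%:C * `|x|.
Proof.
elim: n x => [|n IH] x; first by rewrite sqrt_iter0 normr0 mul0r.
rewrite sqrt_iterS sqrt_majorantS normrZ rmorphM ger0_norm ?invr_ge0//.
rewrite fmorphV rmorph_nat -mulrA ler_wpM2l ?invr_ge0//.
apply: le_trans (ler_normD _ _) _; rewrite rmorphD mulrDl rmorph1 mul1r lerD//.
apply: le_trans (IH _) _; rewrite rmorphXn /= expr2 -mulrA ler_wpM2l//.
by rewrite lecR; case: (sqrt_majorant_bounds n).
Qed.

Lemma sqrt_iter_norm1 n x : `|sqrt_iter n x| <= `|x|.
Proof.
apply: le_trans (sqrt_iter_norm n x) _; rewrite -[leRHS]mul1r ler_wpM2r//.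
by rewrite -(rmorph1 (real_complex R)) lecR; case: (sqrt_majorant_bounds n).
Qed.

(** The iterates commute, being built from B alone, so a difference of squares factors as sum times
    difference; the scalar majorants satisfy the same factorisation. *)
Lemma sqrt_iter_step n x : `|sqrt_iter n.+1 x - sqrt_iter n x| <=
  (sqrt_majorant n.+1 - sqrt_majorant n)%:C * `|x|.
Proof.
elim: n x => [|n IH] x.
  rewrite sqrt_iterS !sqrt_iter0 addr0 subr0 normrZ.
  rewrite /= expr0n /= addr0 mulr1 subr0 fmorphV rmorph_nat ger0_norm ?invr_ge0//.
  by rewrite ler_wpM2l ?invr_ge0.
have -> : sqrt_iter n.+2 x - sqrt_iter n.+1 x = 2^-1 *: (sqrt_iter n.+1 +
  sqrt_iter n) ((sqrt_iter n.+1 - sqrt_iter n) x).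
  rewrite [sqrt_iter n.+2 x]sqrt_iterS [in X in _ - X]sqrt_iterS -scalerBr bopDE bopBE !bopB;
    congr (_ *: _).
  rewrite opprD addrACA subrr add0r (sqrt_iter_comm n.+1 n).
  by rewrite addrA subrK.
rewrite normrZ ger0_norm ?invr_ge0//.
have -> : sqrt_majorant n.+2 - sqrt_majorant n.+1 = 2^-1 * ((sqrt_majorant n.+1 +
  sqrt_majorant n) * (sqrt_majorant n.+1 - sqrt_majorant n)) by rewrite /=; ring.
rewrite [(2^-1 * _)%:C]rmorphM fmorphV rmorph_nat -mulrA ler_wpM2l ?invr_ge0//.
have y0 : 0 <= sqrt_majorant n.+1 + sqrt_majorant n by apply: addr_ge0;
  case: (sqrt_majorant_bounds n.+1); case: (sqrt_majorant_bounds n).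
apply: (@le_trans _ _ ((sqrt_majorant n.+1 +
  sqrt_majorant n)%:C * `|(sqrt_iter n.+1 - sqrt_iter n) x|)).
  rewrite bopDE rmorphD mulrDl; apply: le_trans (ler_normD _ _) _.
  by apply: lerD; exact: sqrt_iter_norm.
by rewrite rmorphM /= -mulrA ler_wpM2l ?lecR//; exact: IH.
Qed.

Lemma sqrt_majorant_nondec n : sqrt_majorant n <= sqrt_majorant n.+1.
Proof.
have [h0 h1] := sqrt_majorant_bounds n; rewrite /= -subr_ge0.
have -> : 2^-1 * (1 + sqrt_majorant n ^+ 2) - sqrt_majorant n =
  2^-1 * (1 - sqrt_majorant n) ^+ 2 by field.
by rewrite mulr_ge0// exprn_even_ge0.
Qed.

Lemma sqrt_iter_dist n d x : `|sqrt_iter (n + d) x - sqrt_iter n x| <= (sqrt_majorant (n +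
  d) - sqrt_majorant n)%:C * `|x|.
Proof.
elim: d => [|d IH]; first by rewrite addn0 !subrr normr0 mul0r.
rewrite addnS.
have -> : sqrt_iter (n + d).+1 x - sqrt_iter n x = (sqrt_iter (n + d).+1 x - sqrt_iter (n +
  d) x) + (sqrt_iter (n + d) x - sqrt_iter n x).
  by rewrite addrA subrK.
have -> : sqrt_majorant (n + d).+1 - sqrt_majorant n = (sqrt_majorant (n +
  d).+1 - sqrt_majorant (n + d)) + (sqrt_majorant (n + d) - sqrt_majorant n).
  by rewrite addrA subrK.
rewrite rmorphD mulrDl; apply: le_trans (ler_normD _ _) _.
by apply: lerD => //; exact: sqrt_iter_step.
Qed.

Lemma sqrt_iter_sa n x y : hdot (sqrt_iter n x) y = hdot x (sqrt_iter n y).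
Proof.
elim: n x y => [|n IH] x y; first by rewrite !sqrt_iter0 hdot0l hdot0r.
rewrite !sqrt_iterS hdotZl hdotZr !hdotDl !hdotDr Bs !IH; congr (_ * _).
by rewrite fmorphV /= conjC_nat.
Qed.

Lemma sqrt_limit : exists Y : bop H H,
  [/\ forall x, `|Y x| <= `|x|, forall x, hdot (Y x) x = hdot x (Y x) & Y = 2^-1 *: (B +
    (Y \oB Y))].
Proof.
have [l [yl l1 yc]] := nondec_cauchy sqrt_majorant_nondec (fun n => (sqrt_majorant_bounds n).2).
have dist m n x : (n <= m)%N -> `|sqrt_iter m x - sqrt_iter n x| <=
  (l - sqrt_majorant n)%:C * `|x|.
  move=> nm; rewrite -(subnKC nm); apply: le_trans (sqrt_iter_dist _ _ _) _.
  by rewrite ler_wpM2r// lecR lerD2r.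
have /choice[f fP] : forall x, exists y : H, (fun n => sqrt_iter n x) @ \oo --> y.
  move=> x; apply: cauchy_seq => e e0.
  have nx1 : 0 < rp `|x| + 1 by rewrite ltr_wpDl// rp_ge0.
  have [N hN] := yc _ (divr_gt0 (divr_gt0 e0 (ltr0Sn R 1)) nx1); exists N => m n Nm Nn.
  have h p : (N <= p)%N -> `|sqrt_iter p x - sqrt_iter N x| < (e / 2)%:C.
    move=> Np; apply: le_lt_trans (dist _ _ _ Np) _.
    rewrite (rpK (normr_ge0 x)) -rmorphM /= ltcR.
    have := hN _ (leqnn N); rewrite ltr_pdivlMr//; apply: le_lt_trans.
    by rewrite ler_wpM2l ?lerDl// subr_ge0.
  have -> : sqrt_iter m x - sqrt_iter n x =
    (sqrt_iter m x - sqrt_iter N x) - (sqrt_iter n x - sqrt_iter N x) by rewrite opprB addrA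
      subrK.
  apply: le_lt_trans (ler_normB _ _) _.
  by rewrite [e in e%:C]splitr rmorphD; apply: ltrD; exact: h.
have lf : linear f.
  move=> a u v; apply: (@cvg_unique _ (@norm_hausdorff _ H) _ _ _ _ (fP _)).
  rewrite /=; under eq_fun do rewrite bop_linear.
  by apply: cvgD; [apply: cvgZr|]; exact: fP.
have fn x : `|f x| <= 1 * `|x|.
  rewrite mul1r; apply/ler_addgt0Pr => e e0.
  have /cvg_seqP/(_ _ (rp_gt0 e0))[N h] := fP x.
  have -> : f x = (f x - sqrt_iter N x) + sqrt_iter N x by rewrite subrK.
  apply: le_trans (ler_normD _ _) _; rewrite addrC; apply: lerD; first exact: sqrt_iter_norm1.
  by rewrite (rpK (ltW e0)) ltW// h.
have [Y YE] := mk_bop lf fn.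
have YP x : (fun n => sqrt_iter n x) @ \oo --> Y x by rewrite YE.
exists Y; split.
- by move=> x; rewrite YE -[leRHS]mul1r.
- move=> x; have h : (fun n => hdot (sqrt_iter n x) x : R[i]^o) @ \oo --> (hdot (Y x) x :
  R[i]^o) by exact: hdot_cvgl.
  have : (fun n => (hdot (sqrt_iter n x) x)^* : R[i]^o) @ \oo --> ((hdot (Y x) x)^* : R[i]^o).
    apply/cvgrPdist_lt => e e0; move/cvgrPdist_lt : h => /(_ e e0).
    by apply: filterS => n; rewrite -rmorphB /= norm_conjC.
  under eq_fun do rewrite -hdotC -sqrt_iter_sa.
  by move=> h'; rewrite [RHS]hdotC;
    exact: (@cvg_unique _ (@norm_hausdorff _ R[i]^o) _ _ _ _ h h').
- apply: bopP => x; apply: (@cvg_unique _ (@norm_hausdorff _ H) _ _ _ _ (YP x)).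
  suff : (fun n => sqrt_iter n.+1 x) @ \oo --> ((2^-1 *: (B +
    (Y \oB Y))) x) by rewrite (cvg_shiftS (fun n => sqrt_iter n x)).
  (* A product of strongly convergent sequences converges because the iterates are uniformly
     contractive. *)
  have YY : (fun n => sqrt_iter n (sqrt_iter n x)) @ \oo --> Y (Y x).
    apply/cvg_seqP => e e0.
    have e20 : 0 < e / 2 by rewrite divr_gt0.
    have /cvg_seqP/(_ _ e20)[N1 h1] := YP x.
    have /cvg_seqP/(_ _ e20)[N2 h2] := YP (Y x).
    exists (N1 + N2)%N => n Nn.
    have -> : Y (Y x) - sqrt_iter n (sqrt_iter n x) = (Y (Y x) - sqrt_iter n (Y x)) +
      sqrt_iter n (Y x - sqrt_iter n x).
      by rewrite bopB addrA subrK.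
    apply: le_lt_trans (ler_normD _ _) _; rewrite [e in e%:C]splitr rmorphD; apply: ltrD.
      by apply: h2; apply: leq_trans Nn; rewrite leq_addl.
    apply: le_lt_trans (sqrt_iter_norm1 _ _) _.
    by apply: h1; apply: leq_trans Nn; rewrite leq_addr.
  by under eq_fun do rewrite sqrt_iterS; rewrite bopZE bopDE; apply: cvgZr; apply: cvgD YY;
    exact: cvg_cst.
Qed.
End Sqrt.

Lemma sqrt_op_exists H (A : bop H H) : positive_op A ->
  exists Q : bop H H, positive_op Q /\ Q \oB Q = A.
Proof.
move=> pA; have [C C0 AC] := bop_bounded A.
have C0' : 0 < C%:C :> R[i] by rewrite ltcR.
pose A1 := (C%:C)^-1 *: A.
have pA1 : positive_op A1 by move=> x; rewrite bopZE hdotZl mulr_ge0// invr_ge0 ltW.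
have nA1 x : `|A1 x| <= `|x|.
  by rewrite bopZE normrZ gtr0_norm ?invr_gt0// mulrC ler_pdivrMr// mulrC.
have sA1 x y := @positive_hdotC H A1 x y pA1.
(* A1^2 <= A1, which makes B = 1 - A1 a contraction. It follows from positivity of A1 at x - A1 x
   and from A1^3 <= A1^2, the latter by |A1| <= 1. *)
have key x : hdot (A1 x) (A1 x) <= hdot (A1 x) x.
  have := pA1 (x - A1 x); rewrite bopB hdotBl !hdotBr (sA1 (A1 x) x).
  have : hdot (A1 (A1 x)) (A1 x) <= hdot (A1 x) (A1 x).
    have /ger0_norm <- := pA1 (A1 x); apply: le_trans (cauchy_schwarz _ _) _.
    by rewrite -hdot_norm expr2 ler_wpM2r.
  move: (hdot (A1 (A1 x)) (A1 x)) (hdot (A1 x) (A1 x)) (hdot (A1 x) x) => P Q r PQ h.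
  rewrite -subr_ge0 -[r - Q](subrK (Q - P)).
  by apply: addr_ge0 => //; rewrite subr_ge0.
pose B : bop H H := bop_id - A1.
have B1 x : `|B x| <= `|x|.
  rewrite -(ler_pXn2r (ltn0Sn 1)) ?nnegrE// !hdot_norm bopBE /=.
  rewrite hdotBl !hdotBr sA1 -[hdot x (A1 x)]sA1 -subr_ge0.
  have := pA1 x; have := key x; rewrite -subr_ge0 => h1 h2; have := addr_ge0 h1 h2.
  by congr (0 <= _); rewrite sA1; ring.
have Bs x y : hdot (B x) y = hdot x (B y) by rewrite !bopBE hdotBl hdotBr sA1.
have [Y [Y1 Ys YE]] := sqrt_limit B1 Bs.
pose Q1 : bop H H := bop_id - Y.
have pQ1 : positive_op Q1.
  move=> x; rewrite bopBE hdotBl /= subr_ge0.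
  have rY : hdot (Y x) x \is Num.real by apply/CrealP; rewrite -hdotC -Ys.
  apply: le_trans (real_ler_norm rY) _; apply: le_trans (cauchy_schwarz _ _) _.
  by rewrite -hdot_norm expr2 ler_wpM2r.
have Q1E : Q1 \oB Q1 = A1.
  apply: bopP => x; rewrite bop_compE !bopBE !bopB.
  have E : Y x + Y x = (x - A1 x) + Y (Y x).
    rewrite {1 2}YE bopZE -scalerDl -[2^-1]div1r -splitr scale1r.
    by rewrite bopDE bopBE.
  by rewrite !bop_idE opprB [Y (Y x) - _]addrC addrA -[x - _ - _]addrA -opprD E opprD addrA
    subKr subrK.
exists ((Num.sqrt C)%:C *: Q1); split.
  by move=> x; rewrite bopZE hdotZl mulr_ge0// lecR sqrtr_ge0.
apply: bopP => x; rewrite bop_compE !bopZE bopZ -[Q1 (Q1 x)]/((Q1 \oB Q1) x) Q1E scalerA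
  -rmorphM -expr2.
rewrite sqr_sqrtr ?(ltW C0)//.
by rewrite bopZE scalerA divff ?scale1r// gt_eqF.
Qed.

Lemma sqrt_opP H (A : bop H H) : positive_op A ->
  positive_op (sqrt_op A) /\ sqrt_op A \oB sqrt_op A = A.
Proof. by move=> /sqrt_op_exists /(xgetPex (0 : bop H H)). Qed.

Lemma norm2_sum_orth H (z : nat -> H) (m n : nat) :
  (forall p q, p != q -> hdot (z p) (z q) = 0) ->
  norm2 (\sum_(m <= q < n) z q) = \sum_(m <= q < n) norm2 (z q).
Proof.
move=> oz; elim: n => [|n IH]; first by rewrite !big_geq// norm20.
have [mn|mn] := leqP m n; last by rewrite !big_geq// norm20.
rewrite !big_nat_recr//= -IH; apply: (@complexI R); rewrite rmorphD /= -!norm2E pythagoras//.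
rewrite hdot_suml big_nat big1// => q /andP[_ qn]; apply: oz.
by rewrite neq_ltn qn.
Qed.

Lemma orth_series H (z : nat -> H) (C : R) :
  (forall p q, p != q -> hdot (z p) (z q) = 0) ->
  (forall N, \sum_(0 <= q < N) norm2 (z q) <= C) ->
  exists l : H, (fun N => \sum_(0 <= q < N) z q) @ \oo --> l.
Proof.
move=> oz bz.
have mono n : \sum_(0 <= q < n) norm2 (z q) <= \sum_(0 <= q < n.+1) norm2 (z q).
  by rewrite big_nat_recr//= lerDl norm2_ge0.
have [l [sl _ sc]] := nondec_cauchy mono bz.
apply: cauchy_seq => e e0.
have [N hN] := sc _ (exprn_gt0 2 e0); exists N.
have key m n : (N <= m)%N -> (m <= n)%N ->
    `|\sum_(0 <= q < n) z q - \sum_(0 <= q < m) z q| < e%:C.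
  move=> Nm mn; rewrite norm_lt_norm2// (big_cat_nat (leq0n m) mn) /= addrAC subrr add0r.
  rewrite norm2_sum_orth//; have := hN _ Nm; apply: le_lt_trans.
  by rewrite lerBrDl; apply: le_trans (sl n); rewrite (big_cat_nat (leq0n m) mn).
move=> m n Nm Nn; have [mn|nm] := leqP m n; last exact: key (ltnW nm).
by rewrite distrC; exact: key.
Qed.

Lemma sum_by_parts (V : lmodType R[i]) (r : R[i]) (x : nat -> V) N :
  \sum_(0 <= q < N) r ^+ q *: x q =
  (1 - r) *: \sum_(0 <= q < N) r ^+ q *: (\sum_(0 <= p < q.+1) x p) +
  r ^+ N *: \sum_(0 <= p < N) x p.
Proof.
elim: N => [|N IH]; first by rewrite !big_geq// !scaler0 addr0.
rewrite !(big_nat_recr N)//= IH exprS.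
set A := \sum_(0 <= q < N) _ *: _; set S := \sum_(0 <= p < N) x p.
rewrite scalerDr -!addrA; congr (_ + _).
rewrite !scalerDr !scalerA mulrBl mul1r !scalerBl.
rewrite addrACA; congr (_ + _); by rewrite subrK.
Qed.

(** Summation by parts writes the damped partial sum minus L as a weighted mean of the deviations D
    of the undamped sums; as r tends to 1 the early deviations lose their weight and the late ones
    are small. *)
Lemma abel_limit (V : normedModType R[i]) (x : nat -> V) (L Z : V) (y : R -> V) :
  (fun N => \sum_(0 <= q < N) x q) @ \oo --> L ->
  (forall r : R, 0 <= r < 1 -> (fun N => \sum_(0 <= q < N) (r ^+ q)%:C *: x q) @ \oo --> y r) ->
  y @ 1^'- --> Z -> L = Z.
Proof.
move=> xL xy yZ; apply/eqP; rewrite -subr_eq0 -normr_le0; apply/ler_addgt0Pr => e' e'0.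
(* Five errors of size e: Z against y r, the tail of the damped series, the first M deviations, the
   later ones, and the boundary term r^N D N. *)
rewrite add0r; pose e := rp e' / 5.
have e0 : 0 < e by rewrite divr_gt0// rp_gt0.
have e0C : 0 < e%:C :> R[i] by rewrite ltcR.
pose D q := \sum_(0 <= p < q) x p - L.
have /cvg_seqP/(_ _ e0)[M hM] := xL.
have DM q : (M <= q)%N -> `|D q| < e%:C by move=> /hM; rewrite distrC.
pose K := \sum_(0 <= q < M) rp `|D q.+1|.
have K0 : 0 <= K by apply: sumr_ge0 => q _; exact: rp_ge0.
have K1 : 0 < K + 1 by rewrite ltr_wpDl.
have [r [r01 rK yr]] : exists r : R, [/\ 0 <= r < 1, (1 - r) * K < e & `|Z - y r| < e%:C].
  have h1 : \forall r \near (1 : R)^'-, `|Z - y r| < e%:C by move/cvgrPdist_lt : yZ; apply.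
  have h2 : \forall r \near (1 : R)^'-, r < 1 by exact: nbhs_left_lt.
  have h3 : \forall r \near (1 : R)^'-, 0 < r by apply: nbhs_left_gt.
  have h4 : \forall r \near (1 : R)^'-, 1 - e / (K + 1) < r.
    by apply: nbhs_left_gt; rewrite ltrBlDr ltrDl divr_gt0.
  have PF : ProperFilter (nbhs (1 : R)^'-) by exact: at_left_proper_filter.
  have h := @filterI _ _ PF _ _ (@filterI _ _ PF _ _ (@filterI _ _ PF _ _ h1 h2) h3) h4.
  have [r [[[a1 a2] a3] a4]] := @filter_ex R _ PF _ h.
  exists r; split => //; first by rewrite (ltW a3).
  apply: (@le_lt_trans _ _ ((1 - r) * (K + 1))).
    by rewrite ler_wpM2l ?lerDl// subr_ge0 ltW.
  by rewrite -ltr_pdivlMr// ltrBlDl -ltrBlDr.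
have /andP[r0 r1] := r01.
have /cvg_seqP/(_ _ e0)[N1 hN1] := xy r r01.
pose N := (M + N1)%N.
have MN : (M <= N)%N by rewrite leq_addr.
have rr n : 0 <= (r ^+ n)%:C :> R[i] by rewrite lecR exprn_ge0.
have bound : `|\sum_(0 <= q < N) (r ^+ q)%:C *: x q - L| <= ((1 - r) * K + e + e)%:C.
  have -> : \sum_(0 <= q < N) (r ^+ q)%:C *: x q - L =
     (1 - r)%:C *: \sum_(0 <= q < N) (r ^+ q)%:C *: D q.+1 + (r ^+ N)%:C *: D N.
    under eq_bigr do rewrite rmorphXn /=.
    rewrite sum_by_parts.
    under [in RHS]eq_bigr do rewrite rmorphXn /= scalerBr.
    rewrite sumrB -scaler_suml scalerBr rmorphB /= rmorph1 !scalerBr rmorphXn /= addrACA;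
      congr (_ + _).
    rewrite scalerA -opprD -scalerDl.
    have -> : (1 - r%:C) * (\sum_(0 <= i < N) r%:C ^+ i) + r%:C ^+ N = 1 :> R[i].
      by rewrite -[1 - _]opprB mulNr big_mkord -subrX1 opprB subrK.
    by rewrite scale1r.
  apply: le_trans (ler_normD _ _) _; rewrite [leRHS]rmorphD /=; apply: lerD; last first.
    rewrite normrZ ger0_norm//; apply: le_trans (ltW (DM _ MN)).
    by rewrite ler_piMl// -(rmorph1 (real_complex R)) lecR exprn_ile1// ltW.
  rewrite normrZ ger0_norm ?lecR ?subr_ge0 ?(ltW r1)//.
  apply: (@le_trans _ _ ((1 - r)%:C * (K + \sum_(0 <= q < N) r ^+ q * e)%:C)).
    rewrite ler_wpM2l ?lecR ?subr_ge0 ?(ltW r1)//.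
    rewrite (big_cat_nat (leq0n M) MN) /=.
    apply: le_trans (ler_normD _ _) _; rewrite [leRHS]rmorphD /=; apply: lerD.
      apply: le_trans (ler_norm_sum _ _ _) _; rewrite rmorph_sum /=; apply: ler_sum => q _.
      rewrite normrZ ger0_norm// -rpK// ler_piMl// -(rmorph1 (real_complex R)) lecR exprn_ile1//
        ltW//.
    apply: le_trans (ler_norm_sum _ _ _) _.
    rewrite (big_cat_nat (leq0n M) MN) /= rmorphD /=.
    apply: ler_wpDl; first by rewrite lecR; apply: sumr_ge0 => q _;
      rewrite mulr_ge0 ?exprn_ge0 ?(ltW e0).
    rewrite rmorph_sum big_nat [leRHS]big_nat /=; apply: ler_sum => q /andP[Mq _].
    rewrite normrZ ger0_norm// rmorphM ler_wpM2l// ltW// DM//; exact: leq_trans Mq _.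
  rewrite -rmorphM lecR mulrDr lerD2l -mulr_suml mulrA ler_piMl ?(ltW e0)//.
  rewrite -[1 - _]opprB mulNr big_mkord -subrX1 opprB lerBlDl lerDr exprn_ge0//.
have -> : L - Z = - (Z - y r) - (y r - \sum_(0 <= q < N) (r ^+ q)%:C *: x q) - (\sum_(0 <=
  q < N) (r ^+ q)%:C *: x q - L).
  by rewrite !opprB [(y r - Z) + _]addrC [X in _ = X + _]addrA subrK [RHS]addrC addrA subrK.
apply: le_trans (ler_normB _ _) _.
have t1 : `|- (Z - y r) - (y r - \sum_(0 <= q < N) (r ^+ q)%:C *: x q)| <= (e + e)%:C.
  apply: le_trans (ler_normB _ _) _; rewrite normrN rmorphD; apply: lerD; apply: ltW => //.
  by apply: hN1; rewrite leq_addl.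
apply: le_trans (lerD t1 bound) _.
rewrite -rmorphD (rpK (ltW e'0)) lecR.
have : 5 * e = rp e' by rewrite /e mulrC divfK.
lra.
Qed.

End ExtensionSqrt.

(** * Tensor products and Fock spaces *)

Section Tensor2.
Context {R : realType}.
Implicit Types A B D H U V W : hilbertType R.

Fixpoint orthonormal_seq D (us : seq D) : Prop :=
  if us is u :: us' then [/\ norm2 u = 1, forall v, v \in us' ->
    hdot u v = 0 & orthonormal_seq us'] else True.

Lemma orthonormal_seq_dot D (us : seq D) u v : orthonormal_seq us -> u \in us -> v \in us ->
  hdot u v = (u == v)%:R.
Proof.
elim: us => // w us IH /= [w1 wo ous]; rewrite !inE => /orP[/eqP ->|uu] /orP[/eqP ->|vv].
- by rewrite eqxx norm2_hdot w1.
- rewrite wo//; case: eqP => // wv; have := wo _ vv; rewrite -wv norm2_hdot w1 => /eqP.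
  by rewrite rmorph1 oner_eq0.
- rewrite hdotC wo// conjC0; case: eqP => // uw; have := wo _ uu;
  rewrite uw norm2_hdot w1 => /eqP.
  by rewrite rmorph1 oner_eq0.
- exact: IH.
Qed.

Lemma orthonormal_seq_uniq D (us : seq D) : orthonormal_seq us -> uniq us.
Proof.
elim: us => // w us IH /= [w1 wo ous]; rewrite IH// andbT; apply/negP => wu.
by have := wo _ wu; rewrite norm2_hdot w1 => /eqP; rewrite rmorph1 oner_eq0.
Qed.

(** Allows a finite sum of elementary tensors to be rewritten with orthonormal second factors; its
    squared norm is then the sum of those of the first factors. Vectors that depend on the previous
    ones add nothing to [us]. *)
Lemma gram_schmidt D (ys : seq D) : exists us : seq D, orthonormal_seq us /\
  forall y, y \in ys -> y = \sum_(u <- us) hdot y u *: u.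
Proof.
elim: ys => [|y ys [us [ous hus]]]; first by exists [::].
pose z := y - \sum_(u <- us) hdot y u *: u.
have zo v : v \in us -> hdot z v = 0.
  move=> vu; rewrite /z hdotBl hdot_suml (bigD1_seq v)//= ?orthonormal_seq_uniq// hdotZl
    (orthonormal_seq_dot ous vu vu) eqxx mulr1.
  rewrite big1_seq ?addr0 ?subrr// => u /andP[uv uu].
  by rewrite hdotZl (orthonormal_seq_dot ous uu vu) (negPf uv) mulr0.
have [z0|z0] := eqVneq z 0.
  exists us; split => // x; rewrite inE => /orP[/eqP ->|]; last exact: hus.
  by apply/eqP; rewrite -subr_eq0 -/z z0.
have nz : 0 < `|z| by rewrite normr_gt0.
pose w := `|z|^-1 *: z.
have w1 : norm2 w = 1.
  by apply: (@complexI R); rewrite -norm2E normrZ normfV normr_id mulVf ?expr1n// gt_eqF.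
have wo v : v \in us -> hdot w v = 0 by move=> vu; rewrite hdotZl zo// mulr0.
exists (w :: us); split; first by [].
move=> x; rewrite inE big_cons => /orP[/eqP ->|xys]; last first.
  rewrite -(hus _ xys).
  suff -> : hdot x w = 0 by rewrite scale0r add0r.
  rewrite (hus _ xys) hdot_suml big1_seq// => u /andP[_ uu].
  by rewrite hdotZl (hdotC w u) wo// conjC0 mulr0.
have {1}-> : y = z + \sum_(u <- us) hdot y u *: u by rewrite subrK.
congr (_ + _).
have -> : hdot y w = `|z|.
  have -> : y = z + \sum_(u <- us) hdot y u *: u by rewrite subrK.
  rewrite hdotDl hdot_suml big1_seq ?addr0 => [|u /andP[_ uu]]; last first.
    by rewrite hdotZl (hdotC w u) wo// conjC0 mulr0.
  rewrite /w hdotZr fmorphV /= (CrealP _) ?normr_real//.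
  by rewrite -hdot_norm expr2 mulKf// gt_eqF.
by rewrite scalerA divff ?scale1r// gt_eqF.
Qed.

Section OneTensor.
Variables (A D : hilbertType R) (E : htensor2 A D).

Lemma tens20l y : tens2 E 0 y = 0.
Proof.
have := tens2_linearl E 1 0 0 y; rewrite !scale1r !addr0 => h.
by apply: (addrI (tens2 E 0 y)); rewrite addr0.
Qed.
Lemma tens2Dl x x' y : tens2 E (x + x') y = tens2 E x y + tens2 E x' y.
Proof. by have := tens2_linearl E 1 x x' y; rewrite !scale1r. Qed.
Lemma tens2Zl c x y : tens2 E (c *: x) y = c *: tens2 E x y.
Proof. by have := tens2_linearl E c x 0 y; rewrite !addr0 tens20l addr0. Qed.
Lemma tens20r x : tens2 E x 0 = 0.
Proof.
have := tens2_linearr E 1 x 0 0; rewrite !scale1r !addr0 => h.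
by apply: (addrI (tens2 E x 0)); rewrite addr0.
Qed.
Lemma tens2Dr x y y' : tens2 E x (y + y') = tens2 E x y + tens2 E x y'.
Proof. by have := tens2_linearr E 1 x y y'; rewrite !scale1r. Qed.
Lemma tens2Zr c x y : tens2 E x (c *: y) = c *: tens2 E x y.
Proof. by have := tens2_linearr E c x y 0; rewrite !addr0 tens20r addr0. Qed.
Lemma tens2_suml (I : Type) (s : seq I) (P : pred I) (f : I -> A) y :
  tens2 E (\sum_(i <- s | P i) f i) y = \sum_(i <- s | P i) tens2 E (f i) y.
Proof. exact: (big_morph (fun x => tens2 E x y) (fun a b => tens2Dl a b y) (tens20l y)). Qed.
Lemma tens2_sumr (I : Type) (s : seq I) (P : pred I) (f : I -> D) y :
  tens2 E y (\sum_(i <- s | P i) f i) = \sum_(i <- s | P i) tens2 E y (f i).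
Proof. exact: (big_morph (tens2 E y) (tens2Dr y) (tens20r y)). Qed.
Lemma tens2_norm x y : `|tens2 E x y| = `|x| * `|y|.
Proof.
apply/eqP; rewrite -(@eqrXn2 _ 2)// ?mulr_ge0//.
by rewrite exprMn !hdot_norm tens2_dot.
Qed.

Lemma tens2_slot y : exists Z : bop A E, Z =1 (fun x => tens2 E x y).
Proof.
apply: (@mk_bop R A E _ `|y|); first by move=> a u v; rewrite tens2_linearl.
by move=> u; rewrite tens2_norm mulrC.
Qed.

Lemma tens2_total_range : total (range (fun p => tens2 E p.1 p.2)).
Proof.
rewrite /total -(tens2_total E); congr (closure (lspan _)); apply/seteqP; split => z.
  by move=> [[x y] _ <-]; exists x, y.
by move=> [x [y ->]]; exists (x, y).
Qed.

Lemma norm2_orthonormal_seq (us : seq D) (x : D -> A) : orthonormal_seq us ->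
  norm2 (\sum_(u <- us) tens2 E (x u) u) = \sum_(u <- us) norm2 (x u).
Proof.
elim: us => [|w us IH] /=; first by rewrite !big_nil norm20.
move=> [w1 wo ous]; rewrite !big_cons -IH//; apply: (@complexI R);
  rewrite rmorphD /= -!norm2E pythagoras.
  by rewrite tens2_norm exprMn (norm2E w) w1 mulr1.
by rewrite hdot_sumr big1_seq// => u /andP[_ uu]; rewrite tens2_dot wo// mulr0.
Qed.
End OneTensor.

Section OpTensor.
Variables (A A' D : hilbertType R) (E : htensor2 A D) (E' : htensor2 A' D) (X : bop A A').

(** Once the second factors are orthonormal, the bound on X applies to the first factors [xi u] one
    by one, so tensoring with the identity does not increase the bound. *)
Lemma op_tens2_ex (C : R) : 0 <= C -> (forall x, `|X x| <= C%:C * `|x|) ->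
  exists2 Z : bop E E', (forall p : A * D, Z (tens2 E p.1 p.2) = tens2 E' (X p.1) p.2) &
    forall z, `|Z z| <= C%:C * `|z|.
Proof.
move=> C0 XC.
apply: (@ext_bop R E E' (A * D)%type (fun p => tens2 E p.1 p.2) (fun p =>
  tens2 E' (X p.1) p.2) C) => //.
  exact: tens2_total_range.
move=> s.
have [us [ous hus]] := gram_schmidt [seq p.2.2 | p <- s].
pose xi u := \sum_(p <- s) (p.1 * hdot p.2.2 u) *: p.2.1.
have E1 : lincomb (fun p => tens2 E p.1 p.2) s = \sum_(u <- us) tens2 E (xi u) u.
  under [RHS]eq_bigr do rewrite tens2_suml.
  rewrite exchange_big /lincomb; apply: eq_big_seq => p ps.
  rewrite {1}(hus p.2.2) ?map_f//; last by apply/mapP; exists p.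
  rewrite tens2_sumr scaler_sumr; apply: eq_bigr => u _.
  by rewrite tens2Zr tens2Zl scalerA.
have E2 : lincomb (fun p => tens2 E' (X p.1) p.2) s = \sum_(u <- us) tens2 E' (X (xi u)) u.
  under [RHS]eq_bigr do rewrite bop_sum tens2_suml.
  rewrite exchange_big /lincomb; apply: eq_big_seq => p ps.
  rewrite {1}(hus p.2.2); last by apply/mapP; exists p.
  rewrite tens2_sumr scaler_sumr; apply: eq_bigr => u _.
  by rewrite tens2Zr bopZ tens2Zl scalerA.
rewrite norm_le_norm2// E1 E2 (norm2_orthonormal_seq _ xi ous) (norm2_orthonormal_seq _ (fun u
  => X (xi u)) ous).
by rewrite mulr_sumr; apply: ler_sum => u _; rewrite -norm_le_norm2.
Qed.

Lemma op_tens2E x y : op_tens2 E E' X bop_id (tens2 E x y) = tens2 E' (X x) y.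
Proof.
have [C C0 XC] := bop_bounded X.
have [Z ZE _] := op_tens2_ex (ltW C0) XC.
rewrite /op_tens2; set P := [set _ | _].
have : P Z by move=> u v /=; exact: (ZE (u, v)).
by move=> /(xgetI 0); exact.
Qed.

Lemma op_tens2_norm (C : R) : 0 <= C -> (forall x, `|X x| <= C%:C * `|x|) ->
  forall z, `|op_tens2 E E' X bop_id z| <= C%:C * `|z|.
Proof.
move=> C0 XC; have [Z ZE Zn] := op_tens2_ex C0 XC.
suff -> : op_tens2 E E' X bop_id = Z by [].
apply: (@bop_total_eq R E E' _ _ _ (tens2_total_range E)) => _ [p _ <-].
by rewrite op_tens2E ZE.
Qed.

Lemma op_tens2_unique (Z : bop E E') : (forall x y, Z (tens2 E x y) = tens2 E' (X x) y) ->
  op_tens2 E E' X bop_id = Z.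
Proof.
move=> h; apply: (@bop_total_eq R E E' _ _ _ (tens2_total_range E)) => _ [p _ <-].
by rewrite op_tens2E h.
Qed.
End OpTensor.

Lemma op_tens2_comp (A B C D : hilbertType R) (E : htensor2 A D) (F : htensor2 B D) (G :
  htensor2 C D)
  (X : bop A B) (Y : bop B C) :
  op_tens2 E G (Y \oB X) bop_id = op_tens2 F G Y bop_id \oB op_tens2 E F X bop_id.
Proof. by apply: op_tens2_unique => x y; rewrite bop_compE !op_tens2E. Qed.

Lemma op_tens2_adj (A B D : hilbertType R) (E : htensor2 A D) (F : htensor2 B D) (X : bop A B) :
  adj (op_tens2 E F X bop_id) = op_tens2 F E (adj X) bop_id.
Proof.
apply/esym/op_tens2_unique => x y; apply/eqP; rewrite -subr_eq0; apply/eqP.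
apply: (totalP _).1 (tens2_total_range E) _ _ => _ [[u v] _ <-] /=.
by rewrite hdotBl -adjE' op_tens2E !tens2_dot adjE' subrr.
Qed.
End Tensor2.

(** * Orthonormal bases and weighted shifts *)

Section OrthBasis.
Context {R : realType}.
Implicit Types H U V : hilbertType R.

Definition orthonormal (I : eqType) U (e : I -> U) := forall i j, hdot (e i) (e j) = (i == j)%:R.

Lemma total_ext (I : Type) U (e : I -> U) x y : total (range e) ->
  (forall i, hdot x (e i) = hdot y (e i)) -> x = y.
Proof.
move=> /totalP te h; apply/eqP; rewrite -subr_eq0; apply/eqP; apply: te => _ [i _ <-].
by rewrite hdotBl h subrr.
Qed.

Lemma norm2_sum_seq (I : eqType) U (z : I -> U) (s : seq I) : uniq s ->
  (forall i j, i != j -> hdot (z i) (z j) = 0) ->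
  norm2 (\sum_(i <- s) z i) = \sum_(i <- s) norm2 (z i).
Proof.
move=> + oz; elim: s => [|i s IH] /=; first by rewrite !big_nil norm20.
move=> /andP[si us]; rewrite !big_cons -IH//; apply: (@complexI R);
  rewrite rmorphD /= -!norm2E pythagoras//.
rewrite hdot_sumr big1_seq// => j /andP[_ js]; apply: oz.
by apply: contraNneq si => ->.
Qed.

Lemma norm2Z U c (x : U) : norm2 (c *: x) = rp (`|c| ^+ 2) * norm2 x.
Proof.
apply: (@complexI R); transitivity ((rp (`|c| ^+ 2))%:C * (norm2 x)%:C); last by rewrite rmorphM.
by rewrite -rpK ?exprn_ge0// -!norm2E normrZ exprMn.
Qed.

(** Combinations are lists with possible repetitions; collecting equal indices is needed before
    Pythagoras can be applied. *)
Lemma lincomb_group (I : eqType) U (e : I -> U) (s : seq (R[i] * I)) :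
  lincomb e s = \sum_(i <- undup (unzip2 s)) (\sum_(p <- s | p.2 == i) p.1) *: e i.
Proof.
under [RHS]eq_bigr do rewrite scaler_suml.
rewrite (exchange_big_dep xpredT)//= /lincomb; apply: eq_big_seq => p ps.
rewrite big_mkcond (bigD1_seq p.2) ?undup_uniq ?mem_undup ?map_f//=.
by rewrite eqxx big1 ?addr0// => i; rewrite eq_sym => /negPf ->.
Qed.

(** Injectivity of [sg] keeps the images of distinct basis vectors orthogonal, so a bound on the
    weights bounds the operator. *)
Lemma shift_bop (I I' : eqType) U V (e : I -> U) (f : I' -> V) (sg : I -> I') (lam : I ->
  R) (C : R) :
  orthonormal e -> total (range e) -> orthonormal f -> injective sg ->
  (forall i, `|lam i| <= C) -> 0 <= C ->
  exists2 Z : bop U V, (forall i, Z (e i) = (lam i)%:C *: f (sg i)) &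
    (forall x, `|Z x| <= C%:C * `|x|).
Proof.
move=> oe te of_ isg lC C0.
apply: ext_bop => // s.
rewrite norm_le_norm2// !lincomb_group !norm2_sum_seq ?undup_uniq//.
- rewrite mulr_sumr; apply: ler_sum => i _; rewrite scalerA !norm2Z.
  have -> : norm2 (e i) = 1 by apply: (@complexI R); rewrite -norm2_hdot oe eqxx.
  have -> : norm2 (f (sg i)) = 1 by apply: (@complexI R); rewrite -norm2_hdot of_ eqxx.
  rewrite !mulr1 normrM exprMn mulrC.
  have -> : `|(lam i)%:C| ^+ 2 = (lam i ^+ 2)%:C :> R[i].
    by rewrite normc_def /= expr0n addr0 sqrtr_sqr rmorphXn /= -!rmorphXn /= real_normK//
      num_real.
  rewrite rpMr ler_wpM2r ?rp_ge0 ?exprn_ge0//.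
  by rewrite -[lam i ^+ 2]real_normK ?num_real// ler_pXn2r// nnegrE.
- by move=> i j ij; rewrite !hdotZl !hdotZr oe (negPf ij) !mulr0.
- move=> i j ij; rewrite !hdotZl !hdotZr of_ (inj_eq isg) (negPf ij) !mulr0//.
Qed.

Lemma shift_adj (I I' : eqType) U V (e : I -> U) (f : I' -> V) (sg : I -> I') (lam : I -> R)
  (Z : bop U V) : orthonormal e -> total (range e) -> orthonormal f -> injective sg ->
  (forall i, Z (e i) = (lam i)%:C *: f (sg i)) ->
  (forall i, adj Z (f (sg i)) = (lam i)%:C *: e i) /\
  (forall j, (forall i, sg i != j) -> adj Z (f j) = 0).
Proof.
move=> oe te of_ isg ZE; split=> [i|j nj]; apply: (total_ext te) => i'.
  rewrite -adjE' ZE hdotZr hdotZl of_ oe (inj_eq isg) conj_rp.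
  by case: eqP => [->|_]; rewrite ?mulr0.
by rewrite -adjE' ZE hdotZr of_ eq_sym (negPf (nj _)) mulr0 hdot0l.
Qed.

End OrthBasis.

Section TensorFamilies.
Context {R : realType} (k : nat) (F : 'I_k -> hilbertType R) (E : htensor F).

Lemma dfwith_id (I : eqType) (G : I -> Type) (x : forall i, G i) i : dfwith x (x i) = x.
Proof.
apply: functional_extensionality_dep => j.
by have [<-|ij] := eqVneq i j; rewrite ?dfwith_in ?dfwith_out.
Qed.

Lemma tens_norm2 (x : forall i, F i) : norm2 (tens E x) = \prod_i norm2 (x i).
Proof.
apply: (@complexI R); rewrite -norm2_hdot tens_dot rmorph_prod /=.
by apply: eq_bigr => i _; rewrite norm2_hdot.
Qed.

Lemma tens_slot (x : forall i, F i) i : exists Z : bop (F i) E, forall u, Z u =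
  tens E (dfwith x u).
Proof.
pose C := \prod_(j | j != i) norm2 (x j).
have C0 : 0 <= C by apply: prodr_ge0 => j _; exact: norm2_ge0.
apply: (@mk_bop R (F i) E (fun u => tens E (dfwith x u)) (Num.sqrt C)%:C).
  by move=> a u v; rewrite tens_linear.
move=> u; rewrite norm_le_norm2 ?sqrtr_ge0// sqr_sqrtr// tens_norm2 (bigD1 i)//= dfwith_in mulrC.
by rewrite ler_wpM2r ?norm2_ge0// le_eqVlt; apply/orP; left; apply/eqP; apply: eq_bigr => j ji;
  rewrite dfwith_out// eq_sym.
Qed.

(** The factors are freed one at a time: on the indices listed in [s] the vector x is arbitrary, on
    the others it lies in B. The adjoint of a slot map turns orthogonality on the total set B i into
    orthogonality on all of F i. *)
Lemma tens_total_sub (B : forall i, set (F i)) (z : E) :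
  (forall i, total (B i)) ->
  (forall x : forall i, F i, (forall i, B i (x i)) -> hdot z (tens E x) = 0) -> z = 0.
Proof.
move=> tB hz.
suff h (s : seq 'I_k) : forall x : forall i, F i, (forall i, i \notin s -> B i (x i)) ->
  hdot z (tens E x) = 0.
  apply: (totalP _).1 (tens_total E) _ _ => _ [x _ <-].
  by apply: (h (enum 'I_k)) => i; rewrite mem_enum.
elim: s => [|i s IH] x xB; first by apply: hz => i; exact: xB.
have [Z ZE] := tens_slot x i.
have : adj Z z = 0.
  apply: (totalP _).1 (tB i) _ _ => u Bu; rewrite -adjE' ZE; apply: IH => j js.
  have [<-|ij] := eqVneq i j; first by rewrite dfwith_in.
  by rewrite dfwith_out//; apply: xB; rewrite inE negb_or eq_sym ij.
move=> Zz; have := adjE' Z (x i) z; rewrite Zz hdot0l ZE dfwith_id; exact.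
Qed.
End TensorFamilies.

Section FockBasis.
Context {R : realType} {n : nat} (n_gt0 : (0 < n)%N) (F : fock R n).
Let j0 : 'I_n := Ordinal n_gt0.
Notation fb := (fock_basis F).

(** [fock_basis] lands in the tensor power of index [size w]; this form brings two words of equal
    length into one and the same power. *)
Lemma fock_basis_nth (w : seq 'I_n) (p : nat) : size w = p ->
  fb w = finj F p (tens (fpow F p) (fun l : 'I_p => fvec F (nth j0 w l))).
Proof.
move=> <-; rewrite /fock_basis; congr (finj F _ (tens _ _)).
by apply: functional_extensionality_dep => l; rewrite (tnth_nth j0).
Qed.

Lemma fock_orthonormal : orthonormal fb.
Proof.
move=> w w'; have [sw|sw] := eqVneq (size w') (size w); last first.
  rewrite (fock_basis_nth (erefl (size w))) (fock_basis_nth (erefl (size w'))).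
  rewrite finj_orth 1?eq_sym//; case: eqP => // ww; by rewrite ww eqxx in sw.
rewrite (fock_basis_nth (erefl (size w))) (fock_basis_nth sw) (isometric_hdot (@finj_isometric _
  _ F _)).
rewrite tens_dot; have [<-|ww] := eqVneq w w'.
  by rewrite big1// => l _; rewrite fvec_orthonormal eqxx.
have [l lw] : exists l : 'I_(size w), nth j0 w l != nth j0 w' l.
  apply/existsP; rewrite -negb_forall; apply: contraNN ww => /forallP h.
  apply/eqP; apply: (@eq_from_nth _ j0) => // l lw.
  by have /eqP := h (Ordinal lw).
by rewrite (bigD1 l)//= fvec_orthonormal (negPf lw) mul0r.
Qed.

Lemma fock_word (p : nat) (g : 'I_p -> 'I_n) : exists w,
  fb w = finj F p (tens (fpow F p) (fun l => fvec F (g l))).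
Proof.
exists [seq g l | l <- enum 'I_p]; rewrite (@fock_basis_nth _ p);
  last by rewrite size_map size_enum_ord.
congr (finj F _ (tens _ _)); apply: functional_extensionality_dep => l.
by rewrite (nth_map l) ?size_enum_ord// nth_ord_enum.
Qed.

Lemma total_full (H : hilbertType R) (A : set H) : lspan A = setT -> total A.
Proof. by move=> A1; rewrite /total A1 -subTset; exact: subset_closure. Qed.

Lemma fock_total : total (range fb).
Proof.
apply/totalP => z hz; apply: (totalP _).1 (finj_total F) _ _ => _ [p _ [x _ <-]].
suff : adj (finj F p) z = 0 by move=> h; rewrite adjE' h hdot0l.
apply: (@tens_total_sub _ _ _ (fpow F p) (fun=> range (fvec F))).
  by move=> i; apply: total_full; exact: fvec_total.
move=> u Bu; rewrite -adjE'.
have /choice[g hg] : forall l, exists j, fvec F j = u l by move=> l; have [j _ <-] := Bu l;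
  exists j.
have [w wE] := fock_word g.
have -> : u = fun l => fvec F (g l) by apply: functional_extensionality_dep => l; rewrite hg.
by rewrite -wE; apply: hz; exists w.
Qed.
End FockBasis.

Section PolyFock.
Context {R : realType} {k : nat} {n : 'I_k -> nat} (hn : forall i, (0 < n i)%N).
Context {F : forall i : 'I_k, fock R (n i)} (E : htensor (fun i => fspace (F i))).

Definition set_word (b : mword n) (i : 'I_k) (w : seq 'I_(n i)) : mword n :=
  [ffun l => dfwith (fun l => b l) w l].

Lemma set_wordE b i w l : @set_word b i w l = dfwith (fun l => b l) w l.
Proof. by rewrite ffunE. Qed.
Lemma set_word_in b i w : @set_word b i w i = w. Proof. by rewrite set_wordE dfwith_in. Qed.
Lemma set_word_out b i w l : i != l -> @set_word b i w l = b l. Proof. by move=> h;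
  rewrite set_wordE dfwith_out. Qed.
Lemma set_word_id b i : @set_word b i (b i) = b.
Proof. by apply/ffunP => l; rewrite set_wordE (dfwith_id (fun l => b l)). Qed.
Lemma set_word_set_word b i w w' : @set_word (@set_word b i w) i w' = @set_word b i w'.
Proof.
apply/ffunP => l; have [<-|il] := eqVneq i l; first by rewrite !set_word_in.
by rewrite !set_word_out.
Qed.

Lemma ebasis_orthonormal : orthonormal (ebasis E).
Proof.
move=> b c; rewrite /ebasis tens_dot; have [->|bc] := eqVneq b c.
  by rewrite big1// => i _; rewrite (fock_orthonormal (hn i)) eqxx.
have [l lw] : exists l, b l != c l.
  apply/existsP; rewrite -negb_forall; apply: contraNN bc => /forallP h.
  by apply/eqP/ffunP => l; apply/eqP.
by rewrite (bigD1 l)//= (fock_orthonormal (hn l)) (negPf lw) mul0r.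
Qed.

Lemma ebasis_total : total (range (ebasis E)).
Proof.
apply/totalP => z hz; apply: (@tens_total_sub _ _ _ E (fun i => range (fock_basis (F i)))).
  by move=> i; exact: fock_total.
move=> u Bu.
pose w i : seq 'I_(n i) := sval (cid2 (Bu i)).
have hw i : fock_basis (F i) (w i) = u i by rewrite /w; case: cid2.
pose b : mword n := [ffun i => w i].
apply: hz; exists b => //; rewrite /ebasis; congr tens.
by apply: functional_extensionality_dep => l; rewrite ffunE hw.
Qed.

Section Ampliation.
Variables (i : 'I_k) (X : bop (F i) (F i)) (sg : seq 'I_(n i) ->
  seq 'I_(n i)) (lam : seq 'I_(n i) -> R) (C : R).
Hypothesis XE : forall w, X (fock_basis (F i) w) = (lam w)%:C *: fock_basis (F i) (sg w).
Hypothesis isg : injective sg.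
Hypothesis lC : forall w, `|lam w| <= C.
Hypothesis C0 : 0 <= C.

Let sgb (b : mword n) : mword n := @set_word b i (sg (b i)).

Lemma sgb_inj : injective sgb.
Proof.
move=> b c bc; apply/ffunP => l; have [<-|il] := eqVneq i l.
  by have := congr1 (fun d : mword n => d i) bc; rewrite !set_word_in => /isg.
by have := congr1 (fun d : mword n => d l) bc; rewrite !set_word_out.
Qed.

(** The candidate Z is a weighted shift of the basis, so that its value on an arbitrary tensor is
    known only through matrix entries. The adjoints of Z and X agree on each basis vector: both undo
    [sg] in the i-th word, or both vanish if that word is not in the range of [sg]. *)
Lemma ampliation_spec (x : forall l, F l) : ampliation E X (tens E x) =
  tens E (dfwith x (X (x i))).
Proof.
have [Z ZE Zn] := @shift_bop R _ _ E E (ebasis E) (ebasis E) sgb (fun b => lam (b i)) C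
  ebasis_orthonormal ebasis_total ebasis_orthonormal sgb_inj (fun b => lC (b i)) C0.
have [Z1 Z2] := shift_adj ebasis_orthonormal ebasis_total ebasis_orthonormal sgb_inj ZE.
have [X1 X2] := shift_adj (fock_orthonormal (hn i) (F i)) (fock_total (hn i) (F i))
  (fock_orthonormal (hn i) (F i)) isg XE.
suff h : forall x : forall l, F l, Z (tens E x) = tens E (dfwith x (X (x i))).
  rewrite /ampliation; set P := [set _ | _].
  have PZ : P Z by exact: h.
  by have := xgetI 0 PZ; apply.
move=> {}x; apply: (total_ext ebasis_total) => c; rewrite adjE.
rewrite [in RHS]/ebasis [RHS]tens_dot [RHS](bigD1 i)//= dfwith_in adjE.
have -> : \prod_(j < k | j != i) hdot (dfwith x (X (x i)) j) (fock_basis (F j) (c j)) =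
          \prod_(j < k | j != i) hdot (x j) (fock_basis (F j) (c j)).
  by apply: eq_bigr => j ji; rewrite dfwith_out// eq_sym.
have [[w wc]|nw] := pselect (exists w, sg w = c i).
  have -> : c = sgb (@set_word c i w) by rewrite /sgb set_word_set_word set_word_in wc
    set_word_id.
  rewrite Z1 /sgb !set_word_in X1 !hdotZr /ebasis tens_dot (bigD1 i)//= set_word_in mulrA;
    congr (_ * _).
  by apply: eq_bigr => j ji; rewrite !set_word_out// eq_sym.
rewrite X2 ?hdot0r ?mul0r; last by move=> w; apply/eqP => h; apply: nw; exists w.
rewrite Z2 ?hdot0r// => b; apply/eqP => h; apply: nw; exists (b i).
by rewrite -h set_word_in.
Qed.

Lemma ampliation_ebasis b : ampliation E X (ebasis E b) =
  (lam (b i))%:C *: ebasis E (@set_word b i (sg (b i))).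
Proof.
rewrite /ebasis ampliation_spec XE.
have [Z ZE] := tens_slot E (fun l => fock_basis (F l) (b l)) i.
rewrite -ZE bopZ ZE; congr (_ *: tens _ _); apply: functional_extensionality_dep => l.
by have [<-|il] := eqVneq i l; rewrite ?dfwith_in ?set_word_in// dfwith_out// set_word_out.
Qed.
End Ampliation.

End PolyFock.

(** * The coefficients b^(m) *)

Section Words.
Context {R : realType} {T : choiceType}.
Implicit Types (w u v : seq T) (a : seq T -> R).

(** The coefficients of the product of two noncommutative power series; accordingly [wpow a p] gives
    those of the p-th power of a. *)
Definition wconv a (f : seq T -> R) w : R := \sum_(s < (size w).+1) a (take s w) * f (drop s w).

Fixpoint wpow a (p : nat) : seq T -> R :=
  if p is p'.+1 then wconv a (wpow a p') else fun w => (w == [::])%:R.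

(* The coefficients of (1 - a)^-l, that is b^(l); b^(0) is supported by the empty
   word. *)
Definition bpow (l : nat) a w : R :=
  if l is l'.+1 then \sum_(p < (size w).+1) 'C(p + l', l')%:R * wpow a p w
  else (w == [::])%:R.

Variable a : seq T -> R.
Hypotheses (a_ge0 : forall w, 0 <= a w) (a_nil : a [::] = 0).

Lemma wpow_ge0 p w : 0 <= wpow a p w.
Proof.
elim: p w => [|p IH] w; first exact: ler0n.
by apply: sumr_ge0 => s _; rewrite mulr_ge0.
Qed.

(** Without constant term, the p-th power starts in degree p; this is why the sum in [bpow] may stop
    at the length of w. *)
Lemma wpow0 p w : (size w < p)%N -> wpow a p w = 0.
Proof.
elim: p w => // p IH w wp; rewrite -[LHS]/(wconv a (wpow a p) w) /wconv big1// => s _.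
have [->|s0] := posnP s; first by rewrite take0 a_nil mul0r.
rewrite IH ?mulr0// size_drop ltn_subLR; last by rewrite -ltnS.
by apply: leq_trans wp _; rewrite -[p.+1]addn1 addnC leq_add2r.
Qed.

Lemma wconvS (f : seq T -> R) w : wconv a f w =
  \sum_(s < size w) a (take s.+1 w) * f (drop s.+1 w).
Proof. by rewrite /wconv big_ord_recl take0 a_nil mul0r add0r. Qed.

Lemma bpow_sum l w N : (size w < N)%N ->
  bpow l.+1 a w = \sum_(0 <= p < N) 'C(p + l, l)%:R * wpow a p w.
Proof.
move=> wN; rewrite /bpow (big_cat_nat (leq0n _) wN) /= big_mkord [X in _ = _ +
  X]big_nat [X in _ = _ + X]big1 ?addr0// => p.
by move=> /andP[wp _]; rewrite wpow0 ?mulr0.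
Qed.

Lemma bpow_ge0 l w : 0 <= bpow l a w.
Proof.
case: l => [|l]; first exact: ler0n.
by apply: sumr_ge0 => p _; rewrite mulr_ge0// wpow_ge0.
Qed.

Lemma bpow_nil l : bpow l a [::] = 1.
Proof.
case: l => [|l]; first by rewrite /bpow eqxx.
by rewrite /bpow /= big_ord_recl big_ord0 addr0 add0n binn mulr1.
Qed.

(* The coefficient form of (1 - a) (1 - a)^-(l+1) = (1 - a)^-l. *)
Lemma bpow_rec l w : bpow l.+1 a w = wconv a (bpow l.+1 a) w + bpow l a w.
Proof.
pose N := (size w).+2.
have h1 : wconv a (bpow l.+1 a) w = \sum_(0 <= p < N.-1) 'C(p + l, l)%:R * wpow a p.+1 w.
  transitivity (wconv a (fun v => \sum_(0 <= p < N.-1) 'C(p + l, l)%:R * wpow a p v) w).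
    apply: eq_bigr => s _; congr (_ * _); rewrite (@bpow_sum _ _ N.-1)//.
    by rewrite ltnS size_drop leq_subr.
  rewrite /wconv; under eq_bigr do rewrite mulr_sumr.
  rewrite exchange_big; apply: eq_bigr => p _ /=.
  by rewrite /wconv mulr_sumr; apply: eq_bigr => s _; rewrite mulrCA.
have hrec l' : bpow l'.+1 a w = wpow a 0 w + \sum_(0 <= p < N.-1) 'C(p.+1 + l',
  l')%:R * wpow a p.+1 w.
  by rewrite (@bpow_sum _ _ N)// big_nat_recl// add0n binn mul1r.
rewrite h1 hrec; case: l {h1} => [|l].
  rewrite addrC; congr (_ + _); by apply: eq_bigr => p _; rewrite !addn0 !bin0.
rewrite (hrec l) addrCA; congr (_ + _); rewrite -big_split; apply: eq_bigr => p _.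
(* Pascal's rule, coefficient by coefficient of the powers of a. *)
by rewrite addSn binS natrD mulrDl addnS -addSn.
Qed.

Lemma bpow_mono l w : bpow l a w <= bpow l.+1 a w.
Proof.
rewrite bpow_rec lerDr; apply: sumr_ge0 => s _.
by rewrite mulr_ge0// bpow_ge0.
Qed.

Lemma bpow_mono_le l l' w : (l <= l')%N -> bpow l a w <= bpow l' a w.
Proof.
move=> ll; rewrite -(subnKC ll); elim: (l' - l)%N => [|d IH]; first by rewrite addn0.
by rewrite addnS; apply: le_trans (bpow_mono _ _).
Qed.

(** Only the term of [bpow_rec] that splits off the first letter is kept. Since a [:: j] > 0, this
    is what bounds the weights of the shifts W_ij. *)
Lemma bpow_cons l j w : a [:: j] * bpow l.+1 a w <= bpow l.+1 a (j :: w).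
Proof.
have E1 : take (@ord0 (size w)).+1 (j :: w) = [:: j] by case: (w).
have E2 : drop (@ord0 (size w)).+1 (j :: w) = w by case: (w).
rewrite [leRHS]bpow_rec wconvS big_ord_recl E1 E2 -addrA lerDl addr_ge0 ?bpow_ge0//.
by apply: sumr_ge0 => s _; rewrite mulr_ge0// bpow_ge0.
Qed.

Lemma bpow_gt0 l w : (forall j, 0 < a [:: j]) -> 0 < bpow l.+1 a w.
Proof.
move=> a1; elim: w => [|j w IH]; first by rewrite bpow_nil.
by apply: lt_le_trans (bpow_cons _ _ _); rewrite mulr_gt0.
Qed.

(** The first factor has length s + 1, hence is nonempty. A duplicate-free list is wanted in order
    to evaluate the sum over a set in [bcoef]. *)
Fixpoint factorizations (p : nat) w : seq (p.-tuple (seq T)) :=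
  if p is p'.+1 then
    [seq cons_tuple (take s.+1 w) g | s <- iota 0 (size w), g <- factorizations p' (drop s.+1 w)]
  else if w is [::] then [:: [tuple]] else [::].

Lemma factorizations_uniq p w : uniq (factorizations p w).
Proof.
elim: p w => [|p IH] w /=; first by case: w.
apply: allpairs_uniq_dep => [||]; first exact: iota_uniq.
  by move=> s _; exact: IH.
move=> [s g] [s' g'] /allpairsPdep[s1 [g1 [s1w g1d /= E1]]] /allpairsPdep[s2 [g2 [s2w g2d /=
  E2]]] /= [] E3.
case: E1 => E1 E1'; case: E2 => E2 E2'; subst.
move=> Eg; have sz t : t \in iota 0 (size w) -> size (take t.+1 w) = t.+1.
  by rewrite mem_iota add0n => /andP[_ tw]; rewrite size_takel.
have : s1.+1 = s2.+1 by rewrite -(sz _ s1w) -(sz _ s2w) E3.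
by case=> ->; rewrite (val_inj Eg).
Qed.

Lemma mem_factorizations p w (g : p.-tuple (seq T)) : (g \in factorizations p w) =
  (flatten g == w) && all (fun v => 0 < size v)%N g.
Proof.
elim: p w g => [|p IH] w g /=.
  by rewrite tuple0; case: w.
case/tupleP: g => u g /=.
apply/allpairsPdep/andP => [[s [g' [sw g'd /= E]]]|[/eqP <-]].
  have [Eu Eg] : u = take s.+1 w /\ g = g'.
    by split; [have := congr1 (fun t => thead t) E; rewrite !theadE|apply: val_inj;
      have := congr1 (fun t : p.+1.-tuple _ => behead t) E].
  move: g'd; rewrite -Eg IH => /andP[/eqP fg ag]; rewrite Eu fg cat_take_drop eqxx; split => //.
  by rewrite ag andbT size_take; move: sw; rewrite mem_iota /= add0n; case: ifP => // _ ;
    case: (size w).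
move=> /andP[u0 ag]; exists (size u).-1, g; rewrite prednK//; split.
- by rewrite mem_iota /= add0n size_cat prednK// leq_addr.
- by rewrite drop_size_cat// IH eqxx.
- by rewrite take_size_cat.
Qed.

Lemma factorizations_sum p w : \sum_(g <- factorizations p w) \prod_(v <- g) a v = wpow a p w.
Proof.
elim: p w => [|p IH] w /=.
  by case: w => [|x w]; rewrite ?big_seq1 ?big_nil//.
rewrite big_allpairs_dep /= wconvS -(big_mkord xpredT (fun s =>
  a (take s.+1 w) * wpow a p (drop s.+1 w))).
rewrite /index_iota subn0; apply: eq_bigr => s _.
by rewrite -IH mulr_sumr; apply: eq_bigr => g _; rewrite big_cons.
Qed.

End Words.

Lemma bcoefE (R : realType) (n : nat) (a : seq 'I_n -> R) (m : nat) (w : seq 'I_n) :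
  a [::] = 0 -> (0 < m)%N -> bcoef a m w = bpow m a w.
Proof.
move=> a0; case: m => // m _; case: w => [|x w]; first by rewrite bpow_nil.
rewrite /bcoef [RHS]/bpow -(big_mkord xpredT (fun p => 'C(p + m, m)%:R * wpow a p (x :: w))).
(* [bcoef] starts at p = 1 and [bpow] at p = 0, but the 0-th power of a vanishes on a nonempty
   word. *)
rewrite [RHS]big_ltn// [wpow _ 0 _]/= mulr0 add0r; apply: eq_bigr => p _.
rewrite -(factorizations_sum a0) mulrC mulr_suml [RHS]fsbig_seq ?factorizations_uniq// addnS
  !subn1 /=.
apply: eq_fsbigl; apply/seteqP; split => g /=; rewrite mem_factorizations.
  by move=> [-> ->]; rewrite eqxx.
by move=> /andP[/eqP -> ->].
Qed.

(** * Unordered sums of nonnegative terms and their regrouping *)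

Section Esum.
Context {R : realType}.
Local Open Scope ereal_scope.

Lemma esum_swap (T1 T2 : choiceType) (f : T1 -> T2 -> \bar R) : (forall i j, 0 <= f i j) ->
  \esum_(i in [set: T1]) \esum_(j in [set: T2]) f i j =
    \esum_(j in [set: T2]) \esum_(i in [set: T1]) f i j.
Proof.
move=> f0; rewrite !esum_esum//.
rewrite (reindex_esum ([set: T2] `*`` fun=> [set: T1]) _ (fun x => (x.2, x.1)))//; split => //=.
  by move=> [i1 i2] [j1 j2] /= _ _ [] -> ->.
by move=> [i1 i2] _ /=; exists (i2, i1).
Qed.

Lemma esum_ord_nat (f : nat -> \bar R) N : (forall i, 0 <= f i) ->
  \esum_(i in `I_N) f i = \sum_(i < N) f i.
Proof. by move=> f0; rewrite esum_fset ?finite_II// fsbig_ord. Qed.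

(** A pair of words is the same thing as the word u ++ v with a cutting position, namely the length
    of u. *)
Lemma esum_split_words (T : choiceType) (G : seq T -> seq T ->
  \bar R) : (forall u v, 0 <= G u v) ->
  \esum_(u in [set: seq T]) \esum_(v in [set: seq T]) G u v =
  \esum_(w in [set: seq T]) \sum_(s < (size w).+1) G (take s w) (drop s w).
Proof.
move=> G0.
under [RHS]eq_esum => w _ do rewrite -(@esum_ord_nat (fun s => G (take s w) (drop s w)))//.
rewrite !esum_esum//.
apply: (reindex_esum ([set: seq T] `*`` fun w => `I_(size w).+1) _ (fun x => (take x.2 x.1,
  drop x.2 x.1))).
split => //=.
  move=> [w s] [w' s'] /=; rewrite !inE /= => -[_ sw] [_ sw'] [E1 E2].
  have ww : w = w' by rewrite -(cat_take_drop s w) E1 E2 cat_take_drop.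
  congr (_, _) => //; have := congr1 size E1; rewrite !size_take_min.
  by rewrite (minn_idPl _) ?(minn_idPl _)// -ltnS.
move=> [u v] _ /=; exists (u ++ v, size u) => /=.
  by split => //=; rewrite ltnS size_cat leq_addr.
by rewrite take_size_cat// drop_size_cat.
Qed.

Lemma esum_diag (G : nat -> nat -> \bar R) : (forall u v, 0 <= G u v) ->
  \esum_(p in [set: nat]) \sum_(s < p.+1) G s p =
  \esum_(s in [set: nat]) \esum_(r in [set: nat]) G s (s + r)%N.
Proof.
move=> G0; under eq_esum => p _ do rewrite -(@esum_ord_nat (fun s => G s p))//.
rewrite !esum_esum//.
apply: (reindex_esum _ ([set: nat] `*`` fun w => `I_w.+1) (fun x => (x.1 + x.2,
  x.1)%N) (fun y => G y.2 y.1)).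
split => //=.
- by move=> [s r] _ /=; split => //=; rewrite ltnS leq_addr.
- by move=> [s r] [s' r'] /= _ _ [] /[swap] -> /addnI ->.
- move=> [p s] [_ /= sp]; exists (s, p - s)%N => //=; by rewrite subnKC.
Qed.

(** One inequality is enough: applied to the inverse of c it gives the other. *)
Lemma esum_scale (T : choiceType) (c : R) (f : T -> \bar R) : (0 <= c)%R ->
  (forall x, 0 <= f x) ->
  \esum_(x in [set: T]) (c%:E * f x) = c%:E * \esum_(x in [set: T]) f x.
Proof.
have key (d : R) (g : T -> \bar R) : (0 <= d)%R -> (forall x, 0 <= g x) ->
  \esum_(x in [set: T]) (d%:E * g x) <= d%:E * \esum_(x in [set: T]) g x.
  move=> d0 g0; apply: ge_ereal_sup => _ [X [finX _] <-].
  rewrite -ge0_mule_fsumr//; apply: lee_wpmul2l; first by rewrite lee_fin.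
  by apply: ereal_sup_ubound; exists X.
move=> c0 f0; apply/eqP; rewrite eq_le key//=.
have [->|c1] := eqVneq c 0%R; first by rewrite mul0e esum_ge0// => x _; rewrite mul0e.
have cp : (0 < c)%R by rewrite lt0r c1.
have := key c^-1%R (fun x => c%:E * f x).
rewrite invr_ge0 => /(_ c0) h.
have {}h := h (fun x => @mule_ge0 _ c%:E _ (c0 : 0 <= c%:E) (f0 x)).
have := @lee_wpmul2l _ c%:E _ _ _ h; rewrite !muleA -EFinM divff// mul1e => /(_ _).
under eq_esum do rewrite muleA -EFinM mulVf// mul1e.
by apply; rewrite lee_fin.
Qed.

(** The bridge between unordered sums and the series of finite level sums in which [Phi] and
    [berezin] are defined. *)
Lemma esum_graded (T : choiceType) (nu : T -> nat) (g : T -> R) :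
  (forall q, finite_set [set x | nu x = q]) -> (forall x, (0 <= g x)%R) ->
  \esum_(x in [set: T]) (g x)%:E = \sum_(q <oo) (\sum_(x \in [set x | nu x = q]) g x)%R%:E.
Proof.
move=> fin g0; rewrite nneseries_esumT; last by move=> q; rewrite lee_fin fsumr_ge0.
have -> : [set: T] = \bigcup_(q in [set: nat]) [set x | nu x = q].
  by apply/seteqP; split => // x _; exists (nu x).
rewrite esum_bigcupT//; last first.
  by move=> q q' _ _ [x [/= <- <-]].
apply: eq_esum => q _; rewrite esum_fset//; last by move=> x _; rewrite lee_fin.
by rewrite fsumEFin.
Qed.

End Esum.

Section Graded.
Context {R : realType}.

Lemma EFin_series (f : nat -> R) N : (\sum_(0 <= q < N) (f q)%:E)%E = (\sum_(0 <= q < N) f q)%:E.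
Proof. by rewrite sumEFin. Qed.

Lemma nneseries_EFin_cvg (f : nat -> R) (L : R) : (forall q, 0 <= f q) ->
  (fun N => \sum_(0 <= q < N) f q : R^o) @ \oo --> (L : R^o) ->
  (\sum_(q <oo) (f q)%:E)%E = L%:E.
Proof.
move=> f0 fL; apply: cvg_lim => //.
under eq_fun do rewrite EFin_series.
by apply/cvg_EFin; [exact: nearW|exact: fL].
Qed.

Lemma nneseries_EFin_lim (f : nat -> R) (L : R) : (forall q, 0 <= f q) ->
  (\sum_(q <oo) (f q)%:E)%E = L%:E ->
  (fun N => \sum_(0 <= q < N) f q : R^o) @ \oo --> (L : R^o).
Proof.
move=> f0 fL.
have : (fun N => (\sum_(0 <= q < N) (f q)%:E)%E) @ \oo --> L%:E.
  by rewrite -fL; apply: is_cvg_nneseries => q _ _; rewrite lee_fin.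
under eq_fun do rewrite EFin_series.
by move=> /fine_cvg.
Qed.

Lemma esum_graded_cvg (T : choiceType) (nu : T -> nat) (g : T -> R) (L : R) :
  (forall q, finite_set [set x | nu x = q]) -> (forall x, 0 <= g x) ->
  (fun N => \sum_(0 <= q < N) \sum_(x \in [set x | nu x = q]) g x : R^o) @ \oo --> (L : R^o) ->
  (\esum_(x in [set: T]) (g x)%:E)%E = L%:E.
Proof.
move=> fin g0 gL; rewrite (esum_graded fin)//; apply: nneseries_EFin_cvg => // q.
by rewrite fsumr_ge0.
Qed.

Lemma esum_graded_lim (T : choiceType) (nu : T -> nat) (g : T -> R) (L : R) :
  (forall q, finite_set [set x | nu x = q]) -> (forall x, 0 <= g x) ->
  (\esum_(x in [set: T]) (g x)%:E)%E = L%:E ->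
  (fun N => \sum_(0 <= q < N) \sum_(x \in [set x | nu x = q]) g x : R^o) @ \oo --> (L : R^o).
Proof.
move=> fin g0; rewrite (esum_graded fin)// => /nneseries_EFin_lim; apply=> q.
by rewrite fsumr_ge0.
Qed.

Lemma sum_tuple_set (T : finType) (V : nmodType) (p : nat) (G : seq T -> V) :
  \sum_(w : p.-tuple T) G w = \sum_(w \in [set w : seq T | size w = p]) G w.
Proof.
transitivity (\sum_(w <- [seq tval t | t <- enum {: p.-tuple T}]) G w).
  by rewrite big_map big_enum.
have u : uniq [seq tval t | t <- enum {: p.-tuple T}].
  by rewrite map_inj_uniq ?enum_uniq//; exact: val_inj.
rewrite fsbig_seq//.
apply: eq_fsbigl; apply/seteqP; split => w /=.
  by move=> /mapP[t _ ->]; rewrite size_tuple.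
move=> sw; apply/mapP; exists (tcast sw (in_tuple w)); first by rewrite mem_enum.
by rewrite val_tcast.
Qed.

Lemma finite_words (T : finType) p : finite_set [set w : seq T | size w = p].
Proof.
have -> : [set w : seq T | size w = p] = [set` [seq tval t | t <- enum {: p.-tuple T}]].
  apply/seteqP; split => w /=; last by move=> /mapP[t _ ->]; rewrite size_tuple.
  move=> sw; apply/mapP; exists (tcast sw (in_tuple w)); first by rewrite mem_enum.
  by rewrite val_tcast.
exact: finite_seq.
Qed.

Lemma telescope_esum (c : nat -> R) : (forall p, c p.+1 <= c p) ->
  (c : nat -> R^o) @ \oo --> (0 : R^o) ->
  (\esum_(p in [set: nat]) (c p - c p.+1)%:E)%E = (c 0%N)%:E.
Proof.
move=> dc c0; rewrite -nneseries_esumT => [|p]; last by rewrite lee_fin subr_ge0.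
apply: nneseries_EFin_cvg => [q|]; first by rewrite subr_ge0.
have E N : \sum_(0 <= q < N) (c q - c q.+1) = c 0%N - c N.
  elim: N => [|N IH]; first by rewrite big_geq ?subrr.
    by rewrite big_nat_recr//= IH addrA subrK.
under eq_fun do rewrite E.
have := @cvgB R R^o _ _ _ _ _ _ _ (@cvg_cst R^o (c 0%N) nat \oo _) c0.
by rewrite subr0; apply.
Qed.

Lemma hockey_stick p m : ('C(p + m.+1, m.+1) = \sum_(s < p.+1) 'C(s + m, m))%N.
Proof.
elim: p => [|p IH]; first by rewrite big_ord_recl big_ord0 !add0n !binn.
by rewrite big_ord_recr /= -IH addSn binS addnS -addSn addnC addSn -addnS addnC.
Qed.
End Graded.

(** * The maps Phi and the isometry of the Berezin kernel *)

Section QuadraticForm.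
Context {R : realType} {H : hilbertType R}.
Implicit Types Y Z : bop H H.

Definition qf Y (h : H) : R := rp (hdot (Y h) h).

Lemma qfE Y h : positive_op Y -> hdot (Y h) h = (qf Y h)%:C.
Proof. by move=> pY; rewrite -rpK. Qed.
Lemma qf_ge0 Y h : positive_op Y -> 0 <= qf Y h.
Proof. by move=> pY; exact: rp_ge0. Qed.
Lemma qfB Y Z h : qf (Y - Z) h = qf Y h - qf Z h.
Proof. by rewrite /qf bopBE hdotBl rpB. Qed.
Lemma qfD Y Z h : qf (Y + Z) h = qf Y h + qf Z h.
Proof. by rewrite /qf bopDE hdotDl rpD. Qed.
Lemma qf_id h : qf bop_id h = norm2 h.
Proof. by rewrite /qf bop_idE norm2_hdot. Qed.
Lemma positive0 : positive_op (0 : bop H H).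
Proof. by move=> x; rewrite bop0E hdot0l. Qed.
Lemma positiveD Y Z : positive_op Y -> positive_op Z -> positive_op (Y + Z).
Proof. by move=> pY pZ x; rewrite bopDE hdotDl addr_ge0. Qed.
Lemma positive_id : positive_op (bop_id : bop H H).
Proof. by move=> x; rewrite bop_idE -hdot_norm exprn_ge0. Qed.

Lemma qf_inj Y Z : positive_op Y -> positive_op Z -> qf Y =1 qf Z -> Y = Z.
Proof.
move=> pY pZ YZ; apply/eqP; rewrite -subr_eq0; apply/eqP; apply: qform_eq0 => x.
by rewrite bopBE hdotBl !qfE// YZ subrr.
Qed.

Lemma wot_unique (V : hilbertType R) (T : Type) (F : set_system T) (PF : ProperFilter F)
  (A : T -> bop H V) B B' : wot_cvg F A B -> wot_cvg F A B' -> B = B'.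
Proof.
move=> h h'; apply: bopP => x; apply: hdot_ext => y.
exact: (@cvg_unique _ (@norm_hausdorff _ R[i]^o) _ _ _ _ (h x y) (h' x y)).
Qed.

Lemma wot_qf (T : Type) (F : set_system T) (PF : Filter F) (A : T -> bop H H) B h :
  wot_cvg F A B -> (fun t => qf (A t) h : R^o) @ F --> (qf B h : R^o).
Proof. by move=> AB; apply: (@rp_cvg R T F PF (fun t => hdot (A t h) h)); exact: AB. Qed.

End QuadraticForm.

Section PhiTheory.
Context {R : realType} {n : nat} (a : seq 'I_n -> R).
Hypotheses (a_ge0 : forall w, 0 <= a w) (a_nil : a [::] = 0).
Context {H : hilbertType R} (X : 'I_n -> bop H H).
Hypothesis HX : Phi_defined a X.
Implicit Types Y Z : bop H H.
Notation Ph := (Phi a X).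
Notation Xa w := (adj (opword X w)).

Lemma PhiP Y : wot_cvg \oo (Phi_partial a X Y) (Ph Y).
Proof. exact: (xgetPex (0 : bop H H) (HX Y)). Qed.

Lemma Phi_partialE Y N x y : hdot (Phi_partial a X Y N x) y =
  \sum_(1 <= p < N) \sum_(w : p.-tuple 'I_n) (a w)%:C * hdot (Y (Xa w x)) (Xa w y).
Proof.
rewrite /Phi_partial bop_sumE hdot_suml; apply: eq_bigr => p _.
rewrite bop_sumE hdot_suml; apply: eq_bigr => w _.
by rewrite bopZE hdotZl !bop_compE adjE.
Qed.

Lemma Phi_linear c Y Z : Ph (c *: Y + Z) = c *: Ph Y + Ph Z.
Proof.
apply: (@wot_unique R H H nat \oo _ (Phi_partial a X (c *: Y + Z)) _ _ (@PhiP _)) => x y.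
have -> : (fun t => hdot (Phi_partial a X (c *: Y + Z) t x) y : R[i]^o) =
   (fun t => c * hdot (Phi_partial a X Y t x) y + hdot (Phi_partial a X Z t x) y).
  apply: funext => N; rewrite !Phi_partialE mulr_sumr -big_split; apply: eq_bigr => p _.
  rewrite mulr_sumr -big_split; apply: eq_bigr => w _ /=.
  transitivity ((a w)%:C * hdot (c *: Y (Xa w x) + Z (Xa w x)) (Xa w y)) => //.
  by rewrite hdotDl hdotZl mulrDr mulrCA.
rewrite bopDE bopZE hdotDl hdotZl.
apply: (@cvgD R[i] R[i]^o); last exact: PhiP.
by apply: (@cvgMr R[i]); exact: PhiP.
Qed.

(** Positivity of Y makes every term nonnegative, so that the weak limit defining [Phi] becomes a
    sum that may be rearranged. *)
Lemma Phi_esum Y h : positive_op Y ->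
  (\esum_(w in [set: seq 'I_n]) (a w * qf Y (Xa w h))%:E)%E = (qf (Ph Y) h)%:E.
Proof.
move=> pY; apply: (esum_graded_cvg (nu := size)) => [q|w|]; first exact: finite_words.
  by rewrite mulr_ge0// qf_ge0.
have h1 : (fun N => qf (Phi_partial a X Y N) h : R^o) @ \oo --> (qf (Ph Y) h :
  R^o) by exact: (wot_qf _ (@PhiP Y)).
apply: cvg_trans h1; apply: near_eq_cvg.
exists 1%N => // N /= N1; rewrite /qf Phi_partialE rp_sum big_ltn//.
(* [Phi_partial] starts at length 1; the level 0 of the graded sum is the empty word, whose
   coefficient is 0. *)
rewrite (_ : \sum_(x \in [set x | size x = 0]) _ = 0) ?add0r; last first.
  by apply: fsbig1 => w /size0nil ->; rewrite a_nil mul0r.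
apply: eq_bigr => p _; rewrite rp_sum -(sum_tuple_set p (fun w =>
  a w * rp (hdot (Y (Xa w h)) (Xa w h)))).
by apply: eq_bigr => w _; rewrite rpMr.
Qed.

Lemma Phi_pos Y : positive_op Y -> positive_op (Ph Y).
Proof.
move=> pY h.
have real N : 0 <= hdot (Phi_partial a X Y N h) h.
  rewrite Phi_partialE; apply: sumr_ge0 => p _; apply: sumr_ge0 => w _.
  by rewrite mulr_ge0// lecR.
have hl := @PhiP Y h h; have hn : (fun N => `|hdot (Phi_partial a X Y N h) h| :
  R[i]^o) @ \oo --> (`|hdot (Ph Y h) h| : R[i]^o) by exact: cvg_norm hl.
suff -> : hdot (Ph Y h) h = `|hdot (Ph Y h) h| by [].
apply: (@cvg_unique _ (@norm_hausdorff _ R[i]^o) _ _ _ _ hl).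
by move: hn; apply: cvg_trans; apply: near_eq_cvg; apply: nearW => N /=; rewrite ger0_norm.
Qed.

Lemma Phi_iter_pos Y p : positive_op Y -> positive_op (iter p Ph Y).
Proof. by move=> pY; elim: p => //= p IH; exact: Phi_pos. Qed.

Lemma Phi_iter_linear c Y Z p : iter p Ph (c *: Y + Z) = c *: iter p Ph Y + iter p Ph Z.
Proof. by elim: p => //= p ->; rewrite Phi_linear. Qed.
Lemma Phi_iterB Y Z p : iter p Ph (Y - Z) = iter p Ph Y - iter p Ph Z.
Proof. by have := Phi_iter_linear (-1) Z Y p; rewrite !scaleN1r !(addrC (- _)). Qed.

Lemma opword_cat u v : opword X (u ++ v) = opword X u \oB opword X v.
Proof. by elim: u => [|j u IH] /=; apply: bopP => x //=; rewrite IH. Qed.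

Lemma adj_opword_cat u v h : Xa (u ++ v) h = Xa v (Xa u h).
Proof. by rewrite opword_cat adj_comp. Qed.

(** Adjoints reverse products, so the word u of the outer [Phi] and the word v of the inner iterate
    act together as u ++ v; collecting the splittings of one word gives the convolution. *)
Lemma wpow_esum Y p h : positive_op Y ->
  (\esum_(w in [set: seq 'I_n]) (wpow a p w * qf Y (Xa w h))%:E)%E = (qf (iter p Ph Y) h)%:E.
Proof.
move=> pY; elim: p h => [|p IH] h.
  rewrite (esumID [set [::]])// => [|w _]; last by rewrite lee_fin mulr_ge0 ?qf_ge0//= ler0n.
  rewrite setTI esum_set1; last by rewrite lee_fin mulr_ge0 ?qf_ge0//= ler0n.
  rewrite esum1 => [|w [_ /= w0]]; last by case: eqP => // ; rewrite ?mul0r.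
  by rewrite adde0 /= mul1r adj_id.
rewrite [iter _ _ _]/= -Phi_esum; last exact: Phi_iter_pos.
have E u : (a u * qf (iter p Ph Y) (Xa u h))%:E =
   (\esum_(v in [set: seq 'I_n]) (a u * (wpow a p v * qf Y (Xa v (Xa u h))))%:E)%E.
  rewrite EFinM -IH -esum_scale// => v; rewrite lee_fin mulr_ge0 ?qf_ge0//; exact: wpow_ge0.
under [RHS]eq_esum do rewrite E.
rewrite (@esum_split_words R _ (fun u v => (a u * (wpow a p v * qf Y (Xa v (Xa u h))))%:E));
  last first.
  by move=> u v; rewrite lee_fin !mulr_ge0 ?qf_ge0//; exact: wpow_ge0.
apply: eq_esum => w _; rewrite sumEFin; congr EFin.
rewrite /= /wconv mulr_suml; apply: eq_bigr => s _.
by rewrite -adj_opword_cat cat_take_drop mulrA.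
Qed.

Lemma bpow_esum Y m h : positive_op Y ->
  (\esum_(w in [set: seq 'I_n]) (bpow m.+1 a w * qf Y (Xa w h))%:E)%E =
  (\esum_(p in [set: nat]) ('C(p + m, m)%:R * qf (iter p Ph Y) h)%:E)%E.
Proof.
move=> pY.
have t0 p w : 0 <= 'C(p + m, m)%:R * (wpow a p w * qf Y (Xa w h)).
  by rewrite !mulr_ge0 ?qf_ge0 ?ler0n//; exact: wpow_ge0.
have E p : (('C(p + m, m)%:R * qf (iter p Ph Y) h)%:E =
   \esum_(w in [set: seq 'I_n]) ('C(p + m, m)%:R * (wpow a p w * qf Y (Xa w h)))%:E)%E.
  by rewrite EFinM -wpow_esum// -esum_scale// => w; rewrite lee_fin mulr_ge0 ?qf_ge0//;
    exact: wpow_ge0.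
under [RHS]eq_esum do rewrite E.
rewrite esum_swap; last by move=> p w; rewrite lee_fin.
apply: eq_esum => w _.
rewrite -nneseries_esumT => [|p]; last by rewrite lee_fin.
apply/esym; apply: nneseries_EFin_cvg => //.
(* Powers of a beyond the length of w vanish on w, so the partial sums are constant from there
   on. *)
apply/cvgrPdist_lt => e e0; exists (size w).+1 => // N wN.
rewrite (bpow_sum a_nil _ (wN : (size w < N)%N)) mulr_suml [X in _ - X](eq_bigr (fun p => 'C(p +
  m, m)%:R * wpow a p w * qf Y (Xa w h))).
  by rewrite subrr normr0.
by move=> p _; rewrite mulrA.
Qed.

Definition defect Y : bop H H := Y - Ph Y.

(** Each application of [defect] subtracts [Phi] of a positive operator. The result provides the
    dominations by which iterates of [Phi] are shown to tend to 0. *)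
Lemma defect_le Y l : (forall l', (l' <= l)%N -> positive_op (iter l' defect Y)) ->
  positive_op (Y - iter l defect Y).
Proof.
elim: l => [|l IH] h; first by rewrite subrr; exact: positive0.
have -> : Y - iter l.+1 defect Y = (Y - iter l defect Y) + Ph (iter l defect Y).
  by rewrite /= {1}/defect opprB addrCA addrC.
apply: positiveD; first by apply: IH => l' l'l; apply: h; rewrite ltnW.
by apply: Phi_pos; exact: h.
Qed.

(** By [bpow_esum] this is a statement on the sequence Phi^p alone. For exponent 1 the series
    telescopes; a higher exponent is lowered by one through a second telescoping inside the sum. *)
Lemma resolvent_sum Y m h : (forall l, (l <= m.+1)%N -> positive_op (iter l defect Y)) ->
  (fun p => qf (iter p Ph Y) h : R^o) @ \oo --> (0 : R^o) ->
  (\esum_(w in [set: seq 'I_n]) (bpow m.+1 a w * qf (iter m.+1 defect Y) (Xa w h))%:E)%E =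
    (qf Y h)%:E.
Proof.
move=> pD lim0; rewrite bpow_esum; last exact: pD.
elim: m pD => [|m IH] pD.
  pose c p := qf (iter p Ph Y) h.
  rewrite -(telescope_esum (c := c))//.
    apply: eq_esum => p _; rewrite addn0 bin0 mul1r /c [iter 1 _ _]/= /defect Phi_iterB qfB
      -iterSr //.
  move=> p; rewrite -subr_ge0 /c iterSr -qfB -Phi_iterB; apply: qf_ge0; apply: Phi_iter_pos.
  exact: (pD 1%N).
set Y' := iter m.+1 defect Y.
have pY' : positive_op Y' by apply: pD; rewrite leqW.
have pDY' : positive_op (defect Y') by exact: (pD m.+2).
have pY : positive_op Y by exact: (pD 0%N).
pose c p := qf (iter p Ph Y') h.
(* Y' <= Y by [defect_le], hence Phi^p(Y') is dominated by Phi^p(Y). *)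
have c_lim : (c : nat -> R^o) @ \oo --> (0 : R^o).
  apply: (@squeeze_cvgr _ _ _ _ (fun=> 0) (fun p => qf (iter p Ph Y) h)) => //;
    last exact: cvg_cst.
  apply: nearW => p; rewrite /c qf_ge0 /=; last exact: Phi_iter_pos.
  rewrite -subr_ge0 -qfB -Phi_iterB; apply: qf_ge0; apply: Phi_iter_pos.
  by apply: defect_le => l lm; apply: pD; exact: leqW.
have c_dec p : c p.+1 <= c p.
  rewrite -subr_ge0 /c iterSr -qfB -Phi_iterB; apply: qf_ge0; exact: Phi_iter_pos.
have cE p : qf (iter p Ph (defect Y')) h = c p - c p.+1.
  by rewrite /c /defect Phi_iterB qfB -iterSr.
rewrite [iter m.+2 _ _]/= -/Y' -IH; last by move=> l lm; apply: pD; rewrite leqW.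
(* The binomial coefficient is a sum over s <= p. After the exchange, the differences c p - c (p +
   1) with p >= s add up to c s, which leaves the sum for the exponent m + 1. *)
under [LHS]eq_esum => p _.
  rewrite hockey_stick natr_sum mulr_suml cE -sumEFin.
  over.
rewrite (@esum_diag R (fun s p => ('C(s + m, m)%:R * (c p - c p.+1))%:E)); last first.
  by move=> s p; rewrite lee_fin mulr_ge0// subr_ge0.
apply: eq_esum => s _.
rewrite -/(c s) -[s in c s]addn0 -(telescope_esum (c := fun r => 'C(s + m, m)%:R * c (s + r)%N)).
- by apply: eq_esum => r _; rewrite mulrBr addnS.
- by move=> r; rewrite ler_wpM2l// addnS.
- rewrite -(mulr0 'C(s + m, m)%:R); apply: (@cvgMr R).
  by under eq_fun do rewrite addnC; move: c_lim; rewrite -(cvg_shiftn s).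
Qed.
End PhiTheory.

Section LinearMaps.
Context {R : realType} {H : hilbertType R}.
Implicit Types Y Z : bop H H.

Definition maplin (L : bop H H -> bop H H) := forall c Y Z, L (c *: Y + Z) = c *: L Y + L Z.

Lemma maplinB L Y Z : maplin L -> L (Y - Z) = L Y - L Z.
Proof. by move=> lL; have := lL (-1) Z Y; rewrite !scaleN1r !(addrC (- _)). Qed.

(* Every Y is a combination of the positive operators C + Re(w Y), w = 1, i. *)
Lemma maplin_pos_eq L1 L2 : maplin L1 -> maplin L2 ->
  (forall Y, positive_op Y -> L1 Y = L2 Y) -> L1 =1 L2.
Proof.
move=> l1 l2 E Y.
have [C C0 YC] := bop_bounded Y.
pose P (w : R[i]) : bop H H := C%:C *: bop_id + 2^-1 *: (w *: Y + adj (w *: Y)).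
have pP w : `|w| = 1 -> positive_op (P w).
  move=> w1 x; rewrite !(bopDE, bopZE) bop_idE hdotDl !hdotZl hdotDl -adjE' bopZE hdotZl hdotZr.
  rewrite -hdot_norm.
  have -> : w * hdot (Y x) x + w^* * hdot x (Y x) = w * hdot (Y x) x + (w * hdot (Y x) x)^*.
    by rewrite rmorphM /= -hdotC.
  set z := w * hdot (Y x) x.
  have rz : z + z^* = 2 * (rp z)%:C by rewrite /rp -addcJ.
  rewrite rz mulKf//.
  have nz : `|z| <= C%:C * `|x| ^+ 2.
    rewrite normrM w1 mul1r; apply: le_trans (cauchy_schwarz _ _) _.
    by rewrite expr2 mulrA ler_wpM2r.
  have : - (rp z)%:C <= C%:C * `|x| ^+ 2.
    by apply: le_trans nz; rewrite -normrN -rmorphN -rpN; exact: rp_le_norm.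
  by rewrite -subr_ge0 opprK.
have [h hE] : exists h : R[i] -> bop H H, forall w, h w = 2^-1 *: (w *: Y + adj (w *: Y)).
  by exists (fun w => 2^-1 *: (w *: Y + adj (w *: Y))).
have E1 w : `|w| = 1 -> L1 (h w) = L2 (h w).
  move=> w1; have -> : h w = P w - C%:C *: bop_id by rewrite hE /P addrAC subrr add0r.
  rewrite !maplinB// (E _ (pP w w1)); congr (_ - _); apply: E => x.
  by rewrite bopZE hdotZl mulr_ge0 ?lecR ?(ltW C0)// -hdot_norm exprn_ge0.
have YE : Y = (- 'i)%R *: h 'i%R + h 1.
  rewrite !hE.
  have adjZ w : adj (w *: Y) = w^* *: adj Y.
    by apply: adj_unique => x y; rewrite !bopZE hdotZl hdotZr conjCK adjE.
  rewrite !adjZ conjCi conjC1 !scale1r !scalerDr !scalerA.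
  have -> : (- 'i * 2^-1 * 'i)%R = 2^-1 :> R[i] by rewrite mulrAC mulNr -expr2 sqrCi opprK mul1r.
  have -> : (- 'i * 2^-1 * - 'i)%R = - 2^-1 :> R[i] by rewrite mulrAC mulrNN -expr2 sqrCi mulN1r.
  rewrite addrACA scaleNr addNr addr0 -scalerDl -[2^-1]div1r -splitr scale1r //.
by rewrite YE l1 l2 (E1 _ (@normr1 R[i])) (E1 _ (@normCi R[i])).
Qed.

Section Comm.
Variables (I : eqType) (g : I -> bop H H -> bop H H).
Hypothesis gC : forall i j Y, g i (g j Y) = g j (g i Y).

Lemma foldr_comm i Y s : g i (foldr g Y s) = foldr g (g i Y) s.
Proof. by elim: s => //= j s IH; rewrite gC IH. Qed.

Lemma foldr_rem i Y s : i \in s -> foldr g Y s = foldr g (g i Y) (rem i s).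
Proof.
elim: s => // j s IH; rewrite inE /=; case: eqP => [<-|ji] /=; first by rewrite eqxx foldr_comm.
by rewrite eq_sym; case: eqP => [/esym//|_] /= /IH ->.
Qed.
End Comm.
End LinearMaps.

(** * Commuting tuples, purity and the sum over all multi-words *)

Section Commuting.
Context {R : realType} {k : nat} {n : 'I_k ->
  nat} {H : hilbertType R} (X : forall i : 'I_k, 'I_(n i) -> bop H H).
Arguments X : clear implicits.

Definition commuting := forall s t, s != t -> forall j l x, X s j (X t l x) = X t l (X s j x).

Hypothesis hX : commuting.

Lemma opword_letter_comm s t : s != t ->
  forall u j x, opword (X s) u (X t j x) = X t j (opword (X s) u x).
Proof. by move=> st; elim=> //= l u IH j x; rewrite IH hX. Qed.

Lemma opword_comm s t : s != t ->
  forall u v x, opword (X s) u (opword (X t) v x) = opword (X t) v (opword (X s) u x).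
Proof. by move=> st u; elim=> //= l v IH x; rewrite opword_letter_comm// IH. Qed.

Lemma adj_opword_comm s t : s != t -> forall u v x,
  adj (opword (X s) u) (adj (opword (X t) v) x) = adj (opword (X t) v) (adj (opword (X s) u) x).
Proof.
move=> st u v x; rewrite -!bop_compE -!adj_comp; congr (adj _ x).
by apply: bopP => y; rewrite !bop_compE (opword_comm st).
Qed.

End Commuting.

Lemma polydomain_commuting (R : realType) (k : nat) (n : 'I_k ->
  nat) (a : forall i : 'I_k, seq 'I_(n i) -> R)
  (m : 'I_k -> nat) (H : hilbertType R) (T : forall i : 'I_k, 'I_(n i) -> bop H H) :
  polydomain a m T -> commuting T.
Proof. by case=> _ h _ s t st j l x; have := congr1 (fun A : bop H H => A x) (h s t st j l). Qed.

Section MultiPhi.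
Context {R : realType} {k : nat} {n : 'I_k -> nat} (a : forall i : 'I_k, seq 'I_(n i) -> R).
Arguments a : clear implicits.
Hypothesis ha : forall i, positive_regular (a i).
Context {H : hilbertType R} (T : forall i : 'I_k, 'I_(n i) -> bop H H).
Arguments T : clear implicits.
Variable m : 'I_k -> nat.
Hypothesis hm : forall i, (0 < m i)%N.
Hypothesis hT : polydomain a m T.
Hypothesis hTpure : pure a T.

Notation Ph i := (Phi (a i) (T i)).
Notation D i := (defect (a i) (T i)).

Let a_ge0 i w : 0 <= a i w. Proof. by case: (ha i). Qed.
Let a_nil i : a i [::] = 0. Proof. by case: (ha i). Qed.
Let HX i : Phi_defined (a i) (T i). Proof. by case: hT. Qed.
Let Tcomm : commuting T := polydomain_commuting hT.

Lemma Phi_maplin i : maplin (Ph i). Proof. by move=> c Y Z; exact: Phi_linear. Qed.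

(** For positive Y both sides are one double sum of nonnegative terms, read in two orders;
    [maplin_pos_eq] carries the equality over to all Y. *)
Lemma Phi_comm s t Y : Ph s (Ph t Y) = Ph t (Ph s Y).
Proof.
have [->//|st] := eqVneq s t.
apply: (@maplin_pos_eq _ _ (fun Y => Ph s (Ph t Y)) (fun Y => Ph t (Ph s Y))).
- by move=> c U V; rewrite !Phi_maplin.
- by move=> c U V; rewrite !Phi_maplin.
move=> {}Y pY.
have pp i Z : positive_op Z -> positive_op (Ph i Z) by move=> pZ; apply: Phi_pos.
apply: qf_inj => [||h]; [by apply/pp/pp|by apply/pp/pp|].
have key i j : (qf (Ph i (Ph j Y)) h)%:E =
  (\esum_(u in [set: seq 'I_(n i)]) \esum_(v in [set: seq 'I_(n j)])
   (a i u * (a j v * qf Y (adj (opword (T j) v) (adj (opword (T i) u) h))))%:E)%E.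
  rewrite -Phi_esum//; last exact: pp.
  apply: eq_esum => u _; rewrite EFinM -Phi_esum// -esum_scale// => v.
  by rewrite lee_fin mulr_ge0// qf_ge0.
have : (qf (Ph s (Ph t Y)) h)%:E = (qf (Ph t (Ph s Y)) h)%:E.
  rewrite !key esum_swap => [|u v]; last by rewrite lee_fin !mulr_ge0// qf_ge0.
  apply: eq_esum => v _; apply: eq_esum => u _.
  by rewrite mulrCA (adj_opword_comm Tcomm)// eq_sym.
by case.
Qed.

Lemma Phi_iter_comm s t p q Y : iter p (Ph s) (iter q (Ph t) Y) = iter q (Ph t) (iter p (Ph s) Y).
Proof.
have h Z : Ph s (iter q (Ph t) Z) = iter q (Ph t) (Ph s Z).
  by elim: q => //= q IH; rewrite Phi_comm IH.
by elim: p => //= p ->; rewrite h.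
Qed.

Let iter_lin i p : maplin (iter p (Ph i)).
Proof. by move=> c Y Z; apply: Phi_iter_linear. Qed.

Definition iter_gap (q : 'I_k -> nat) i Y : bop H H := Y - iter (q i) (Ph i) Y.

Lemma iter_gap_comm q i j Y : iter_gap q i (iter_gap q j Y) = iter_gap q j (iter_gap q i Y).
Proof.
have key (V : zmodType) (x y z t : V) : x - y - (z - t) = x - z - (y - t).
  by rewrite opprB (addrC t) addrACA [in RHS]opprB (addrC t).
by rewrite /iter_gap !(maplinB _ _ (iter_lin _ _)) (Phi_iter_comm i j) key.
Qed.

Definition iter_defect (p : 'I_k -> nat) i Z := iter (p i) (D i) Z.

Lemma D_comm i j Y : D i (D j Y) = D j (D i Y).
Proof. by have := iter_gap_comm (fun=> 1%N) i j Y. Qed.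

Lemma D_iter_comm i j p q Y : iter p (D i) (iter q (D j) Y) = iter q (D j) (iter p (D i) Y).
Proof.
have h Z : D i (iter q (D j) Z) = iter q (D j) (D i Z) by elim: q => //= q IH; rewrite D_comm IH.
by elim: p => //= p ->; rewrite h.
Qed.

Lemma DeltaE p Y : Delta a T p Y = foldr (iter_defect p) Y (enum 'I_k).
Proof. by []. Qed.

Lemma Delta_pos p : (forall i, (p i <= m i)%N) -> positive_op (Delta a T p bop_id).
Proof. by case: hT => _ _; exact. Qed.

Lemma Delta_incr p j : D j (Delta a T p bop_id) = Delta a T (fun i => p i + (i == j))%N bop_id.
Proof.
rewrite !DeltaE.
have C q i l Y : iter_defect q i (iter_defect q l Y) =
  iter_defect q l (iter_defect q i Y) by exact: D_iter_comm.
have je : j \in enum 'I_k by rewrite mem_enum.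
rewrite (foldr_rem (C _) _ je) [RHS](foldr_rem (C _) _ je).
rewrite /iter_defect eqxx addn1 iterS.
have : j \notin rem j (enum 'I_k) by rewrite mem_rem_uniq ?enum_uniq// inE eqxx.
move: (iter (p j) _ _) => Z; elim: (rem j _) => //= l s IH; rewrite inE negb_or => /andP[jl js].
rewrite -IH// (eq_sym l) (negPf jl) addn0; exact: (D_iter_comm j l 1).
Qed.

Lemma iter_gap_sum q j Y : iter_gap q j Y = \sum_(0 <= t < q j) iter t (Ph j) (D j Y).
Proof.
rewrite /iter_gap; elim: (q j) => [|N IH]; first by rewrite big_geq ?subrr.
by rewrite big_nat_recr//= -IH /defect (maplinB _ _ (iter_lin _ _)) -iterSr addrA subrK.
Qed.

Lemma foldr_iter_gap_lin q s : maplin (foldr (iter_gap q) ^~ s).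
Proof.
elim: s => //= i s IH c Y Z; rewrite IH /iter_gap iter_lin opprD addrACA -scalerN -scalerDr //.
Qed.

Lemma foldr_iter_gap_sum q s N (f : nat -> bop H H) :
  foldr (iter_gap q) (\sum_(0 <= t < N) f t) s = \sum_(0 <= t < N) foldr (iter_gap q) (f t) s.
Proof.
have l0 : foldr (iter_gap q) 0 s = 0.
  by have := foldr_iter_gap_lin q s 1 0 0; rewrite !scale1r addr0 => h;
    apply: (addrI (foldr (iter_gap q) 0 s)); rewrite addr0.
elim: N => [|N IH]; first by rewrite !big_geq.
by rewrite !big_nat_recr//= -IH; have := foldr_iter_gap_lin q s 1 (\sum_(0 <= t < N) f t) (f N);
  rewrite !scale1r.
Qed.

(** 1 - Phi^q = (1 + Phi + ... + Phi^(q-1)) (1 - Phi). Each factor thus becomes a sum of iterates of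
    Phi_j, applied to [Delta] with its j-th exponent raised from 0 to 1, which m still allows. *)
Lemma foldr_iter_gap_pos q s p : uniq s -> (forall i, (p i <= m i)%N) -> (forall i, i \in s ->
  p i = 0%N) ->
  positive_op (foldr (iter_gap q) (Delta a T p bop_id) s).
Proof.
elim: s p => [|j s IH] p /=; first by move=> _ pm _; exact: Delta_pos.
move=> /andP[js us] pm ps.
rewrite (foldr_comm (iter_gap_comm q)) iter_gap_sum foldr_iter_gap_sum.
elim: (q j) => [|N IHN]; first by rewrite big_geq//; exact: positive0.
rewrite big_nat_recr//=; apply: positiveD => //.
have -> Y : foldr (iter_gap q) (iter N (Ph j) Y) s = iter N (Ph j) (foldr (iter_gap q) Y s).
  elim: (s) => //= l s' ->; rewrite /iter_gap (maplinB _ _ (iter_lin _ _)) (Phi_iter_comm j l) //.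
apply: Phi_iter_pos => //; rewrite Delta_incr; apply: IH => // i.
  by case: eqP => [->|_]; rewrite ?addn0 ?addn1 ?pm// ps ?mem_head.
move=> is_; rewrite ps ?inE ?is_ ?orbT//; case: eqP => // ij; by rewrite -ij is_ in js.
Qed.

(* Bounds the factor of index i by the product in the definition of purity, so
   that a pure tuple has Phi_i^q(1) -> 0 for each i. *)
Lemma foldr_iter_gap_le q i s : uniq s -> i \notin s ->
  positive_op (iter_gap q i bop_id - foldr (iter_gap q) (iter_gap q i bop_id) s).
Proof.
elim: s => [|j s IH] /=; first by rewrite subrr => _ _; exact: positive0.
move=> /andP[js us]; rewrite inE negb_or => /andP[ij is_].
rewrite {2}/iter_gap opprB addrCA addrC; apply: positiveD; first exact: IH.
apply: Phi_iter_pos => //; rewrite -foldr_rcons.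
have E : Delta a T (fun=> 0%N) bop_id = bop_id by rewrite DeltaE; elim: (enum _).
rewrite -E; apply: foldr_iter_gap_pos => //; by rewrite rcons_uniq is_.
Qed.

Lemma Phi_iter_cvg0 i h : (fun p => qf (iter p (Ph i) bop_id) h : R^o) @ \oo --> (0 : R^o).
Proof.
apply/cvgrPdist_lt => e e0.
have FF : Filter (@multi_oo k).
  split; first by exists (fun=> 0%N).
    move=> A B [q1 h1] [q2 h2]; exists (fun j => maxn (q1 j) (q2 j)) => q hq; split.
      by apply: h1 => j; apply: leq_trans (hq j); rewrite leq_maxl.
    by apply: h2 => j; apply: leq_trans (hq j); rewrite leq_maxr.
  by move=> A B AB [q1 h1]; exists q1 => q hq; apply/AB/h1.
have := @hTpure h h => /cvgrPdist_lt/(_ e%:C); rewrite ltcR => /(_ e0)[q0 hq0].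
exists (q0 i) => // N /= Nq.
(* Purity controls all tuples above q0; only the i-th exponent has to vary. *)
pose q j := if j == i then N else q0 j.
have qq j : (q0 j <= q j)%N by rewrite /q; case: eqP => [->|].
have := hq0 q qq.
have -> : foldl (fun (Y : bop H H) i => Y - iter (q i) (Ph i) Y) bop_id (enum 'I_k) =
          foldr (iter_gap q) bop_id (rev (enum 'I_k)) by rewrite -[enum _ in LHS]revK foldl_rev.
have ie : i \in rev (enum 'I_k) by rewrite mem_rev mem_enum.
have ue : uniq (rev (enum 'I_k)) by rewrite rev_uniq enum_uniq.
rewrite (foldr_rem (iter_gap_comm q) _ ie).
have := @foldr_iter_gap_le q i (rem i (rev (enum 'I_k))) (rem_uniq _ ue).
rewrite mem_rem_uniq// inE eqxx => /(_ isT).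
set W := foldr _ _ _ => pW hW; rewrite sub0r normrN ger0_norm ?qf_ge0//; last first.
  by apply: Phi_iter_pos => //; exact: positive_id.
rewrite -ltcR; apply: le_lt_trans hW.
rewrite -hdotBl -bopBE; apply: le_trans (rp_le_norm _); rewrite lecR -/(qf _ h).
have -> : bop_id - W = (iter_gap q i bop_id - W) + iter (q i) (Ph i) bop_id.
  by rewrite /iter_gap addrAC subrK.
by rewrite qfD /q eqxx lerDr qf_ge0.
Qed.

Section SuffixSum.

(** Suffixes of the enumeration let [Delta] and [mopword_adj] unfold together: in both, the head
    index is applied last, so that a sum over its words can be carried out with the other words
    fixed. *)
Definition suffix_Delta (s : seq 'I_k) : bop H H := foldr (iter_defect m) bop_id s.

Definition suffix_adj (s : seq 'I_k) (b : mword n) : bop H H :=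
  foldr (fun i A => adj (opword (T i) (b i)) \oB A) bop_id s.

Lemma suffix_Delta_pos s1 i s l : enum 'I_k = s1 ++ i :: s -> (l <= m i)%N ->
  positive_op (iter l (D i) (suffix_Delta s)).
Proof.
(* The operator is [Delta] at this tuple, with exponent 0 on s1; positivity at all tuples below m,
   not only at m, is used here. *)
move=> E lm; pose p j := if j == i then l else if j \in s then m j else 0%N.
have pm j : (p j <= m j)%N by rewrite /p; case: eqP => [->|_]//; case: ifP.
have := enum_uniq 'I_k; rewrite E cat_uniq /= => /and4P[_ s1d is_ us].
have := Delta_pos pm; rewrite DeltaE E foldr_cat /=.
have -> : foldr (iter_defect p) bop_id s = suffix_Delta s.
  suff h t : i \notin t -> {subset t <= s} ->
    foldr (iter_defect p) bop_id t = foldr (iter_defect m) bop_id t by exact: h.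
  elim: t => //= j t IH; rewrite inE negb_or => /andP[ij it] ts.
  rewrite IH//; last by move=> x xt; apply: ts; rewrite inE xt orbT.
  by rewrite /iter_defect /p eq_sym (negPf ij) ts ?mem_head.
have h t Z : {subset t <= s1} -> foldr (iter_defect p) Z t = Z.
  elim: t => //= j t IH ts; rewrite IH; last by move=> x xt; apply: ts; rewrite inE xt orbT.
  have js1 : j \in s1 by apply: ts; rewrite mem_head.
  move: s1d; rewrite negb_or => /andP[is1 /hasPn s1d].
  rewrite /iter_defect /p; case: eqP => [ji|_]; first by rewrite -ji js1 in is1.
  by case: ifP => // js; have := s1d _ js; rewrite /= js1.
by rewrite h// /iter_defect /p eqxx.
Qed.

Lemma suffix_Delta_pos0 s1 s : enum 'I_k = s1 ++ s -> positive_op (suffix_Delta s).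
Proof.
case: s => [|i s] E; first exact: positive_id.
by have := suffix_Delta_pos E (leqnn (m i)).
Qed.

Lemma suffix_Delta_le1 s1 s : enum 'I_k = s1 ++ s -> positive_op (bop_id - suffix_Delta s).
Proof.
elim: s s1 => [|i s IH] s1 E; first by rewrite subrr; exact: positive0.
have -> : bop_id - suffix_Delta (i :: s) = (bop_id - suffix_Delta s) +
  (suffix_Delta s - iter (m i) (D i) (suffix_Delta s)).
  by rewrite /= addrA subrK.
apply: positiveD; first by apply: (IH (rcons s1 i)); rewrite cat_rcons.
apply: defect_le => // l lm; exact: (suffix_Delta_pos E).
Qed.

(** The resolvent identity for index i with Y = [suffix_Delta s]. Its limit hypothesis holds because
    Y <= 1 and, by purity, the iterates of Phi_i at 1 tend to 0. *)
Lemma one_sum s1 i s h : enum 'I_k = s1 ++ i :: s ->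
  (\esum_(w in [set: seq 'I_(n i)]) (bcoef (a i) (m i) w * qf (suffix_Delta (i :: s)) (adj
    (opword (T i) w) h))%:E)%E
  = (qf (suffix_Delta s) h)%:E.
Proof.
move=> E; under eq_esum do rewrite (bcoefE _ (a_nil i) (hm i)).
rewrite /= /iter_defect -(prednK (hm i)).
apply: resolvent_sum => //.
  by move=> l; rewrite (prednK (hm i)); exact: (suffix_Delta_pos E).
have E' : enum 'I_k = rcons s1 i ++ s by rewrite cat_rcons.
apply: (@squeeze_cvgr _ _ _ _ (fun=> 0) (fun p => qf (iter p (Ph i) bop_id) h)) => //.
- apply: nearW => p; rewrite qf_ge0 /=; last by apply: Phi_iter_pos => //;
  exact: (suffix_Delta_pos0 E').
  rewrite -subr_ge0 -qfB -Phi_iterB//; apply: qf_ge0; apply: Phi_iter_pos => //.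
  exact: (suffix_Delta_le1 E').
- exact: cvg_cst.
- exact: Phi_iter_cvg0.
Qed.

(** Keeping the words outside s empty allows sums over the words of s alone to be indexed by full
    multi-words. *)
Definition supp_in (s : seq 'I_k) : set (mword n) := [set b | forall i, i \notin s -> b i = [::]].

Lemma suffix_sum s1 s h : enum 'I_k = s1 ++ s ->
  (\esum_(b in supp_in s) ((\prod_(i <- s) bcoef (a i) (m i) (b i)) * qf (suffix_Delta s)
    (suffix_adj s b h))%:E)%E = (norm2 h)%:E.
Proof.
have bc0 i w : 0 <= bcoef (a i) (m i) w.
  by rewrite (bcoefE _ (a_nil i) (hm i)) bpow_ge0.
elim: s s1 h => [|i s IH] s1 h E.
  pose b0 : mword n := [ffun i => [::]].
  have -> : supp_in [::] = [set b0].
    apply/seteqP; split => [b hb|_ ->]; last by move=> i _; rewrite ffunE.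
    by apply/ffunP => i; rewrite ffunE; apply: hb.
  by rewrite esum_set1 big_nil mul1r /= qf_id// lee_fin norm2_ge0.
have E' : enum 'I_k = rcons s1 i ++ s by rewrite cat_rcons.
have := enum_uniq 'I_k; rewrite E cat_uniq /= => /and4P[_ _ is_ us].
have pZ := suffix_Delta_pos0 E; have pZ' := suffix_Delta_pos0 E'.
rewrite -(IH (rcons s1 i) h E').
have prodE (b : mword n) w : \prod_(j <- s) bcoef (a j) (m j) (@set_word k n b i w j) =
  \prod_(j <- s) bcoef (a j) (m j) (b j).
  by apply: eq_big_seq => j js; rewrite set_word_out//; apply: contraNneq is_ => ->.
have adjE_ (b : mword n) w : suffix_adj s (@set_word k n b i w) = suffix_adj s b.
  rewrite /suffix_adj; elim: {IH}s is_ {us pZ pZ' prodE E E'} => //= j t IHt;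
    rewrite inE negb_or => /andP[ij it].
  by rewrite IHt// set_word_out.
(* A multi-word supported in i :: s is one supported in s together with its i-th word. *)
rewrite (reindex_esum (supp_in s `*`` fun=> [set: seq 'I_(n i)]) (supp_in (i :: s)) (fun x =>
  @set_word k n x.1 i x.2)); last first.
  split => /=.
  - move=> [b w] [/= hb _] j; rewrite inE negb_or => /andP[ji js].
    by rewrite set_word_out 1?eq_sym// hb.
  - move=> [b w] [b' w']; rewrite !inE /= => -[hb _] [hb' _] E1.
    have ww : w = w' by have := congr1 (fun d : mword n => d i) E1; rewrite !set_word_in.
    congr (_, _) => //; apply/ffunP => j; have [<-|ij] := eqVneq i j.
      by rewrite hb// hb'.
    by have := congr1 (fun d : mword n => d j) E1; rewrite !set_word_out.
  - move=> b hb; exists (@set_word k n b i [::], b i) => /=;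
    last by rewrite set_word_set_word set_word_id.
    split => // j js; have [<-|ij] := eqVneq i j; first by rewrite set_word_in.
    by rewrite set_word_out// hb// inE negb_or eq_sym ij.
rewrite -(@esum_esum _ _ _ (supp_in s) (fun=> [set: seq 'I_(n i)]) (fun b w =>
   ((\prod_(j <- i :: s) bcoef (a j) (m j) (@set_word k n b i w j)) * qf (suffix_Delta (i :: s))
     (suffix_adj (i :: s) (@set_word k n b i w) h))%:E)); last first.
  by move=> b w _ _; rewrite lee_fin mulr_ge0 ?qf_ge0// prodr_ge0.
apply: eq_esum => b _.
rewrite EFinM -(one_sum _ E) -esum_scale; last 2 first.
- by apply: prodr_ge0 => j _; exact: bc0.
- by move=> w; rewrite lee_fin mulr_ge0 ?qf_ge0.
apply: eq_esum => w _; rewrite -EFinM; congr EFin.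
by rewrite big_cons prodE set_word_in mulrCA mulrA [suffix_adj (i :: s) _]/= -/(suffix_adj s _)
  adjE_ set_word_in bop_compE.
Qed.

Lemma berezin_sum h :
  (\esum_(b in [set: mword n]) ((\prod_i bcoef (a i) (m i) (b i)) * qf (Delta a T m bop_id)
    (mopword_adj T b h))%:E)%E = (norm2 h)%:E.
Proof.
rewrite -(@suffix_sum [::] (enum 'I_k) h)//.
have -> : supp_in (enum 'I_k) = setT.
  by apply/seteqP; split => // b _ i; rewrite mem_enum.
by apply: eq_esum => b _; rewrite big_enum.
Qed.

End SuffixSum.
End MultiPhi.

(** * The square root of the defect operator *)

Section DefectSqrt.
Context {R : realType} {H : hilbertType R} (A : bop H H).
Hypothesis pA : positive_op A.
Notation Q := (sqrt_op A).
Notation DS := (proj (closed_range A) \oB Q).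

(** The component v of Q x orthogonal to the range of A satisfies A v = 0, hence Q v = 0 because |Q
    v|^2 = <A v, v>; then v is orthogonal to Q x itself. *)
Lemma sqrt_range x : cset (closed_range A) (Q x).
Proof.
have [pQ QQ] := sqrt_opP pA.
have [m Mm hm] := projection_exists (closed_range A) (Q x).
suff v0 : Q x - m = 0 by move/eqP: v0; rewrite subr_eq0 => /eqP ->.
set v := Q x - m in hm *.
have Av : A v = 0.
  apply: hdot_ext => y; rewrite hdot0l positive_hdotC//; apply: hm.
  by apply: subset_closure; exists y.
have Qv : Q v = 0.
  by apply: hdot_eq0; rewrite -positive_hdotC// -[Q (Q v)]/((Q \oB Q) v) QQ Av hdot0l.
apply: hdot_eq0; rewrite {2}/v hdotBr (hm m)// subr0.
by rewrite -positive_hdotC// Qv hdot0l.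
Qed.

Lemma incl_defect_sqrt x : incl (closed_range A) (DS x) = Q x.
Proof.
have mP : Q x \in cpred (closed_range A) by apply/asboolP; exact: sqrt_range.
by rewrite bop_compE -[X in proj _ X]/(incl (closed_range A) (SubH mP)) proj_id.
Qed.

Lemma norm2_defect_sqrt x : norm2 (DS x) = qf A x.
Proof.
have [pQ QQ] := sqrt_opP pA.
apply: (@complexI R); rewrite -norm2_hdot -qfE// -[hdot _ _]/(hdot (incl _ (DS x)) (incl _ (DS
  x))).
by rewrite incl_defect_sqrt -positive_hdotC// -bop_compE QQ.
Qed.

(** A x = Q (Q x), so the range of the square root contains that of A, which is dense in the defect
    space by definition. *)
Lemma defect_sqrt_total : total (range DS).
Proof.
have [pQ QQ] := sqrt_opP pA.
apply/totalP => z hz; apply: hdot_eq0.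
have h x : hdot (incl (closed_range A) z) (A x) = 0.
  have -> : A x = Q (Q x) by rewrite -[RHS]/((Q \oB Q) x) QQ.
  rewrite -incl_defect_sqrt; exact: (hz (DS (Q x)) (ex_intro2 _ _ (Q x) I erefl)).
rewrite -[hdot z z]/(hdot (incl (closed_range A) z) (incl (closed_range A) z)).
have /asboolP := sub_subproof z; rewrite -/(incl (closed_range A) z) => cz.
have sub : lspan (range A) `<=` range A.
  apply: lspan_ind; first by exists 0; rewrite // bop0.
  by move=> c _ _ [x _ <-] [y _ <-]; exists (c *: x + y); rewrite // bop_linear.
apply: (@cspan_orth R H (range A)) => [_ [x _ <-]|]; first exact: h.
rewrite /=; apply: closure_subset cz; exact: lspan_sub.
Qed.
End DefectSqrt.

Lemma tens2_total_sub (R : realType) (A D : hilbertType R) (E : htensor2 A D) (I : Type) (e :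
  I -> A) :
  total (range e) -> total (range (fun p : I * D => tens2 E (e p.1) p.2)).
Proof.
move=> te; apply/totalP => z hz;
  apply: (totalP _).1 (tens2_total_range E) _ _ => _ [[x y] _ <-] /=.
have [Z ZE] := tens2_slot E y.
rewrite -ZE adjE'; suff -> : adj Z z = 0 by rewrite hdot0l.
by apply: (totalP _).1 te _ _ => _ [i _ <-]; rewrite -adjE' ZE; apply: hz; exists (i, y).
Qed.

(** * The weighted shifts on the tensor product of Fock spaces *)

Section Model.
Context {R : realType} {k : nat} {n : 'I_k -> nat} (hn : forall i, (0 < n i)%N).
Variable a : forall i : 'I_k, seq 'I_(n i) -> R.
Arguments a : clear implicits.
Hypothesis ha : forall i, positive_regular (a i).
Variable m : 'I_k -> nat.
Hypothesis hm : forall i, (0 < m i)%N.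
Context {F : forall i : 'I_k, fock R (n i)} (E : htensor (fun i => fspace (F i))).

Let a_ge0 i w : 0 <= a i w. Proof. by case: (ha i). Qed.
Let a_nil i : a i [::] = 0. Proof. by case: (ha i). Qed.
Let a_gt0 i j : 0 < a i [:: j]. Proof. by case: (ha i). Qed.

Notation bc i := (bcoef (a i) (m i)).

Lemma bc_gt0 i w : 0 < bc i w.
Proof. by rewrite (bcoefE _ (a_nil i) (hm i)) -(prednK (hm i)); exact: bpow_gt0. Qed.

Lemma bc_cons i j w : a i [:: j] * bc i w <= bc i (j :: w).
Proof. by rewrite !(bcoefE _ (a_nil i) (hm i)) -(prednK (hm i)); exact: bpow_cons. Qed.

Definition shift_weight i j w : R := Num.sqrt (bc i w / bc i (j :: w)).
Arguments shift_weight : clear implicits.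

Lemma shift_weight_ge0 i j w : 0 <= shift_weight i j w. Proof. exact: sqrtr_ge0. Qed.

Lemma shift_weight_bound i j w : `|shift_weight i j w| <= Num.sqrt (a i [:: j])^-1.
Proof.
rewrite ger0_norm ?shift_weight_ge0// ler_wsqrtr// ler_pdivrMr ?bc_gt0//.
by rewrite mulrC ler_pdivlMr// mulrC bc_cons.
Qed.

Lemma wshiftE i j w : wshift (a i) (m i) (F i) j (fock_basis (F i) w) =
  (shift_weight i j w)%:C *: fock_basis (F i) (j :: w).
Proof.
have [Z ZE _] := @shift_bop R _ _ _ _ _ _ (cons j) (shift_weight i j) _ (fock_orthonormal (hn i)
  (F i))
  (fock_total (hn i) (F i)) (fock_orthonormal (hn i) (F i)) (fun u v e => congr1 behead e)
  (shift_weight_bound j) (sqrtr_ge0 _).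
rewrite /wshift; set P := [set _ | _].
have PZ : P Z by exact: ZE.
by have := xgetI 0 PZ; exact.
Qed.

Notation W i j := (@Wmodel _ _ _ _ E a m i j).

Definition cons_word (i : 'I_k) (j : 'I_(n i)) (b : mword n) :
  mword n := @set_word k n b i (j :: b i).
Arguments cons_word : clear implicits.

Lemma Wmodel_ebasis i j (b : mword n) : W i j (ebasis E b) =
  (shift_weight i j (b i))%:C *: ebasis E (cons_word i j b).
Proof.
apply: (ampliation_ebasis hn E (wshiftE j) _ (shift_weight_bound j) (sqrtr_ge0 _)).
by move=> u v [].
Qed.

Lemma Wmodel_commuting : commuting (Wmodel E a m).
Proof.
move=> s t st j l x; rewrite -!bop_compE; congr (bop_fun _ x).
apply: (@bop_total_eq R E E _ _ _ (ebasis_total hn E)) => _ [b _ <-].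
have ts : t != s by rewrite eq_sym.
rewrite !bop_compE !Wmodel_ebasis !bopZ !Wmodel_ebasis !scalerA /cons_word !(set_word_out _ _
  st) !(set_word_out _ _ ts) [in LHS]mulrC; congr (_ *: ebasis E _).
apply/ffunP => r; have [<-|sr] := eqVneq s r;
  first by rewrite set_word_in (set_word_out _ _ ts) set_word_in.
rewrite (set_word_out _ _ sr); have [<-|tr] := eqVneq t r; first by rewrite !set_word_in.
by rewrite !(set_word_out _ _ tr) (set_word_out _ _ sr).
Qed.

Definition sqrt_bcoef (b : mword n) : R := \prod_i Num.sqrt (bc i (b i)).

Lemma sqrt_bcoef_ge0 b : 0 <= sqrt_bcoef b. Proof. by apply: prodr_ge0 => i _;
  exact: sqrtr_ge0. Qed.

Lemma sqrt_bcoef_sqr b : sqrt_bcoef b ^+ 2 = \prod_i bc i (b i).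
Proof. by rewrite /sqrt_bcoef -prodrXl; apply: eq_bigr => i _;
  rewrite sqr_sqrtr// ltW// bc_gt0. Qed.

(** The weights of W_ij are quotients of the coefficients of the kernel; this cancellation is what
    makes the kernel intertwine. *)
Lemma sqrt_bcoef_cons_word i j (b : mword n) :
  shift_weight i j (b i) * sqrt_bcoef (cons_word i j b) = sqrt_bcoef b.
Proof.
rewrite /sqrt_bcoef (bigD1 i)//= set_word_in mulrA -sqrtrM; last first.
  by rewrite divr_ge0// ltW// bc_gt0.
rewrite divfK ?gt_eqF ?bc_gt0// [RHS](bigD1 i)//=; congr (_ * _).
by apply: eq_bigr => l li; rewrite set_word_out// eq_sym.
Qed.

(** Guarantees that sums over [homog q] are finite sums and not the default value 0 of an infinitely
    supported one. *)
Lemma finite_homog q : finite_set (@homog k n q).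
Proof.
pose X (s : seq 'I_k) := [set b : mword n | forall i, (size (b i) <= q)%N /\ (i \notin s ->
  b i = [::])].
have fX s : finite_set (X s).
  elim: s => [|i s IH].
    apply: (@sub_finite_set _ _ [set [ffun i => [::]] : mword n]); last exact: finite_set1.
    by move=> b hb; apply/ffunP => i; rewrite ffunE; exact: (hb i).2.
  pose Wq := \bigcup_(p in `I_q.+1) [set w : seq 'I_(n i) | size w = p].
  have fW : finite_set Wq.
    by apply: bigcup_finite => [|p _]; [exact: finite_II|exact: finite_words].
  apply: sub_finite_set (finite_image (fun x => @set_word k n x.1 i x.2) (finite_setX IH fW)).
  move=> b hb; exists (@set_word k n b i [::], b i);
    last by rewrite /= set_word_set_word set_word_id.
  split => /=; last by exists (size (b i)) => //=; rewrite ltnS; exact: (hb i).1.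
  move=> j; have [<-|ij] := eqVneq i j; first by rewrite set_word_in.
  rewrite set_word_out//; split; first exact: (hb j).1.
  by move=> js; apply: (hb j).2; rewrite inE negb_or eq_sym ij.
apply: sub_finite_set (fX (enum 'I_k)) => b hb i; split; last by rewrite mem_enum.
have <- : (\sum_(l < k) size (b l))%N = q := hb.
by rewrite (bigD1 i)//= leq_addr.
Qed.
End Model.

(** * The Berezin kernel *)

Section Berezin.
Context {R : realType} {k : nat} {n : 'I_k -> nat} (hn : forall i, (0 < n i)%N).
Variable a : forall i : 'I_k, seq 'I_(n i) -> R.
Arguments a : clear implicits.
Hypothesis ha : forall i, positive_regular (a i).
Variable m : 'I_k -> nat.
Hypothesis hm : forall i, (0 < m i)%N.
Context {F : forall i : 'I_k, fock R (n i)} (E : htensor (fun i => fspace (F i))).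
Context {H : hilbertType R} (T : forall i : 'I_k, 'I_(n i) -> bop H H).
Arguments T : clear implicits.
Hypothesis hT : polydomain a m T.
Hypothesis hTpure : pure a T.
Variable ED : htensor2 E (subH (defect_space a m T)).

Notation Dl := (Delta a T m bop_id).
Notation DS := (defect_sqrt a m T).
Notation sqrt_bcoef := (sqrt_bcoef a m).
Notation eb := (ebasis E).
Notation W i j := (@Wmodel _ _ _ _ E a m i j).

Let pD : positive_op Dl. Proof. by case: hT => _ _; apply. Qed.

Definition berezin_entry b h := DS (mopword_adj T b h).

Lemma norm2_DS x : norm2 (DS x) = qf Dl x. Proof. exact: norm2_defect_sqrt. Qed.

Lemma tens_orth b c (x y : subH (defect_space a m T)) : b != c ->
  hdot (tens2 ED (eb b) x) (tens2 ED (eb c) y) = 0.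
Proof. by move=> bc; rewrite tens2_dot (ebasis_orthonormal hn E) (negPf bc) mul0r. Qed.

Lemma norm2_tens_eb b (x : subH (defect_space a m T)) : norm2 (tens2 ED (eb b) x) = norm2 x.
Proof.
apply: (@complexI R); rewrite -!norm2E tens2_norm exprMn.
by rewrite [`|eb b| ^+ 2]hdot_norm (ebasis_orthonormal hn E) eqxx mul1r.
Qed.

Definition berezin_term h b : ED := (sqrt_bcoef b)%:C *: tens2 ED (eb b) (berezin_entry b h).
Definition berezin_level h q : ED := \sum_(b \in homog q) berezin_term h b.

Lemma berezin_term_orth h b c : b != c -> hdot (berezin_term h b) (berezin_term h c) = 0.
Proof. by move=> bc; rewrite hdotZl hdotZr tens_orth// !mulr0. Qed.

Lemma norm2_berezin_term h b : norm2 (berezin_term h b) =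
  (\prod_i bcoef (a i) (m i) (b i)) * qf Dl (mopword_adj T b h).
Proof.
rewrite norm2Z norm2_tens_eb norm2_DS -(sqrt_bcoef_sqr ha hm); congr (_ * _).
by rewrite ger0_norm ?lecR ?sqrt_bcoef_ge0// -rmorphXn rpC.
Qed.

Lemma berezin_level_seq h q : berezin_level h q =
  \sum_(b <- finmap.enum_fset (fset_set (@homog k n q))) berezin_term h b.
Proof. by rewrite /berezin_level fsbig_finite//; exact: finite_homog. Qed.

Lemma norm2_berezin_level h q : norm2 (berezin_level h q) =
  \sum_(b \in homog q) (\prod_i bcoef (a i) (m i) (b i)) * qf Dl (mopword_adj T b h).
Proof.
rewrite berezin_level_seq norm2_sum_seq; [|exact: finmap.fset_uniq|exact: berezin_term_orth].
rewrite fsbig_finite; last exact: finite_homog.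
by apply: eq_bigr => b _; rewrite norm2_berezin_term.
Qed.

Lemma berezin_level_orth h p q : p != q -> hdot (berezin_level h p) (berezin_level h q) = 0.
Proof.
move=> pq; rewrite !berezin_level_seq hdot_suml big1_seq// => b /andP[_ bp].
rewrite hdot_sumr big1_seq// => c /andP[_ cq]; apply: berezin_term_orth.
apply: contraNneq pq => bc; move: bp cq; rewrite !in_fset_set; try exact: finite_homog.
by rewrite !inE /homog /= bc => <- <-.
Qed.

Lemma norm2_berezin_level_cvg h : (fun N => \sum_(0 <= q < N) norm2 (berezin_level h q) :
  R^o) @ \oo --> (norm2 h : R^o).
Proof.
under eq_fun do under eq_bigr do rewrite norm2_berezin_level.
apply: (esum_graded_lim (nu := fun b : mword n => (\sum_(i < k) size (b i))%N)).
- by move=> q; exact: finite_homog.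
- move=> b; rewrite mulr_ge0 ?qf_ge0//; apply: prodr_ge0 => i _.
  by rewrite ltW// bc_gt0.
- exact: (berezin_sum ha hm hT hTpure).
Qed.

(** Distinct levels are orthogonal and, by [berezin_sum], their squared norms add up to that of h:
    this gives at once convergence of the series and the isometry. *)
Lemma berezin_exists : exists K : bop H ED, isometric K /\
  forall h, (fun N => \sum_(0 <= q < N) berezin_level h q) @ \oo --> K h.
Proof.
have bound h N : \sum_(0 <= q < N) norm2 (berezin_level h q) <= norm2 h.
  have := @norm2_berezin_level_cvg h => /cvg_lim <-//.
  apply: (@nondecreasing_cvgn_le _ (fun N => \sum_(0 <= q < N) norm2 (berezin_level h q))).
    by apply/nondecreasing_seqP => p; rewrite big_nat_recr//= lerDl norm2_ge0.
  by apply/cvg_ex; exists (norm2 h); exact: norm2_berezin_level_cvg.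
have /choice[f fP] : forall h, exists l : ED, (fun N => \sum_(0 <=
  q < N) berezin_level h q) @ \oo --> l.
  by move=> h; apply: (orth_series (C := norm2 h)) => //; exact: berezin_level_orth.
have zl c x y q : berezin_level (c *: x + y) q = c *: berezin_level x q + berezin_level y q.
  rewrite !berezin_level_seq scaler_sumr -big_split; apply: eq_bigr => b _ /=.
  by rewrite /berezin_term /berezin_entry !bop_linear tens2_linearr scalerDr !scalerA mulrC.
have lf : linear f.
  move=> c x y; apply: (@cvg_unique _ (@norm_hausdorff _ ED) _ _ _ _ (fP _)).
  have -> : (fun N => \sum_(0 <= q < N) berezin_level (c *: x + y) q) =
      (fun N => c *: (\sum_(0 <= q < N) berezin_level x q) + \sum_(0 <= q < N) berezin_level y q).
    by apply: funext => N; rewrite scaler_sumr -big_split; apply: eq_bigr => q _; rewrite zl.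
  by apply: cvgD; [apply: cvgZr|]; exact: fP.
have fn x : norm2 (f x) = norm2 x.
  have h1 : (fun N => norm2 (\sum_(0 <= q < N) berezin_level x q) :
    R^o) @ \oo --> (norm2 (f x) : R^o).
    have h1 : (fun N => `|\sum_(0 <= q < N) berezin_level x q| : R[i]^o) @ \oo --> (`|f x| :
      R[i]^o).
      by apply: cvg_norm; exact: fP.
    have h2 : (fun N => `|\sum_(0 <= q < N) berezin_level x q| * `|\sum_(0 <=
      q < N) berezin_level x q| : R[i]^o) @ \oo --> (`|f x| * `|f x| : R[i]^o).
      exact: (cvgM h1 h1).
    exact: rp_cvg h2.
  have h2 := @norm2_berezin_level_cvg x.
  have e : (fun N => norm2 (\sum_(0 <= q < N) berezin_level x q) : R^o) = (fun N => \sum_(0 <=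
    q < N) norm2 (berezin_level x q)).
    by apply: funext => N; rewrite norm2_sum_orth// => p q; exact: berezin_level_orth.
  by apply: (@cvg_unique _ (@norm_hausdorff _ R^o) _ _ _ _ _ h2); rewrite -e.
have fi x : `|f x| = `|x| by apply/eqP; rewrite -(@eqrXn2 _ 2)//; rewrite !norm2E fn.
have [K KE] := @mk_bop R H ED f 1 lf (fun x => eq_ind_r (fun z => z <=
  1 * `|x|) (eq_ind_r (fun z => `|x| <= z) (lexx _) (mul1r _)) (fi x)).
by exists K; split => [x|x]; rewrite KE.
Qed.

Notation K := (berezin ED).

Lemma berezinP : isometric K /\ forall h, (fun N => \sum_(0 <=
  q < N) berezin_level h q) @ \oo --> K h.
Proof.
have [K0 [K0i K0P]] := berezin_exists.
suff -> : K = K0 by [].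
rewrite /berezin; set P := [set _ | _].
have PK0 : P K0 by exact: K0P.
have PK : P (xget 0 P) by exact: xgetI PK0.
apply: bopP => h; exact: (@cvg_unique _ (@norm_hausdorff _ ED) _ _ _ _ (PK h) (PK0 h)).
Qed.

Lemma berezin_coef h b y : hdot (K h) (tens2 ED (eb b) y) =
  (sqrt_bcoef b)%:C * hdot (berezin_entry b h) y.
Proof.
have [_ KP] := berezinP.
have h1 : (fun N => hdot (\sum_(0 <= q < N) berezin_level h q) (tens2 ED (eb b) y) :
  R[i]^o) @ \oo -->
   (hdot (K h) (tens2 ED (eb b) y) : R[i]^o) by apply: hdot_cvgl; exact: (KP h).
apply: (@cvg_unique _ (@norm_hausdorff _ R[i]^o) _ _ _ _ h1).
(* Only the term b, which sits in level p, meets e_b; the partial sums are constant as soon as they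
   include this level. *)
apply/cvgrPdist_lt => e e0; pose p := (\sum_(i < k) size (b i))%N.
exists p.+1 => // N pN; rewrite [X in _ - X](_ : _ =
  (sqrt_bcoef b)%:C * hdot (berezin_entry b h) y) ?subrr ?normr0//.
have zb0 c : c != b -> hdot (berezin_term h c) (tens2 ED (eb b) y) = 0.
  by move=> cb; rewrite hdotZl tens_orth// mulr0.
rewrite hdot_suml (bigD1_seq p) ?iota_uniq//=; last by rewrite mem_index_iota.
rewrite [X in _ + X]big1 ?addr0 => [|q qp]; last first.
  rewrite berezin_level_seq hdot_suml big1_seq// => c /andP[_ cq]; apply: zb0.
  apply: contraNneq qp => cb; move: cq; rewrite in_fset_set; last exact: finite_homog.
  by rewrite inE /homog /= cb /p => <-.
rewrite berezin_level_seq hdot_suml (bigD1_seq b) ?finmap.fset_uniq//=; last first.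
  by rewrite in_fset_set ?inE//; exact: finite_homog.
rewrite [X in _ + X]big1 ?addr0 => [|c cb]; last exact: zb0.
by rewrite hdotZl tens2_dot (ebasis_orthonormal hn E) eqxx mul1r.
Qed.

(** The new letter stands first in its word, so its adjoint acts first within that factor; it then
    moves past the adjoints of all other indices by commutation. *)
Lemma mopword_adj_cons_word i j b h : mopword_adj T (cons_word j b) h =
  mopword_adj T b (adj (T i j) h).
Proof.
have letter t : t != i -> forall w x, adj (opword (T t) w) (adj (T i j) x) =
  adj (T i j) (adj (opword (T t) w) x).
  move=> ti w x; have := adj_opword_comm (polydomain_commuting hT) ti w [:: j] x.
  have -> : opword (T i) [:: j] = T i j by apply: bopP.
  by [].
rewrite /mopword_adj.
have : i \in enum 'I_k by rewrite mem_enum.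
elim: (enum 'I_k) (enum_uniq 'I_k) => //= t s IH /andP[ts us]; rewrite inE.
have comm s' x : i \notin s' ->
  foldr (fun l (A : bop H H) => adj (opword (T l) (b l)) \oB A) bop_id s' (adj (T i j) x) =
  adj (T i j) (foldr (fun l (A : bop H H) => adj (opword (T l) (b l)) \oB A) bop_id s' x).
  elim: s' => //= l s' IH'; rewrite inE negb_or => /andP[il is'].
  by rewrite IH'// letter// eq_sym.
case: eqP => [it _|/eqP it /= is_].
  subst t; rewrite comm//= /cons_word set_word_in /= adj_comp /=; congr (adj _ (adj _ _)).
  elim: s ts {IH us} => //= l s IH; rewrite inE negb_or => /andP[il is_].
  by rewrite set_word_out// IH.
by rewrite IH// /cons_word set_word_out.
Qed.

Lemma berezin_intertwine_adj i j h x y :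
  hdot (K h) (tens2 ED (W i j x) y) = hdot (K (adj (T i j) h)) (tens2 ED x y).
Proof.
have [Z ZE] := tens2_slot ED y.
rewrite -!ZE !adjE' -bop_compE.
suff : forall b, hdot (adj (W i j) (adj Z (K h))) (eb b) =
  hdot (adj Z (K (adj (T i j) h))) (eb b).
  by move=> e; rewrite bop_compE; congr hdot; exact: (total_ext (ebasis_total hn E) e).
move=> b; rewrite -!adjE' !ZE (Wmodel_ebasis hn ha hm) tens2Zl hdotZr conj_rp !berezin_coef.
by rewrite mulrA -rmorphM (sqrt_bcoef_cons_word ha hm) /berezin_entry mopword_adj_cons_word.
Qed.

End Berezin.

(** * Words, monomials and dilations *)

Section WordTheory.
Context {R : realType} {k : nat} {n : 'I_k -> nat}.

Definition empty_word : mword n := [ffun=> [::]].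

Section OneFamily.
Context {H : hilbertType R} (X : forall i : 'I_k, 'I_(n i) -> bop H H).
Arguments X : clear implicits.

Lemma mopword_empty : mopword X empty_word = bop_id.
Proof.
apply: bopP => x; rewrite /mopword; elim: (enum 'I_k) => //= i s IH.
by rewrite IH ffunE.
Qed.

Hypothesis hX : commuting X.

Lemma letter_mopword i (j : 'I_(n i)) b : X i j \oB mopword X b = mopword X (cons_word j b).
Proof.
apply: bopP => x; rewrite bop_compE /mopword.
have : i \in enum 'I_k by rewrite mem_enum.
elim: (enum 'I_k) (enum_uniq 'I_k) => //= t s IH /andP[ts us]; rewrite inE.
case: eqP => [it _|/eqP it /= is_].
  subst t; rewrite /cons_word set_word_in /=; congr (X i j (opword (X i) (b i) _)).
  elim: s ts {IH us} => //= l s IH; rewrite inE negb_or => /andP[il is_].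
  by rewrite set_word_out// IH.
have ti : t != i by rewrite eq_sym.
by rewrite -(opword_letter_comm hX ti) IH// /cons_word set_word_out.
Qed.

Lemma mopword_letter i (j : 'I_(n i)) : mopword X (cons_word j empty_word) = X i j.
Proof. by rewrite -letter_mopword mopword_empty; apply: bopP. Qed.

Definition monomial (s : seq {i : 'I_k & 'I_(n i)}) : bop H H :=
  foldr (fun ij B => X (tag ij) (tagged ij) \oB B) bop_id s.

(** Letters of different indices commute, so any product of letters can be sorted by index. *)
Lemma monomial_mopword s : exists b, monomial s = mopword X b.
Proof.
elim: s => [|[i j] s [b IH]]; first by exists empty_word; rewrite mopword_empty.
by exists (cons_word j b); rewrite -letter_mopword -IH.
Qed.

End OneFamily.

Lemma mopword_intertwine (U V : hilbertType R) (X : forall i : 'I_k, 'I_(n i) -> bop U U)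
    (Y : forall i : 'I_k, 'I_(n i) -> bop V V) (A : bop U V) :
  (forall i j, A \oB X i j = Y i j \oB A) -> forall b, A \oB mopword X b = mopword Y b \oB A.
Proof.
move=> h b; apply: bopP => x; rewrite !bop_compE.
have hA i j y : A (X i j y) = Y i j (A y) by rewrite -!bop_compE h.
rewrite /mopword; elim: (enum 'I_k) => //= i s <-.
by elim: (b i) => //= j w IH; rewrite hA IH.
Qed.

Lemma amplify_mopword (A D : hilbertType R) (AD : htensor2 A D)
    (X : forall i : 'I_k, 'I_(n i) -> bop A A) b :
  amplify AD (mopword X b) = mopword (fun i j => amplify AD (X i j)) b.
Proof.
apply: op_tens2_unique => x y; rewrite /mopword.
elim: (enum 'I_k) => //= i s ->.
by elim: (b i) => //= j w ->; rewrite op_tens2E.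
Qed.

End WordTheory.

Section Dilation.
Context {R : realType} {k : nat} {n : 'I_k -> nat} {N H : hilbertType R}.
Variables (S : forall i : 'I_k, 'I_(n i) -> bop N N) (T : forall i : 'I_k, 'I_(n i) -> bop H H).
Arguments S : clear implicits.
Arguments T : clear implicits.
Context {D : hilbertType R} (ND : htensor2 N D) (V : bop H ND).

Lemma adj_amplify X : adj (amplify ND X) = amplify ND (adj X).
Proof. exact: op_tens2_adj. Qed.

Lemma amplify_comp X Y : amplify ND (Y \oB X) = amplify ND Y \oB amplify ND X.
Proof. exact: op_tens2_comp. Qed.

Lemma intertwine_mopword : (forall i j, adj V \oB amplify ND (S i j) = T i j \oB adj V) ->
  forall b, adj V \oB amplify ND (mopword S b) = mopword T b \oB adj V.
Proof. by move=> h b; rewrite amplify_mopword; exact: mopword_intertwine. Qed.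

Lemma intertwine_dilation : isometric V ->
  (forall i j, adj V \oB amplify ND (S i j) = T i j \oB adj V) -> is_dilation S T V.
Proof.
move=> iV h; split => // [i j|b].
  move=> _ [x _ <-]; exists (adj (T i j) x) => //.
  by rewrite -bop_compE -[V in LHS]adjK -adj_comp -h adj_comp adjK.
rewrite intertwine_mopword//; apply: bopP => x; rewrite !bop_compE.
by rewrite -[adj V (V x)]bop_compE isometric_adj.
Qed.

(** Co-invariance puts the adjoint of S_ij (x) I, applied to V x, into the range of V, where V V^*
    is the identity; the compression formula then upgrades to an intertwining. *)
Lemma dilation_intertwine : commuting S -> commuting T -> is_dilation S T V ->
  forall i j, adj V \oB amplify ND (S i j) = T i j \oB adj V.
Proof.
move=> cS cT [iV co dil] i j.
have e : T i j = adj V \oB amplify ND (S i j) \oB V.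
  by rewrite -(mopword_letter cT) dil (mopword_letter cS).
rewrite -[LHS]adjK -[RHS]adjK; congr adj; rewrite !adj_comp adjK; apply: bopP => x.
have [y _ yE] := co i j (V x) (ex_intro2 _ _ x I erefl).
rewrite !bop_compE -yE; congr (V _).
rewrite e !adj_comp adjK !bop_compE -yE.
by rewrite -[adj V (V y)]bop_compE isometric_adj.
Qed.

End Dilation.

(** * Compression to N_J *)

Section Constrained.
Context {R : realType} {k : nat} {n : 'I_k -> nat} (hn : forall i, (0 < n i)%N).
Variable a : forall i : 'I_k, seq 'I_(n i) -> R.
Arguments a : clear implicits.
Hypothesis ha : forall i, positive_regular (a i).
Variable m : 'I_k -> nat.
Hypothesis hm : forall i, (0 < m i)%N.
Context {F : forall i : 'I_k, fock R (n i)} (E : htensor (fun i => fspace (F i))).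
Notation W := (Wmodel E a m).
Variable J : set (bop E E).
Hypothesis hJ : wot_left_ideal W J.
Notation S := (Smodel W J).
Notation P := (proj (NJ J)).

Lemma MJ_sub g x : J g -> MJ J (g x).
Proof. by move=> Jg; apply: subset_closure; apply: lspan_sub; exists g, x. Qed.

Lemma NJ_orth y : (forall g x, J g -> hdot y (g x) = 0) -> cset (NJ J) y.
Proof. by move=> h; apply: cspan_orth => _ [g [x [Jg ->]]]; exact: h. Qed.

Lemma hardy_letter i (j : 'I_(n i)) : hardy W (W j).
Proof.
exists (fun=> W j); split => [l|x]; last exact: cvg_cst.
apply: lspan_sub; exists [:: Tagged (fun i => 'I_(n i)) j] => /=.
by apply: bopP.
Qed.

(** J is a left ideal and W_ij belongs to the Hardy algebra, so W_ij g is again in J for g in J. *)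
Lemma adj_Wmodel_NJ i (j : 'I_(n i)) y : cset (NJ J) y -> cset (NJ J) (adj (W j) y).
Proof.
move=> Ny; apply: NJ_orth => g x Jg; rewrite -adjE' -bop_compE; apply: Ny.
by apply: MJ_sub; case: hJ => _ _ _ h _; apply: h => //; exact: hardy_letter.
Qed.

Lemma proj_Wmodel i (j : 'I_(n i)) : P \oB W j = S j \oB P.
Proof.
apply: bopP => x; rewrite /Smodel !bop_compE; apply: hdot_ext => y;
  rewrite !proj_dot !(adjE (W j)).
have /asboolP Ny := sub_subproof y.
have mP : adj (W j) (incl (NJ J) y) \in cpred (NJ J) by apply/asboolP; exact: adj_Wmodel_NJ.
by rewrite -[adj (W j) _]/(incl (NJ J) (SubH mP)) -!proj_dot proj_id.
Qed.

(** Transferred from W through P, which intertwines the two families and is onto. *)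
Lemma Smodel_commuting : commuting S.
Proof.
have e i (u : 'I_(n i)) y : S u (P y) = P (W u y) by rewrite -!bop_compE proj_Wmodel.
by move=> s t st j l x; rewrite -[x]proj_id !e (Wmodel_commuting hn ha hm st).
Qed.

Context {H : hilbertType R} (T : forall i : 'I_k, 'I_(n i) -> bop H H).
Arguments T : clear implicits.
Hypothesis hT : polydomain a m T.
Hypothesis hTpure : pure a T.
Hypothesis hTJ : forall g, J g -> calculus W T g 0.
Variables (ED : htensor2 E (subH (defect_space a m T)))
  (ND : htensor2 (subH (NJ J)) (subH (defect_space a m T))).
Notation K := (berezin ED).
Notation KJ := (constrained_berezin ED ND).

Lemma berezin_intertwine i j : adj K \oB amplify ED (W j) = T i j \oB adj K.
Proof.
apply: (@bop_total_eq _ _ _ _ _ _ (tens2_total_range ED)) => _ [[x y] _ <-];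
  rewrite [(x, y).1]/= [(x, y).2]/=.
apply: hdot_ext => h; rewrite !bop_compE op_tens2E.
rewrite (adjE (T i j)) !(adjE (adj K)) adjK [LHS]hdotC [RHS]hdotC.
by rewrite (berezin_intertwine_adj hn ha hm hT hTpure).
Qed.

Lemma berezin_word b : adj K \oB amplify ED (mopword W b) = mopword T b \oB adj K.
Proof. by apply: intertwine_mopword => i j; exact: berezin_intertwine. Qed.

Lemma adj_berezin_J g x y : J g -> adj K (tens2 ED (g x) y) = 0.
Proof.
move=> Jg; have [c fc hc] := hTJ Jg.
have [Z ZE] := tens2_slot ED y.
suff : adj K \oB Z \oB g = 0.
  by move=> /(congr1 (fun A : bop E H => A x)); rewrite !bop_compE ZE.
apply: (@bop_total_eq _ _ _ _ _ _ (ebasis_total hn E)) => _ [w _ <-].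
(* By the intertwining, T_b z is the image of W_b e_w (x) y. The Fourier series of g at e_w is thus
   mapped to the undamped series of g(T) at z, whose sum Abel's theorem identifies with g(T) z =
   0. *)
rewrite bop0E; pose z := adj K (Z (ebasis E w)).
have TE b : mopword T b z = (adj K \oB Z) (mopword W b (ebasis E w)).
  by rewrite /z -bop_compE -berezin_word !bop_compE !ZE op_tens2E.
have h1 : (fun M => \sum_(0 <= q < M) \sum_(b \in homog q) c b *: mopword T b z) @ \oo -->
    (adj K \oB Z \oB g) (ebasis E w).
  have -> : (fun M => \sum_(0 <= q < M) \sum_(b \in homog q) c b *: mopword T b z) =
      (adj K \oB Z) \o (fun M => \sum_(0 <=
        q < M) \sum_(b \in homog q) c b *: mopword W b (ebasis E w)).
    apply: funext => M; rewrite compE bop_sum; apply: eq_bigr => q _.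
    rewrite !fsbig_finite; try exact: finite_homog.
    by rewrite bop_sum; apply: eq_bigr => b _; rewrite bopZ TE.
  exact: (@bop_cvg R _ _ (adj K \oB Z) _ _ _ _ _ (fc w)).
have [y' hy y0] := hc z.
apply: (abel_limit h1 _ y0) => r r1; apply: cvg_trans (hy r r1).
apply: near_eq_cvg; near=> M; apply: eq_bigr => q _.
rewrite !fsbig_finite; try exact: finite_homog.
by rewrite scaler_sumr; apply: eq_bigr => b _; rewrite scalerA.
Unshelve. all: by end_near. Qed.

(** The adjoint form of the inclusion of K H in N_J (x) D: each slice of K h along a vector y of D
    is orthogonal to all g x with g in J. *)
Lemma adj_berezin_proj : adj K \oB amplify ED (incl (NJ J) \oB P) = adj K.
Proof.
apply: (@bop_total_eq _ _ _ _ _ _ (tens2_total_range ED)) => _ [[x y] _ <-];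
  rewrite [(x, y).1]/= [(x, y).2]/=.
rewrite bop_compE op_tens2E bop_compE; have [Z ZE] := tens2_slot ED y.
rewrite -!ZE; apply: hdot_ext => h; rewrite !(adjE (adj _)) adjK !(adjE Z).
have mP : adj Z (K h) \in cpred (NJ J).
  apply/asboolP; apply: NJ_orth => g v Jg.
  by rewrite -adjE' ZE hdotC (adjE' K) adj_berezin_J// hdot0l conjC0.
by rewrite -[adj Z _]/(incl (NJ J) (SubH mP)) -[RHS]proj_dot -proj_dot proj_id.
Qed.

Lemma adj_constrained : adj KJ = adj K \oB op_tens2 ND ED (incl (NJ J)) bop_id.
Proof. by rewrite adj_comp op_tens2_adj adj_proj. Qed.

Lemma amplify_incl_proj : amplify ED (incl (NJ J) \oB P) =
  op_tens2 ND ED (incl (NJ J)) bop_id \oB op_tens2 ED ND P bop_id.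
Proof. exact: op_tens2_comp. Qed.

Lemma constrained_isometric : isometric KJ.
Proof.
have [iK _] := berezinP hn ha hm hT hTpure ED.
have e : adj KJ \oB KJ = bop_id.
  rewrite adj_constrained -(isometric_adj iK) -[in RHS]adj_berezin_proj amplify_incl_proj.
  by apply: bopP.
move=> x; apply/eqP; rewrite -(@eqrXn2 _ 2)//; rewrite !hdot_norm adjE -bop_compE.
by rewrite e.
Qed.

Lemma constrained_intertwine i j : adj KJ \oB amplify ND (S j) = T i j \oB adj KJ.
Proof.
have e : op_tens2 ND ED (incl (NJ J)) bop_id \oB amplify ND (S j) =
    amplify ED (incl (NJ J) \oB P) \oB amplify ED (W j) \oB op_tens2 ND ED (incl (NJ J)) bop_id.
  by rewrite /amplify -!op_tens2_comp; congr op_tens2; apply: bopP.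
have e2 : T i j \oB adj KJ = T i j \oB adj K \oB op_tens2 ND ED (incl (NJ J)) bop_id.
  by rewrite adj_constrained; apply: bopP.
rewrite e2 -berezin_intertwine adj_constrained.
transitivity (adj K \oB (op_tens2 ND ED (incl (NJ J)) bop_id \oB amplify ND (S j)));
  first by apply: bopP.
by rewrite e -[in RHS]adj_berezin_proj; apply: bopP.
Qed.

Lemma constrained_dilation : is_dilation S T KJ.
Proof. apply: intertwine_dilation;
  [exact: constrained_isometric|exact: constrained_intertwine]. Qed.

End Constrained.

(** The uniform bound C carries convergence from the span of B to its closure. *)
Lemma strong_cvg_total (R : realType) (U V : hilbertType R) (B : set U) (A_ : nat ->
  bop U V) (A : bop U V) (C : R) :
  total B -> (forall M x, `|A_ M x| <= C%:C * `|x|) ->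
  (forall x, B x -> (fun M => A_ M x) @ \oo --> A x) ->
  forall x, (fun M => A_ M x) @ \oo --> A x.
Proof.
move=> tB bA cA x.
have [C' C'0 bA'] := bop_bounded A.
have sub : lspan B `<=` [set x | (fun M => A_ M x) @ \oo --> A x].
  apply: lspan_ind => [|c u v Bu cv] /=.
    by under eq_fun do rewrite bop0; rewrite bop0; exact: cvg_cst.
  under eq_fun do rewrite bop_linear.
  by rewrite bop_linear; apply: cvgD => //; apply: cvgZr; exact: cA.
apply/cvg_seqP => e e0.
pose D := `|C| + C' + 1.
have D0 : 0 < D by rewrite addr_gt0// ltr_wpDl.
have e3 : 0 < (e / 2 / D)%:C :> R[i] by rewrite ltcR !divr_gt0.
have : closure (lspan B) x by rewrite tB.
move=> /closure_normP/(_ _ e3)[u Bu xu].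
have := sub u Bu; move=> /cvg_seqP/(_ (e / 2)); rewrite divr_gt0// => /(_ isT)[M0 hM].
exists M0 => M /hM uM.
have -> : A x - A_ M x = (A u - A_ M u) + (A (x - u) - A_ M (x - u)).
  by rewrite !bopB addrACA subrKC -opprD subrKC.
apply: le_lt_trans (ler_normD _ _) _; rewrite [e]splitr rmorphD /=; apply: ltrD => //.
apply: le_lt_trans (ler_normB _ _) _.
apply: (@le_lt_trans _ _ (D%:C * `|x - u|)).
  rewrite /D !rmorphD /= !mulrDl mul1r addrC -addrA; apply: lerD.
    by apply: le_trans (bA _ _) _; rewrite ler_wpM2r// lecR ler_norm.
  by apply: le_trans (bA' _) _; rewrite lerDl.
apply: (@lt_le_trans _ _ (D%:C * (e / 2 / D)%:C)); first by rewrite ltr_pM2l// ltcR.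
by rewrite -rmorphM lecR mulrC divfK// gt_eqF.
Qed.

Section WordShift.
Context {R : realType} {T : choiceType} (a : seq T -> R).
Hypothesis a_ge0 : forall w, 0 <= a w.

(** The coefficients of the monomial Z_w times the series with coefficients phi. *)
Definition shift_word (w : seq T) (phi : seq T -> R) (v : seq T) : R :=
  if take (size w) v == w then phi (drop (size w) v) else 0.

Lemma shift_word_cons j w phi v : shift_word (j :: w) phi v =
  if v is j' :: u then if j' == j then shift_word w phi u else 0 else 0.
Proof.
by case: v => [|j' u] //; rewrite /shift_word /= eqseq_cons; case: (j' == j).
Qed.

(** The part of the convolution that comes from the terms of degree p of a. The value 0 for p > size
    v allows a common cut-off N for all words. *)
Definition wconv_term (phi : seq T ->
  R) v p := if (p <= size v)%N then a (take p v) * phi (drop p v) else 0.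

Lemma wconv_termE phi v N : (size v < N)%N ->
  \sum_(0 <= p < N) wconv_term phi v p = wconv a phi v.
Proof.
move=> vN; rewrite (big_cat_nat (leq0n _) vN) /= [X in _ + X]big_nat_cond [X in _ +
  X]big1 ?addr0; last first.
  by move=> p /andP[/andP[vp _] _]; rewrite /wconv_term leqNgt vp.
rewrite big_mkord; apply: eq_bigr => p _.
by rewrite /wconv_term -ltnS ltn_ord.
Qed.

Lemma wconv_term_ge0 phi v p : (forall u, 0 <= phi u) -> 0 <= wconv_term phi v p.
Proof. by move=> h; rewrite /wconv_term; case: ifP => // _; rewrite mulr_ge0. Qed.

Lemma wconv_partial phi v N : (forall u, 0 <= phi u) ->
  0 <= \sum_(0 <= p < N) wconv_term phi v p <= wconv a phi v.
Proof.
move=> h; apply/andP; split; first by apply: sumr_ge0 => p _; exact: wconv_term_ge0.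
rewrite -(@wconv_termE phi v (N + (size v).+1)); last by rewrite addnS ltnS leq_addl.
rewrite [leRHS](big_cat_nat (leq0n _) (leq_addr _ _)) /= lerDl.
by apply: sumr_ge0 => p _; exact: wconv_term_ge0.
Qed.
End WordShift.

(** Among the words of length p only the prefix of v contributes. *)
Lemma wconv_term_sum (R : realType) (n : nat) (a : seq 'I_n -> R) phi v p :
  \sum_(w : p.-tuple 'I_n) a w * shift_word w phi v = wconv_term a phi v p.
Proof.
rewrite /wconv_term; case: leqP => pv; last first.
  rewrite big1// => w _; rewrite /shift_word size_tuple take_oversize 1?ltnW//.
  by case: eqP => [vw|]; rewrite ?mulr0//; move: pv; rewrite vw size_tuple ltnn.
have sw : size (take p v) == p by rewrite size_takel.
rewrite (bigD1 (Tuple sw))//= /shift_word /= (eqP sw) eqxx big1 ?addr0// => w wv.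
rewrite size_tuple; case: eqP => [e|]; rewrite ?mulr0//.
by case/eqP: wv; apply: val_inj.
Qed.

(** * Minimality *)

Section Minimality.
Context {R : realType} {k : nat} {n : 'I_k -> nat} (hn : forall i, (0 < n i)%N).
Variable a : forall i : 'I_k, seq 'I_(n i) -> R.
Arguments a : clear implicits.
Hypothesis ha : forall i, positive_regular (a i).
Variable m : 'I_k -> nat.
Hypothesis hm : forall i, (0 < m i)%N.
Context {F : forall i : 'I_k, fock R (n i)} (E : htensor (fun i => fspace (F i))).
Context {H : hilbertType R} (T : forall i : 'I_k, 'I_(n i) -> bop H H).
Arguments T : clear implicits.
Hypothesis hT : polydomain a m T.
Hypothesis hTpure : pure a T.
Variable ED : htensor2 E (subH (defect_space a m T)).

Notation W := (Wmodel E a m).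
Notation DS := (defect_sqrt a m T).
Notation eb := (ebasis E).
Notation K := (berezin ED).
Notation bc i := (bcoef (a i) (m i)).

Let a_ge0 i w : 0 <= a i w. Proof. by case: (ha i). Qed.
Let a_nil i : a i [::] = 0. Proof. by case: (ha i). Qed.
Let bc0 i w : 0 < bc i w. Proof. exact: bc_gt0. Qed.

Variable z : ED.
Hypothesis hz : forall b h, hdot (amplify ED (mopword W b) (K h)) z = 0.

(** Arbitrary sequences of letters are taken instead of multi-words, so that in [good_conj] a letter
    can be appended without sorting. *)
Definition good (X : bop E E) := forall s h, hdot (amplify ED (monomial W s \oB X) (K h)) z = 0.

Lemma good_id : good bop_id.
Proof.
move=> s h; have [b ->] := monomial_mopword (Wmodel_commuting hn ha hm (E := E)) s.
by rewrite -(hz b h); congr (hdot (amplify ED _ _) z); apply: bopP.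
Qed.

Lemma good_lin c X Y : good X -> good Y -> good (c *: X + Y).
Proof.
move=> gX gY s h; have -> : amplify ED (monomial W s \oB (c *: X + Y)) =
    c *: amplify ED (monomial W s \oB X) + amplify ED (monomial W s \oB Y).
  apply: op_tens2_unique => x y; rewrite bopDE bopZE !op_tens2E !bop_compE bopDE bopZE.
  by rewrite bop_linear tens2_linearl.
by rewrite bopDE bopZE hdot_linear gX gY mulr0 addr0.
Qed.

Lemma good_conj i (j : 'I_(n i)) X : good X -> good (W j \oB X \oB adj (W j)).
Proof.
move=> gX s h.
have -> : monomial W s \oB (W j \oB X \oB adj (W j)) =
    monomial W (rcons s (Tagged (fun i => 'I_(n i)) j)) \oB X \oB adj (W j).
  apply: bopP => x; rewrite !bop_compE; move: (X _) => y {h}.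
  by elim: s => //= -[i' j'] s IH; exact: (congr1 (W j') IH).
rewrite amplify_comp bop_compE.
have -> : amplify ED (adj (W j)) (K h) = K (adj (T i j) h).
  rewrite -adj_amplify -[K]adjK -!bop_compE -!adj_comp.
  by rewrite (berezin_intertwine hn ha hm hT hTpure).
exact: gX.
Qed.

Definition good_diag (d : mword n -> R) :=
  exists2 X : bop E E, (forall b, X (eb b) = (d b)%:C *: eb b) & good X.

Lemma good_diag_ext d d' : d =1 d' -> good_diag d -> good_diag d'.
Proof. by move=> e [X XE gX]; exists X => // b; rewrite -e. Qed.

Lemma good_diag1 : good_diag (fun=> 1).
Proof. by exists bop_id; [move=> b; rewrite scale1r|exact: good_id]. Qed.

Lemma good_diag_lin c d d' : good_diag d -> good_diag d' -> good_diag (fun b => c * d b + d' b).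
Proof.
move=> [X XE gX] [Y YE gY]; exists (c%:C *: X + Y); last exact: good_lin.
by move=> b; rewrite bopDE bopZE XE YE scalerA -rmorphM -scalerDl -rmorphD.
Qed.

Lemma good_diag0 : good_diag (fun=> 0).
Proof.
by apply: good_diag_ext (good_diag_lin (-1) good_diag1 good_diag1) => b; rewrite mulr1 addNr.
Qed.

Lemma good_diag_sum (I : Type) (s : seq I) c d : (forall i, good_diag (d i)) ->
  good_diag (fun b => \sum_(i <- s) c i * d i b).
Proof.
move=> h; elim: s => [|i s IH]; first by apply: good_diag_ext good_diag0 => b; rewrite big_nil.
by apply: good_diag_ext (good_diag_lin (c i) (h i) IH) => b; rewrite big_cons.
Qed.

(** Being good is a condition at vectors, hence stable under strong limits; diagonal operators with
    entries bounded by 1 that stabilise at each basis vector converge strongly, also after tensoring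
    with the identity. *)
Lemma good_diag_lim (d_ : nat -> mword n -> R) d : (forall N, good_diag (d_ N)) ->
  (forall N b, `|d_ N b| <= 1) -> (forall b, exists N0, forall N, (N0 <= N)%N ->
    d_ N b = d b) -> good_diag d.
Proof.
move=> gd d1 dlim.
have dd b : `|d b| <= 1 by have [N0 h] := dlim b; rewrite -(h N0).
have [X XE _] := shift_bop (ebasis_orthonormal hn E) (ebasis_total hn E)
  (ebasis_orthonormal hn E) (@inj_id _) dd ler01.
have /choice[X_ hX] : forall N, exists Y : bop E E, [/\ forall b, Y (eb b) = (d_ N b)%:C *: eb b,
    good Y & forall x, `|Y x| <= 1%:C * `|x|].
  move=> N; have [Y YE gY] := gd N; exists Y; split => // x.
  have [Z ZE Zb] := shift_bop (ebasis_orthonormal hn E) (ebasis_total hn E)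
    (ebasis_orthonormal hn E) (@inj_id _) (d1 N) ler01.
  suff -> : Y = Z by [].
  by apply: (bop_total_eq (ebasis_total hn E)) => _ [b _ <-]; rewrite YE ZE.
exists X => // s h.
have cv : (fun N => amplify ED (X_ N) (K h)) @ \oo --> amplify ED X (K h).
  apply: (@strong_cvg_total R ED ED _ _ _ 1 (tens2_total_sub ED (ebasis_total hn E))).
    by move=> N; apply: op_tens2_norm => //; case: (hX N).
  move=> _ [[b y] _ <-] /=; have [N0 hN] := dlim b.
  apply: cvg_near_cst; exists N0 => // N /= NN.
  by rewrite /amplify !op_tens2E XE; have [-> _ _] := hX N; rewrite hN.
set z' := adj (amplify ED (monomial W s)) z.
have c0 : (fun N => hdot (amplify ED (X_ N) (K h)) z' : R[i]^o) @ \oo -->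
    (hdot (amplify ED X (K h)) z' : R[i]^o) by apply: hdot_cvgl; exact: cv.
rewrite amplify_comp bop_compE adjE -/z'.
apply: (@cvg_unique _ (@norm_hausdorff _ R[i]^o) _ _ _ _ c0).
have -> : (fun N => hdot (amplify ED (X_ N) (K h)) z' : R[i]^o) = fun=> 0; last exact: cvg_cst.
apply: funext => N; rewrite -adjE -bop_compE -amplify_comp.
by have [_ g _] := hX N.
Qed.

Section Slot.
Variables (i : 'I_k) (rho : mword n -> R).
Hypothesis rho_set_word : forall b w, rho (@set_word k n b i w) = rho b.

(** Only the numerator at index i varies; [rho] carries the quotients of the other indices. Dividing
    by b^(m_i) absorbs the weights of W_ij under conjugation. *)
Definition dslot (phi : seq 'I_(n i) -> R) (b : mword n) : R := phi (b i) / bc i (b i) * rho b.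

(* W_j X W_j^* prepends the letter j, in the i-th component, to the numerator. *)
Lemma good_diag_letter j (psi phi : seq 'I_(n i) -> R) :
  (forall v, psi v = if v is j' :: u then if j' == j then phi u else 0 else 0) ->
  good_diag (dslot phi) -> good_diag (dslot psi).
Proof.
move=> psiE [X XE gX]; exists (W j \oB X \oB adj (W j)); last exact: good_conj.
have pinj : injective (cons_word j : mword n -> mword n).
  move=> b c e; have := congr1 (fun d : mword n => d i) e; rewrite !set_word_in => -[bci].
  apply/ffunP => l; have [<-//|il] := eqVneq i l.
  by have := congr1 (fun d : mword n => d l) e; rewrite !set_word_out.
have [A1 A2] := shift_adj (ebasis_orthonormal hn E) (ebasis_total hn E)
  (ebasis_orthonormal hn E) pinj (Wmodel_ebasis hn ha hm E j).
move=> c; rewrite !bop_compE.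
have [[u cu]|nc] := pselect (exists u, c i = j :: u).
  have -> : c = cons_word j (@set_word k n c i u).
    by rewrite /cons_word set_word_in set_word_set_word -cu set_word_id.
  set b := @set_word k n c i u.
  rewrite A1 bopZ XE !bopZ (Wmodel_ebasis hn ha hm) !scalerA -!rmorphM; congr (_%:C *: _).
  rewrite /dslot /cons_word rho_set_word set_word_in psiE eqxx.
  have -> : shift_weight a m j (b i) * (phi (b i) / bc i (b i) * rho b) * shift_weight a m j (b
    i) =
    shift_weight a m j (b i) ^+ 2 * (phi (b i) / bc i (b i) * rho b) by rewrite expr2; ring.
  rewrite sqr_sqrtr ?divr_ge0 ?(ltW (bc0 _))//.
  by field; rewrite !gt_eqF.
rewrite A2 => [|b]; last by apply/eqP => e; apply: nc; exists (b i);
  rewrite -e /cons_word set_word_in.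
rewrite !bop0 /dslot psiE; case: (c i) nc => [|j' u] nc; first by rewrite !mul0r scale0r.
case: eqP => [e|_]; last by rewrite !mul0r scale0r.
by case: nc; exists u; rewrite e.
Qed.

Lemma good_diag_shift_word w phi : good_diag (dslot phi) -> good_diag (dslot (shift_word w phi)).
Proof.
elim: w => [|j w IH] gp.
  by apply: good_diag_ext gp => b; rewrite /dslot /shift_word take0 eqxx drop0.
apply: good_diag_letter (IH gp) => v; exact: shift_word_cons.
Qed.

Hypothesis rho01 : forall b, 0 <= rho b <= 1.

(** Subtracting from phi its conjugates with weights a_w, for the words w shorter than N,
    approximates (1 - a) phi = b^(l). The remainders lie between 0 and phi, and phi <= b^(m_i) as l
    < m_i, so all entries stay in [0, 1] and [good_diag_lim] applies. *)
Lemma good_diag_bpow l : (l < m i)%N -> good_diag (dslot (bpow l.+1 (a i))) ->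
  good_diag (dslot (bpow l (a i))).
Proof.
move=> lm gl; pose phi := bpow l.+1 (a i).
have phi0 u : 0 <= phi u by exact: bpow_ge0.
pose d_ N := dslot (fun v => phi v - \sum_(0 <= p < N) wconv_term (a i) phi v p).
apply: (@good_diag_lim d_) => [N|N b|b].
- have gp p : good_diag (dslot (fun v => wconv_term (a i) phi v p)).
    apply: good_diag_ext (good_diag_sum (index_enum {: p.-tuple 'I_(n i)}) (fun w => a i w)
      (fun w => good_diag_shift_word w gl)) => b.
    rewrite /dslot -wconv_term_sum !mulr_suml; apply: eq_bigr => w _.
    by rewrite !mulrA.
  have := good_diag_lin (-1) (good_diag_sum (index_iota 0 N) (fun=> 1) gp) gl.
  apply: good_diag_ext => b; rewrite /d_ /dslot mulrBl mulrBl mulN1r addrC; congr (_ - _).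
  by rewrite !mulr_suml; apply: eq_bigr => p _; rewrite mul1r.
- have /andP[w0 w1] := @wconv_partial R _ (a i) (@a_ge0 i) phi (b i) N phi0.
  have := rho01 b; move=> /andP[r0 r1].
  have h0 : 0 <= phi (b i) - \sum_(0 <= p < N) wconv_term (a i) phi (b i) p.
    rewrite subr_ge0; apply: le_trans w1 _.
    by rewrite /phi [leRHS]bpow_rec// lerDl bpow_ge0.
  rewrite ger0_norm; last by rewrite !mulr_ge0// invr_ge0 ltW.
  apply: mulr_ile1 => //; first by rewrite divr_ge0// ltW.
  rewrite ler_pdivrMr// mul1r (bcoefE _ (a_nil i) (hm i)).
  by apply: (@le_trans _ _ (phi (b i))); [rewrite gerBl|exact: bpow_mono_le].
- exists (size (b i)).+1 => N bN; rewrite /d_ /dslot wconv_termE//.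
  by rewrite /phi [bpow l.+1 _ _]bpow_rec// addrAC subrr add0r.
Qed.
End Slot.

Lemma good_diag_all (l : 'I_k -> nat) : (forall i, (l i <= m i)%N) ->
  good_diag (fun b => \prod_i (bpow (l i) (a i) (b i) / bc i (b i))).
Proof.
(* Induction on the total distance from l up to m; at distance 0 the diagonal operator is the
   identity. *)
have [N] := ubnP (\sum_i (m i - l i))%N; elim: N l => // N IH l lN lm.
have [/forallP e|/forallPn[i /negP li]] := boolP [forall i, l i == m i].
  apply: good_diag_ext good_diag1 => b; rewrite big1// => i _.
  by rewrite (eqP (e i)) -(bcoefE _ (a_nil i) (hm i)) divff// gt_eqF.
have lmi : (l i < m i)%N by rewrite ltn_neqAle lm andbT; apply/negP.
pose l' j := (l j + (j == i))%N.
have lm' j : (l' j <= m j)%N.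
  by rewrite /l'; case: eqP => [->|_]; rewrite ?addn1// addn0.
have : good_diag (fun b => \prod_i (bpow (l' i) (a i) (b i) / bc i (b i))).
  apply: IH => //; move: lN; rewrite !ltnS; apply: leq_trans.
  rewrite (bigD1 i)//= [X in (_ < X)%N](bigD1 i)//= /l' eqxx addn1 -addSn.
  apply: leq_add; first by rewrite subnSK.
  by apply: leq_sum => j /negPf ->; rewrite addn0.
pose rho (b : mword n) := \prod_(j | j != i) (bpow (l j) (a j) (b j) / bc j (b j)).
have rho_set_word b w : rho (@set_word k n b i w) = rho b.
  by apply: eq_bigr => j ji; rewrite set_word_out// eq_sym.
have rho01 b : 0 <= rho b <= 1.
  have h j : 0 <= bpow (l j) (a j) (b j) / bc j (b j) <= 1.
    rewrite divr_ge0 ?bpow_ge0 ?(ltW (bc0 _))//= ler_pdivrMr// mul1r.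
    by rewrite (bcoefE _ (a_nil j) (hm j)) bpow_mono_le.
  by rewrite prodr_ge0 ?prodr_ile1 => // j _; case/andP: (h j).
move=> g; have : good_diag (dslot rho (bpow (l i).+1 (a i))).
  apply: good_diag_ext g => b; rewrite /dslot (bigD1 i)//= /l' eqxx addn1; congr (_ * _).
  by apply: eq_bigr => j /negPf ->; rewrite addn0.
move=> /(good_diag_bpow rho_set_word rho01 lmi); apply: good_diag_ext => b.
by rewrite /dslot [RHS](bigD1 i).
Qed.

(** The case l = 0 of [good_diag_all]: b^(0) is supported by the empty word. *)
Lemma good_diag_vacuum : good_diag (fun b => (b == empty_word)%:R).
Proof.
have := @good_diag_all (fun=> 0%N) (fun=> leq0n _); apply: good_diag_ext => b.
have [->|be] := eqVneq b empty_word.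
  by rewrite big1// => i _; rewrite ffunE (bcoefE _ (a_nil i) (hm i)) !bpow_nil divr1.
have /existsP[i bi] : [exists i, b i != [::]].
  apply: contraNT be => /existsPn h; apply/eqP/ffunP => i; rewrite ffunE.
  by apply/eqP; move: (h i); rewrite negbK.
by rewrite (bigD1 i)//= (negPf bi) !mul0r.
Qed.

(** The vacuum is cyclic because no weight vanishes; the letters of b are peeled off one by one. *)
Lemma monomial_ebasis b : exists s (c : R[i]), c != 0 /\ monomial W s (eb empty_word) = c *: eb b.
Proof.
have [N] := ubnP (\sum_i size (b i))%N; elim: N b => // N IH b bN.
have [->|be] := eqVneq b empty_word.
  by exists [::], 1; rewrite oner_eq0 scale1r.
have /existsP[i bi] : [exists i, b i != [::]].
  apply: contraNT be => /existsPn h; apply/eqP/ffunP => i; rewrite ffunE.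
  by apply/eqP; move: (h i); rewrite negbK.
case bE : (b i) bi => [//|j u] _.
have bp : b = cons_word j (@set_word k n b i u) by rewrite /cons_word set_word_in
  set_word_set_word -bE set_word_id.
have [|s [c [c0 sE]]] := IH (@set_word k n b i u).
  move: bN; rewrite ltnS; apply: leq_trans.
  rewrite (bigD1 i)//= [X in (_ < X)%N](bigD1 i)//= set_word_in bE /= addSn ltnS leq_add2l.
  by apply: leq_sum => l li; rewrite set_word_out// eq_sym.
exists (Tagged (fun i => 'I_(n i)) j :: s), (c * (shift_weight a m j u)%:C); split.
  rewrite mulf_eq0 negb_or c0 /= (inj_eq (@complexI R) _ 0) gt_eqF// sqrtr_gt0 divr_gt0//.
rewrite -[LHS]/(W j (monomial W s (eb empty_word))) sE bopZ (Wmodel_ebasis hn ha hm) set_word_in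
  scalerA.
by rewrite -bp.
Qed.

Lemma berezin_minimal : z = 0.
Proof.
have [P PE gP] := good_diag_vacuum.
have adjP b : adj P (eb b) = ((b == empty_word)%:R)%:C *: eb b.
  apply: (total_ext (ebasis_total hn E)) => c.
  rewrite -adjE' PE hdotZr conj_rp hdotZl (ebasis_orthonormal hn E).
  by have [->|_] := eqVneq b c; rewrite ?mulr0.
have PK h : amplify ED P (K h) = tens2 ED (eb empty_word) (DS h).
  apply: (total_ext (tens2_total_sub ED (ebasis_total hn E))) => -[b y] /=.
  rewrite adjE adj_amplify op_tens2E adjP tens2Zl hdotZr conj_rp.
  rewrite (berezin_coef hn ha hm hT hTpure) tens2_dot (ebasis_orthonormal hn E) eq_sym.
  have [->|_] := eqVneq b empty_word; last by rewrite !mul0r.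
  have -> : sqrt_bcoef a m empty_word = 1.
    by rewrite /sqrt_bcoef big1// => i _;
      rewrite ffunE (bcoefE _ (a_nil i) (hm i)) bpow_nil sqrtr1.
  rewrite !mul1r; congr (hdot (DS _) y).
  by rewrite /mopword_adj; elim: (enum 'I_k) => //= i s ->; rewrite ffunE adj_id.
have pD : positive_op (Delta a T m bop_id) by case: hT => _ _; apply.
apply: (totalP _).1 (tens2_total_sub ED (ebasis_total hn E)) _ _ => _ [[b y] _ <-] /=.
have [s [c [c0 sE]]] := monomial_ebasis b.
(* The adjoint of y |-> e_b (x) y reduces the claim to y = DS h, and such vectors are total in the
   defect space. *)
have [Z ZE] : exists Z : bop (subH (defect_space a m T)) ED, Z =1 tens2 ED (eb b).
  apply: (@mk_bop R _ ED _ `|eb b|); first by move=> u v w; rewrite tens2_linearr.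
  by move=> u; rewrite tens2_norm.
rewrite -ZE adjE'; suff -> : adj Z z = 0 by rewrite hdot0l.
apply: (totalP _).1 (defect_sqrt_total pD) _ _ => _ [h _ <-].
rewrite -adjE' ZE hdotC; apply/eqP; rewrite conjC_eq0; apply/eqP.
have := gP s h; rewrite amplify_comp bop_compE PK op_tens2E sE tens2Zl hdotZl.
by move=> /eqP; rewrite mulf_eq0 (negPf c0) => /eqP.
Qed.
End Minimality.

Section ConstrainedMinimality.
Context {R : realType} {k : nat} {n : 'I_k -> nat} (hn : forall i, (0 < n i)%N).
Variable a : forall i : 'I_k, seq 'I_(n i) -> R.
Arguments a : clear implicits.
Hypothesis ha : forall i, positive_regular (a i).
Variable m : 'I_k -> nat.
Hypothesis hm : forall i, (0 < m i)%N.
Context {F : forall i : 'I_k, fock R (n i)} (E : htensor (fun i => fspace (F i))).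
Notation W := (Wmodel E a m).
Variable J : set (bop E E).
Hypothesis hJ : wot_left_ideal W J.
Notation S := (Smodel W J).
Notation P := (proj (NJ J)).
Context {H : hilbertType R} (T : forall i : 'I_k, 'I_(n i) -> bop H H).
Arguments T : clear implicits.
Hypothesis hT : polydomain a m T.
Hypothesis hTpure : pure a T.
Variables (ED : htensor2 E (subH (defect_space a m T)))
  (ND : htensor2 (subH (NJ J)) (subH (defect_space a m T))).

(** Since P W_b = S_b P, a vector orthogonal to the compressed family becomes, once included in E
    (x) D, orthogonal to the uncompressed one; projecting back recovers it. *)
Lemma constrained_minimal : minimal S (constrained_berezin ED ND).
Proof.
apply/totalP => z hz; pose z' := op_tens2 ND ED (incl (NJ J)) bop_id z.
have z'0 : z' = 0.
  apply: (berezin_minimal hn ha hm hT hTpure) => b h.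
  rewrite /z' -adj_proj -op_tens2_adj -adjE -bop_compE -op_tens2_comp.
  rewrite (mopword_intertwine (proj_Wmodel hJ)) (op_tens2_comp ED ND ND) bop_compE hdotC.
  by rewrite hz ?conjC0//; exists b, h.
have <- : op_tens2 ED ND P bop_id z' = z; last by rewrite z'0 bop0.
rewrite -bop_compE -op_tens2_comp -[RHS]bop_idE; congr (bop_fun _ z).
by apply: op_tens2_unique => x y; rewrite bop_compE proj_id.
Qed.

End ConstrainedMinimality.

(** * Generated C*-algebras and equality of Gram matrices *)

Section CstarGen.
Context {R : realType} {H : hilbertType R} (G : set (bop H H)).

Lemma Cstar_gen_sub : G `<=` Cstar_gen G.
Proof. by move=> A GA B [GB _ _ _ _]; exact: GB. Qed.

Lemma Cstar_gen_id : Cstar_gen G bop_id.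
Proof. by move=> B []. Qed.

Lemma Cstar_gen_comp A B : Cstar_gen G A -> Cstar_gen G B -> Cstar_gen G (A \oB B).
Proof. by move=> cA cB C hC; case: (hC) => _ _ _ h _; apply: h; [exact: cA|exact: cB]. Qed.

Lemma Cstar_gen_adj A : Cstar_gen G A -> Cstar_gen G (adj A).
Proof. by move=> cA C hC; case: (hC) => _ _ _ _ [h _]; apply: h; exact: cA. Qed.
End CstarGen.

Lemma lincomb_norm (R : realType) (U V : hilbertType R) (I : Type) (v : I -> U) (w : I -> V) s :
  (forall p q, hdot (v p) (v q) = hdot (w p) (w q)) -> `|lincomb v s| = `|lincomb w s|.
Proof.
move=> h; apply/eqP; rewrite -(@eqrXn2 _ 2)// !hdot_norm; apply/eqP.
rewrite /lincomb !hdot_suml; apply: eq_bigr => p _; rewrite !hdot_sumr; apply: eq_bigr => q _.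
by rewrite !hdotZl !hdotZr h.
Qed.

(** Equal Gram matrices give equal norms of combinations, so both assignments extend to
    contractions; being inverse to each other, they are isometric. *)
Lemma gram_unitary (R : realType) (U V : hilbertType R) (I : Type) (v : I -> U) (w : I -> V) :
  total (range v) -> total (range w) -> (forall p q, hdot (v p) (v q) = hdot (w p) (w q)) ->
  exists2 Z : bop U V, unitary Z & forall p, Z (v p) = w p.
Proof.
move=> tv tw h.
have [Z Zv Zn] : exists2 Z : bop U V, (forall p, Z (v p) = w p) & forall x, `|Z x| <= 1%:C * `|x|.
  by apply: ext_bop => // s; rewrite mul1r (lincomb_norm s h).
have [Y Yw sqrt_iter] : exists2 Y : bop V U, (forall p, Y (w p) = v p) & forall x, `|Y x| <=
  1%:C * `|x|.
  by apply: ext_bop => // s; rewrite mul1r (lincomb_norm s h).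
have YZ : Y \oB Z = bop_id.
  by apply: (bop_total_eq tv) => _ [p _ <-]; rewrite bop_compE Zv Yw.
have ZY : Z \oB Y = bop_id.
  by apply: (bop_total_eq tw) => _ [p _ <-]; rewrite bop_compE Yw Zv.
have iZ : isometric Z.
  move=> x; apply/eqP; rewrite eq_le; apply/andP; split; first by rewrite -[leRHS]mul1r.
  by rewrite -[x in leLHS]bop_idE -YZ bop_compE -[leRHS]mul1r.
exists Z => //; split; first exact: isometric_adj.
have -> : adj Z = Y.
  apply: bopP => y; rewrite -[y in LHS]bop_idE -ZY bop_compE -bop_compE.
  by rewrite isometric_adj.
by [].
Qed.

(** * Uniqueness *)

Section Uniqueness.
Context {R : realType} {k : nat} {n : 'I_k -> nat} {N H : hilbertType R}.
Variables (S : forall i : 'I_k, 'I_(n i) -> bop N N) (T : forall i : 'I_k, 'I_(n i) -> bop H H).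
Arguments S : clear implicits.
Arguments T : clear implicits.
Hypotheses (cS : commuting S) (cT : commuting T).

Section Compression.
Context {D : hilbertType R} (ND : htensor2 N D) (V : bop H ND).
Hypothesis dV : is_dilation S T V.

Lemma compress_words b c :
  adj V \oB amplify ND (mopword S b \oB adj (mopword S c)) \oB V =
    mopword T b \oB adj (mopword T c).
Proof.
have h := intertwine_mopword (dilation_intertwine cS cT dV).
have h' : amplify ND (adj (mopword S c)) \oB V = V \oB adj (mopword T c).
  by rewrite -adj_amplify -[V in LHS]adjK -adj_comp h adj_comp adjK.
have [iV _ _] := dV.
transitivity (adj V \oB amplify ND (mopword S b) \oB (amplify ND (adj (mopword S c)) \oB V)).
  by rewrite amplify_comp; apply: bopP.
rewrite h' h.
transitivity (mopword T b \oB (adj V \oB V) \oB adj (mopword T c)); first by apply: bopP.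
by rewrite isometric_adj//; apply: bopP.
Qed.

Lemma amplify_lin c X Y : amplify ND (c *: X + Y) = c *: amplify ND X + amplify ND Y.
Proof.
apply: op_tens2_unique => x y; rewrite !bopDE !bopZE !op_tens2E.
by rewrite tens2_linearl.
Qed.

Lemma compress_dot b c h h' :
  hdot (amplify ND (mopword S b) (V h)) (amplify ND (mopword S c) (V h')) =
  hdot ((adj V \oB amplify ND (adj (mopword S c) \oB mopword S b) \oB V) h) h'.
Proof.
by rewrite amplify_comp !bop_compE (adjE (adj V)) adjK -adj_amplify (adjE (adj _)) adjK.
Qed.

(** V is isometric and amplification preserves bounds, so the estimate is uniform in the dilation;
    it lets [compress_eq] pass to the norm closure. *)
Lemma compress_close e (A B : bop N N) x y : 0 <= e -> (forall u, `|A u - B u| <= e * `|u|) ->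
  `|hdot ((adj V \oB amplify ND A \oB V) x) y - hdot ((adj V \oB amplify ND B \oB V) x) y|
    <= e * (`|x| * `|y|).
Proof.
move=> e0 AB; have [iV _ _] := dV.
rewrite -hdotBl !bop_compE -bopB (adjE (adj V)) adjK.
apply: le_trans (cauchy_schwarz _ _) _; rewrite iV mulrA ler_wpM2r// -[`|x|]iV.
have -> : amplify ND A (V x) - amplify ND B (V x) = amplify ND (A - B) (V x).
  rewrite -scaleN1r addrC -[RHS]/(amplify ND (A - B) _).
  by rewrite -bopZE -bopDE -amplify_lin scaleN1r addrC.
by rewrite (rpK e0); apply: op_tens2_norm; rewrite ?rp_ge0// => u; rewrite bopBE -rpK.
Qed.

End Compression.

Hypothesis hC : norm_closure (lspan [set A | exists b c : mword n,
    A = bop_comp (mopword S b) (adj (mopword S c))]) =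
  Cstar_gen [set A | exists i j, A = S i j].
Context {D1 D2 : hilbertType R} (ND1 : htensor2 N D1) (ND2 : htensor2 N D2).
Variables (V1 : bop H ND1) (V2 : bop H ND2).
Hypotheses (dV1 : is_dilation S T V1) (dV2 : is_dilation S T V2).

Lemma compress_eq A : Cstar_gen [set A | exists i j, A = S i j] A ->
  adj V1 \oB amplify ND1 A \oB V1 = adj V2 \oB amplify ND2 A \oB V2.
Proof.
rewrite -hC => cA; apply: bopP => x.
have lsE B : lspan [set A | exists b c : mword n, A =
  bop_comp (mopword S b) (adj (mopword S c))] B ->
    adj V1 \oB amplify ND1 B \oB V1 = adj V2 \oB amplify ND2 B \oB V2.
  move: B; apply: lspan_ind => [|c X Y [b [d ->]] IH].
    have e0 (D : hilbertType R) (ND : htensor2 N D) : amplify ND 0 = 0.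
      by apply: op_tens2_unique => u v; rewrite !bop0E tens20l.
    by rewrite !e0; apply: bopP => u; rewrite !bop_compE !bop0E !bop0.
  have e (D : hilbertType R) (ND : htensor2 N D) (V : bop H ND) (X' Y' : bop N N) :
      adj V \oB amplify ND (c *: X' + Y') \oB V =
      c *: (adj V \oB amplify ND X' \oB V) + (adj V \oB amplify ND Y' \oB V).
    apply: bopP => u; rewrite bopDE bopZE !bop_compE amplify_lin bopDE bopZE.
    by rewrite bop_linear.
  by rewrite !e IH !compress_words.
apply: hdot_ext => y; apply/eqP; rewrite -subr_eq0 -normr_le0; apply/ler_addgt0Pr => e e0.
(* One half of e for each of the two dilations; the + 1 covers the case where x or y is 0. *)
rewrite add0r; pose d := e / 2 / (`|x| * `|y| + 1).
have D0 : 0 < `|x| * `|y| + 1 by rewrite ltr_wpDl// mulr_ge0.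
have d0 : 0 < d by rewrite !divr_gt0.
have [B lB AB] := cA d d0.
have BA u : `|B u - A u| <= d * `|u| by rewrite distrC.
have dle : d * (`|x| * `|y|) <= e / 2.
  rewrite /d mulrAC ler_pdivrMr// ler_wpM2l//; first by rewrite ltW// divr_gt0.
  by rewrite lerDl.
rewrite [e]splitr.
have := le_trans (compress_close dV2 x y (ltW d0) BA) dle.
have := le_trans (compress_close dV1 x y (ltW d0) AB) dle.
rewrite (lsE _ lB); set p := hdot _ _; set q := hdot _ _; set r := hdot _ _ => h1 h2.
by have -> : p - r = (p - q) + (q - r) by [rewrite addrA subrK];
  apply: le_trans (ler_normD _ _) (lerD h1 h2).
Qed.

Hypotheses (mV1 : minimal S V1) (mV2 : minimal S V2).

Lemma Cstar_mopword b : Cstar_gen [set A | exists i j, A = S i j] (mopword S b).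
Proof.
rewrite /mopword; elim: (enum 'I_k) => [|i s IH] /=; first exact: Cstar_gen_id.
apply: Cstar_gen_comp => //; elim: (b i) => [|j w IH'] /=; first exact: Cstar_gen_id.
by apply: Cstar_gen_comp => //; apply: Cstar_gen_sub; exists i, j.
Qed.

Lemma minimal_total (D : hilbertType R) (ND : htensor2 N D) (V : bop H ND) : minimal S V ->
  total (range (fun p : mword n * H => amplify ND (mopword S p.1) (V p.2))).
Proof.
move=> mV; rewrite /total -mV; congr (closure (lspan _)); apply/seteqP; split => z.
  by move=> [[b h] _ <-]; exists b, h.
by move=> [b [h ->]]; exists (b, h).
Qed.

Lemma minimal_dilations_isomorphic : isomorphic_dilations S V1 V2.
Proof.
have [[b h] [c h']|U uU UE] := gram_unitary (minimal_total mV1) (minimal_total mV2).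
  rewrite /= !compress_dot// compress_eq//.
  by apply: Cstar_gen_comp; [apply: Cstar_gen_adj|]; exact: Cstar_mopword.
exists U; split => // [i j|].
  apply: (bop_total_eq (minimal_total mV1)) => _ [[b h] _ <-].
  have sh (D : hilbertType R) (ND : htensor2 N D) (V : bop H ND) :
      amplify ND (S i j) (amplify ND (mopword S b) (V h)) =
        amplify ND (mopword S (cons_word j b)) (V h).
    by rewrite -bop_compE -amplify_comp letter_mopword.
  by rewrite /= sh (UE (b, h)) sh (UE (cons_word j b, h)).
(* At the empty word, the correspondence of the two spanning families reads U V1 = V2. *)
have id_amp (D : hilbertType R) (ND : htensor2 N D) : amplify ND (mopword S empty_word) = bop_id.
  by apply: op_tens2_unique => x y; rewrite mopword_empty.
by apply: bopP => h; have := UE (empty_word, h); rewrite /= !id_amp.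
Qed.

End Uniqueness.

Theorem theorem2p7 (R : realType) (k : nat) (hk : (0 < k)%N)
  (n m : 'I_k -> nat) (hn : forall i, (0 < n i)%N) (hm : forall i, (0 < m i)%N)
  (a : forall i : 'I_k, seq 'I_(n i) -> R)
  (ha : forall i, positive_regular (a i))
  (F : forall i : 'I_k, fock R (n i)) (E : htensor (fun i => fspace (F i)))
  (J : set (bop E E))
  (hJ : wot_left_ideal (Wmodel E a m) J)
  (hN : exists2 y : E, cset (NJ J) y & y <> 0)
  (H : hilbertType R) (hH : separable H)
  (T : forall i : 'I_k, 'I_(n i) -> bop H H)
  (hT : polydomain a m T) (hTpure : pure a T)
  (hTJ : forall g, J g -> calculus (Wmodel E a m) T g 0)
  (ED : htensor2 E (subH (defect_space a m T)))
  (ND : htensor2 (subH (NJ J)) (subH (defect_space a m T))) :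
  let S := Smodel (Wmodel E a m) J in
  let K := constrained_berezin ED ND in
  [/\ forall i j, coinvariant (amplify ND (S i j)) (range K),
      is_dilation S T K &
      cset (NJ J) (vacuum E) ->
      minimal S K /\
      ((forall i, positive_regular_poly (a i)) ->
       norm_closure (lspan [set A | exists b c : mword n,
         A = bop_comp (mopword S b) (adj (mopword S c))]) =
         Cstar_gen [set A | exists i j, A = S i j] ->
       forall (D1 D2 : hilbertType R) (ND1 : htensor2 (subH (NJ J)) D1)
         (ND2 : htensor2 (subH (NJ J)) D2) (V1 : bop H ND1) (V2 : bop H ND2),
         separable D1 -> separable D2 ->
         is_dilation S T V1 -> minimal S V1 ->
         is_dilation S T V2 -> minimal S V2 ->
         isomorphic_dilations S V1 V2)].
Proof.
move=> S K; have dK : is_dilation S T K by exact: constrained_dilation.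
split=> //; first by case: dK.
move=> _; split; first exact: constrained_minimal.
move=> _ hC D1 D2 ND1 ND2 V1 V2 _ _ d1 m1 d2 m2.
apply: (minimal_dilations_isomorphic _ (polydomain_commuting hT)) => //.
exact: Smodel_commuting.
Qed.
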